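(* Let $f\in\mathcal{S}$ be given by $f(z)=z+\sum_{n=2}^{\infty}a_nz^n$ for $|z|<1$, and suppose that $a_2=0$. Then (i) $|a_5|\le \dfrac{3}{4}+\dfrac{1}{\sqrt{7}}=1.12796\ldots$; (ii) $|H_3(1)|\le c_1$, where $c_1=1.026\ldots$ is the constant defined in the context.
   Context: $\mathbb{D}=\{z\in\mathbb{C}:|z|<1\}$ is the open unit disk. $\mathcal{S}$ is the class of functions $f$ that are analytic and univalent (injective) in $\mathbb{D}$ and have the form $f(z)=z+a_2z^2+a_3z^3+\cdots$ (i.e. $f(0)=0$, $f'(0)=1$). The third Hankel determinant of such an $f$ is $$H_3(1)=a_3(a_2a_4-a_3^2)-a_4(a_4-a_2a_3)+a_5(a_3-a_2^2).$$ The constant $c_1$ is $$c_1=\max_{0\le y\le 1/2}\left(2y^{3}+\frac{4}{5}(1-3y^{2})+\frac{4}{\sqrt{7}}\,y\sqrt{1-3y^{2}}\right)=1.026\ldots,$$ where dots after a decimal indicate a truncated decimal expansion. *)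

(* Defs.v *)
(* Stdlib reals and Coquelicot's complex numbers. *)
From Stdlib Require Import Reals Lra ClassicalEpsilon.
From Coquelicot Require Import Coquelicot.

Open Scope R_scope.

Definition in_disk (z : C) : Prop := Cmod z < 1.

(* [f] is total, and its values outside the disk play no role.  The explicit
   [C_AbsRing] makes the derivative the complex one, since [C] is also a normed
   module over the reals. *)
Record class_S (f : C -> C) : Prop := {
  S_analytic : forall z : C, in_disk z ->
    @ex_derive C_AbsRing C_NormedModule f z;
  S_univalent : forall z w : C, in_disk z -> in_disk w -> f z = f w -> z = w;
  S_zero : f (RtoC 0) = RtoC 0;
  S_deriv_one : @is_derive C_AbsRing C_NormedModule f (RtoC 0) (RtoC 1)
}.

Definition normalized_expansion (f : C -> C) (a : nat -> C) : Prop :=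
  a 0%nat = RtoC 0 /\ a 1%nat = RtoC 1 /\
  forall z : C, in_disk z -> @is_pseries C_AbsRing C_NormedModule a z (f z).

Definition hankel3 (a : nat -> C) : C :=
  (a 3%nat * (a 2%nat * a 4%nat - a 3%nat * a 3%nat)
   - a 4%nat * (a 4%nat - a 2%nat * a 3%nat)
   + a 5%nat * (a 3%nat - a 2%nat * a 2%nat))%C.

Definition is_max_on (g : R -> R) (u v m : R) : Prop :=
  (exists y : R, u <= y <= v /\ g y = m) /\
  (forall y : R, u <= y <= v -> g y <= m).

Definition c_1_fun (y : R) : R :=
  2 * y ^ 3 + 4 / 5 * (1 - 3 * y ^ 2)
  + 4 / sqrt 7 * y * sqrt (1 - 3 * y ^ 2).

Lemma c_1_exists : exists m : R, is_max_on c_1_fun 0 (1 / 2) m.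
Proof.
  destruct (continuity_ab_maj c_1_fun 0 (1 / 2)) as [x [Hx Hx01]].
  - lra.
  - intros c Hc.
    assert (Hs : continuity_pt (fun y => sqrt (1 - 3 * y ^ 2)) c).
    { apply (continuity_pt_comp (fun y => 1 - 3 * y ^ 2) sqrt).
      - reg.
      - apply continuity_pt_sqrt; nra. }
    unfold c_1_fun.
    apply (continuity_pt_plus
             (fun y => 2 * y ^ 3 + 4 / 5 * (1 - 3 * y ^ 2))
             (fun y => 4 / sqrt 7 * y * sqrt (1 - 3 * y ^ 2))).
    + reg.
    + apply (continuity_pt_mult (fun y => 4 / sqrt 7 * y)
               (fun y => sqrt (1 - 3 * y ^ 2))).
      * apply (continuity_pt_mult (fun _ => 4 / sqrt 7) (fun y => y)); reg.
      * exact Hs.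
  - exists (c_1_fun x); split; [now exists x | exact Hx].
Qed.

Definition c_1 : R := proj1_sig (constructive_indefinite_description _ c_1_exists).

Lemma c_1_is_max : is_max_on c_1_fun 0 (1 / 2) c_1.
Proof. exact (proj2_sig (constructive_indefinite_description _ c_1_exists)). Qed.

(* Main.v *)
(* Area-type inequalities are obtained without computing areas, from the conditional positivity of
   the logarithmic energy.  For points w, w' of the plane,
   |w-w'|^2 + e = (1+A)(1+A')(1 - <v,v'>)/2 with A = |w|^2 + e/2 and v in the unit ball of R^3
   (stereographic projection), and -ln (1 - <v,v'>) is a sum of powers <v,v'>^n/n, so a charge of
   total mass 0 has nonnegative energy.  Put the charge e^(-it) + sum_k c_k e^(ikt) on the image of
   the circle |z| = r under an injective holomorphic F = z + ..., and split
     ln |F(z)-F(w)|^2 = ln |z-w|^2 + ln |(F(z)-F(w))/(z-w)|^2.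
   The first term gives 1 + sum |c_k|^2/k; the second is the real part of a function holomorphic in
   both variables, and the mean value property leaves only the coefficients of 1/z - 1/F(z).
   Choosing the c_k optimally gives sum k |b_k|^2 <= 1 when 1/F(z) = 1/z - sum b_k z^k.

   With F = f and a_2 = 0 this gives |a_3| <= 1.  With F(z) = sqrt(f(z^2)) it gives
   3 |b_3|^2 + 5 |b_5|^2 + 7 |b_7|^2 <= 1, where b_3 = a_3/2, b_5 = a_4/2, b_7 = a_5/2 - 3 a_3^2/8,
   and a_5 and the Hankel determinant are polynomials in b_3, b_5, b_7. *)

Require Import Defs.
From Stdlib Require Import Reals Lra Lia ZArith Psatz.
From Coquelicot Require Import Coquelicot.

Open Scope R_scope.

(** * Continuity and complex derivatives *)

(** The shift e is more than a regularization: for one choice of e tied to a parameter rho < 1,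
    |z-w|^2 + e on the circle is a constant times |1 - rho e^(i(t-s))|^2, so the regularized kernel
    stays diagonal in Fourier modes. The price is that ln (q a + e) no longer splits as ln q + ln (a
    + e); the defect is dominated by e/(a+e), a multiple of the Poisson kernel whose mass tends to 0
    as rho -> 1. No singular integral ever occurs. The only tool of complex analysis is the mean
    value property, for functions merely continuous at the centre and on the boundary circle, so
    difference quotients extended by their limits qualify as they stand. It also shows that an
    injective function has no critical point. No two-variable logarithm is chosen: ln |H|^2 enters
    through its angular derivative, that is through H'/H. Both area inequalities are needed at the
    end: the one for the root transform alone would allow |b_3| up to 1/sqrt 3, and |a_3| <= 1 cuts
    this to |b_3| <= 1/2, the range of y in the definition of c_1. *)

Definition ccont {X : UniformSpace} (f : X -> C) (x : X) : Prop :=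
  @continuous X C_UniformSpace f x.

(** Neighbourhoods in [C_UniformSpace] are squares; since |z| is at most sqrt 2 times the larger
    coordinate and sqrt 2 < 2, the square of half-side d/2 fits into the disk of radius d. *)
Lemma locally_Cmod (z : C) (P : C -> Prop) :
  @locally C_UniformSpace z P <->
  exists d, 0 < d /\ forall w, Cmod (w - z) < d -> P w.
Proof.
  split.
  - intros [e He]. exists e; split; [apply cond_pos|]. intros w Hw.
    apply He. apply C_NormedModule_mixin_compat1. exact Hw.
  - intros [d [Hd H]].
    assert (Hd2 : 0 < d / 2) by lra.
    exists (mkposreal _ Hd2). intros w [H1 H2]. apply H.
    assert (Hs : sqrt 2 < 2).
    { rewrite <- (sqrt_Rsqr 2) at 2 by lra. apply sqrt_lt_1; unfold Rsqr; lra. }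
    assert (Hs0 : 0 < sqrt 2) by (apply sqrt_lt_R0; lra).
    eapply Rle_lt_trans; [apply Cmod_2Rmax|].
    change (Rabs (fst w - fst z) < d / 2) in H1.
    change (Rabs (snd w - snd z) < d / 2) in H2.
    apply Rlt_trans with (sqrt 2 * (d / 2)); [|nra].
    apply Rmult_lt_compat_l; [lra|]. apply Rmax_lub_lt; assumption.
Qed.

Lemma ccont_eps {X : UniformSpace} (f : X -> C) (x : X) :
  ccont f x <-> forall e, 0 < e -> locally x (fun y => Cmod (f y - f x) < e).
Proof.
  split.
  - intros H e He. apply (H (fun w => Cmod (w - f x) < e)).
    apply locally_Cmod. exists e; auto.
  - intros H P HP. apply locally_Cmod in HP. destruct HP as [d [Hd HP]].
    unfold filtermap. apply filter_imp with (2 := H d Hd). intros y Hy; auto.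
Qed.

Lemma ccont_C_eps (f : C -> C) (z : C) :
  ccont (X := C_UniformSpace) f z <->
  forall e, 0 < e -> exists d, 0 < d /\ forall w, Cmod (w - z) < d -> Cmod (f w - f z) < e.
Proof.
  split; intros H.
  - intros e He. apply ccont_eps with (e := e) in H; auto. now apply locally_Cmod in H.
  - apply ccont_eps. intros e He. apply locally_Cmod. auto.
Qed.

Lemma ccont_Re {X : UniformSpace} (f : X -> C) x :
  ccont f x -> continuous (fun y => Re (f y)) x.
Proof.
  intros H. apply (continuous_comp f (fun p : R * R => fst p) x); auto.
  unfold ccont in H. destruct (f x). apply continuous_fst.
Qed.

Lemma ccont_Im {X : UniformSpace} (f : X -> C) x :
  ccont f x -> continuous (fun y => Im (f y)) x.
Proof.
  intros H. apply (continuous_comp f (fun p : R * R => snd p) x); auto.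
  destruct (f x). apply continuous_snd.
Qed.

Lemma ccont_pair {X : UniformSpace} (f g : X -> R) x :
  continuous f x -> continuous g x -> ccont (fun y => (f y, g y)) x.
Proof.
  intros Hf Hg. apply (continuous_comp_2 f g (fun a b => (a, b)) x); auto.
  apply continuous_ext with (fun p => p); [now intros [? ?]|apply continuous_id].
Qed.

Lemma ccont_ext_loc {X : UniformSpace} (f g : X -> C) x :
  locally x (fun y => f y = g y) -> ccont f x -> ccont g x.
Proof.
  intros H Hf. now apply continuous_ext_loc with f.
Qed.

Lemma ccont_ext {X : UniformSpace} (f g : X -> C) x :
  (forall y, f y = g y) -> ccont f x -> ccont g x.
Proof. intros H. apply ccont_ext_loc. apply filter_forall. exact H. Qed.

Lemma ccont_const {X : UniformSpace} c (x : X) : ccont (fun _ => c) x.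
Proof. apply continuous_const. Qed.

Lemma continuous_Rplus {X : UniformSpace} (f g : X -> R) x :
  continuous f x -> continuous g x -> continuous (fun y => f y + g y) x.
Proof. apply (continuous_plus (V := R_NormedModule)). Qed.

Lemma continuous_Ropp {X : UniformSpace} (f : X -> R) x :
  continuous f x -> continuous (fun y => - f y) x.
Proof. apply (continuous_opp (V := R_NormedModule)). Qed.

Lemma continuous_Rminus {X : UniformSpace} (f g : X -> R) x :
  continuous f x -> continuous g x -> continuous (fun y => f y - g y) x.
Proof. apply (continuous_minus (V := R_NormedModule)). Qed.

Lemma continuous_Rmult {X : UniformSpace} (f g : X -> R) x :
  continuous f x -> continuous g x -> continuous (fun y => f y * g y) x.
Proof. apply (continuous_mult (K := R_AbsRing)). Qed.

Lemma continuous_Rcomp {X : UniformSpace} (f : X -> R) (h : R -> R) x :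
  continuous f x -> continuity_pt h (f x) -> continuous (fun y => h (f y)) x.
Proof.
  intros Hf Hh. apply (continuous_comp f h); auto. now apply continuity_pt_filterlim.
Qed.

Lemma continuous_Rinv_comp {X : UniformSpace} (f : X -> R) x :
  continuous f x -> f x <> 0 -> continuous (fun y => / f y) x.
Proof.
  intros Hf H. apply (continuous_Rcomp f Rinv); auto.
  apply (continuity_pt_inv (fun t => t)); auto. apply continuity_pt_id.
Qed.

Lemma continuous_ln_comp {X : UniformSpace} (f : X -> R) x :
  continuous f x -> 0 < f x -> continuous (fun y => ln (f y)) x.
Proof.
  intros Hf H. apply (continuous_Rcomp f ln); auto.
  apply derivable_continuous_pt. exists (/ f x). now apply derivable_pt_lim_ln.
Qed.

Lemma continuous_pow_comp {X : UniformSpace} (f : X -> R) n x :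
  continuous f x -> continuous (fun y => f y ^ n) x.
Proof.
  intros Hf. induction n as [|n IH]; simpl.
  - apply continuous_const.
  - now apply continuous_Rmult.
Qed.

Lemma ccont_plus {X : UniformSpace} (f g : X -> C) x :
  ccont f x -> ccont g x -> ccont (fun y => f y + g y)%C x.
Proof.
  intros Hf Hg. apply (ccont_pair (fun y => Re (f y) + Re (g y)) (fun y => Im (f y) + Im (g y)));
  apply continuous_Rplus; auto using ccont_Re, ccont_Im.
Qed.

Lemma ccont_opp {X : UniformSpace} (f : X -> C) x :
  ccont f x -> ccont (fun y => - f y)%C x.
Proof.
  intros Hf. apply (ccont_pair (fun y => - Re (f y)) (fun y => - Im (f y)));
  apply continuous_Ropp; auto using ccont_Re, ccont_Im.
Qed.

Lemma ccont_minus {X : UniformSpace} (f g : X -> C) x :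
  ccont f x -> ccont g x -> ccont (fun y => f y - g y)%C x.
Proof. intros Hf Hg. apply ccont_plus; auto using ccont_opp. Qed.

Lemma ccont_mult {X : UniformSpace} (f g : X -> C) x :
  ccont f x -> ccont g x -> ccont (fun y => f y * g y)%C x.
Proof.
  intros Hf Hg. apply (ccont_pair (fun y => Re (f y) * Re (g y) - Im (f y) * Im (g y))
   (fun y => Re (f y) * Im (g y) + Im (f y) * Re (g y)));
  [apply continuous_Rminus | apply continuous_Rplus]; apply continuous_Rmult;
   auto using ccont_Re, ccont_Im.
Qed.

Lemma ccont_conj {X : UniformSpace} (f : X -> C) x :
  ccont f x -> ccont (fun y => Cconj (f y)) x.
Proof.
  intros Hf. apply (ccont_pair (fun y => Re (f y)) (fun y => - Im (f y)));
  auto using continuous_Ropp, ccont_Re, ccont_Im.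
Qed.

Lemma ccont_RtoC {X : UniformSpace} (f : X -> R) x :
  continuous f x -> ccont (fun y => RtoC (f y)) x.
Proof. intros Hf. apply ccont_pair; auto. apply continuous_const. Qed.

Lemma ccont_pow {X : UniformSpace} (f : X -> C) n x :
  ccont f x -> ccont (fun y => f y ^ n)%C x.
Proof.
  intros Hf. induction n as [|n IH]; simpl.
  - apply ccont_const.
  - now apply ccont_mult.
Qed.

Lemma Re_Im_sq_pos (z : C) : z <> RtoC 0 -> 0 < Re z ^ 2 + Im z ^ 2.
Proof. intros H. rewrite <- Cmod2_alt. apply Cmod_gt_0 in H. nra. Qed.

Lemma ccont_inv {X : UniformSpace} (f : X -> C) x :
  ccont f x -> f x <> RtoC 0 -> ccont (fun y => / f y)%C x.
Proof.
  intros Hf H. pose proof (Re_Im_sq_pos _ H) as HP.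
  apply (ccont_pair (fun y => Re (f y) * / (Re (f y) ^ 2 + Im (f y) ^ 2))
   (fun y => - Im (f y) * / (Re (f y) ^ 2 + Im (f y) ^ 2)));
  apply continuous_Rmult; try apply continuous_Ropp; auto using ccont_Re, ccont_Im;
  apply continuous_Rinv_comp; try lra;
  apply continuous_Rplus; apply continuous_pow_comp; auto using ccont_Re, ccont_Im.
Qed.

Lemma ccont_div {X : UniformSpace} (f g : X -> C) x :
  ccont f x -> ccont g x -> g x <> RtoC 0 -> ccont (fun y => f y / g y)%C x.
Proof. intros Hf Hg H. apply ccont_mult; auto using ccont_inv. Qed.

Lemma ccont_comp {X : UniformSpace} (f : X -> C) (h : C -> C) x :
  ccont f x -> ccont (X := C_UniformSpace) h (f x) -> ccont (fun y => h (f y)) x.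
Proof. intros Hf Hh. exact (continuous_comp f h x Hf Hh). Qed.

Lemma continuous_Cmod {X : UniformSpace} (f : X -> C) x :
  ccont f x -> continuous (fun y => Cmod (f y)) x.
Proof.
  intros Hf. apply (continuous_Rcomp (fun y => fst (f y) ^ 2 + snd (f y) ^ 2) sqrt).
  - apply continuous_Rplus; apply continuous_pow_comp.
    + now apply (ccont_Re f).
    + now apply (ccont_Im f).
  - apply continuity_pt_sqrt. nra.
Qed.

Lemma ccont_id z : ccont (X := C_UniformSpace) (fun w => w) z.
Proof. apply continuous_id. Qed.

Definition cis (t : R) : C := (cos t, sin t).

Lemma continuous_cos_comp {X : UniformSpace} (f : X -> R) x :
  continuous f x -> continuous (fun y => cos (f y)) x.
Proof. intros H. apply (continuous_Rcomp f cos); auto. apply continuity_cos. Qed.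
Lemma continuous_sin_comp {X : UniformSpace} (f : X -> R) x :
  continuous f x -> continuous (fun y => sin (f y)) x.
Proof. intros H. apply (continuous_Rcomp f sin); auto. apply continuity_sin. Qed.

Lemma ccont_cis {X : UniformSpace} (f : X -> R) x :
  continuous f x -> ccont (fun y => cis (f y)) x.
Proof.
  intros H. apply ccont_pair; auto using continuous_cos_comp, continuous_sin_comp.
Qed.

Lemma Cmod_cis t : Cmod (cis t) = 1.
Proof.
  unfold Cmod, cis; cbn [fst snd]. rewrite <- sqrt_1. f_equal.
  pose proof (sin2_cos2 t) as H. unfold Rsqr in H. lra.
Qed.

Lemma cis_plus s t : cis (s + t) = (cis s * cis t)%C.
Proof. unfold cis, Cmult; cbn [fst snd]. rewrite cos_plus, sin_plus. f_equal; ring. Qed.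

Lemma cis_opp t : cis (- t) = Cconj (cis t).
Proof. unfold cis, Cconj; cbn [fst snd]. now rewrite cos_neg, sin_neg. Qed.

Lemma cis_0 : cis 0 = RtoC 1.
Proof. unfold cis. now rewrite cos_0, sin_0. Qed.

Lemma cis_neq_0 t : cis t <> RtoC 0.
Proof. apply Cmod_gt_0. rewrite Cmod_cis. lra. Qed.

Lemma cis_pow t n : (cis t ^ n)%C = cis (INR n * t).
Proof.
  induction n as [|n IH].
  - simpl. now rewrite Rmult_0_l, cis_0.
  - rewrite S_INR, Rmult_plus_distr_r, Rmult_1_l, Rplus_comm, cis_plus, <- IH. reflexivity.
Qed.

Lemma cis_2PI t : cis (t + 2 * PI) = cis t.
Proof. unfold cis. now rewrite cos_plus, sin_plus, cos_2PI, sin_2PI, !Rmult_0_r, !Rmult_1_r, Rminus_0_r, Rplus_0_r. Qed.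

Definition R2 := prod_UniformSpace R_UniformSpace R_UniformSpace.
Definition cont2 (k : R * R -> R) : Prop := forall p, @continuous R2 R_UniformSpace k p.
Definition ccontR (h : R -> C) : Prop := forall t, ccont (X := R_UniformSpace) h t.
Definition ccont2 (k : R * R -> C) : Prop := forall p, ccont (X := R2) k p.

Lemma ccont2_fst f : ccontR f -> ccont2 (fun p => f (fst p)).
Proof. intros H [s t]. apply (continuous_comp (U := R2) fst f); [apply continuous_fst|apply H]. Qed.
Lemma ccont2_snd f : ccontR f -> ccont2 (fun p => f (snd p)).
Proof. intros H [s t]. apply (continuous_comp (U := R2) snd f); [apply continuous_snd|apply H]. Qed.
Lemma cont2_fst (f : R -> R) : (forall t, continuous f t) -> cont2 (fun p => f (fst p)).
Proof. intros H [s t]. apply (continuous_comp (U := R2) fst f); [apply continuous_fst|apply H]. Qed.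
Lemma cont2_snd (f : R -> R) : (forall t, continuous f t) -> cont2 (fun p => f (snd p)).
Proof. intros H [s t]. apply (continuous_comp (U := R2) snd f); [apply continuous_snd|apply H]. Qed.

(** The head symbol of the function selects the continuity rule; nonvanishing denominators and
    positive arguments of [ln] are left as side goals. *)
Ltac cts_step :=
  cbv beta;
  match goal with
  | |- ccont (fun t => Cplus (@?u t) (@?v t)) _ => apply (ccont_plus u v)
  | |- ccont (fun t => Cminus (@?u t) (@?v t)) _ => apply (ccont_minus u v)
  | |- ccont (fun t => Cmult (@?u t) (@?v t)) _ => apply (ccont_mult u v)
  | |- ccont (fun t => Cdiv (@?u t) (@?v t)) _ => apply (ccont_div u v)
  | |- ccont (fun t => Cinv (@?u t)) _ => apply (ccont_inv u)
  | |- ccont (fun t => Copp (@?u t)) _ => apply (ccont_opp u)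
  | |- ccont (fun t => Cconj (@?u t)) _ => apply (ccont_conj u)
  | |- ccont (fun t => Cpow (@?u t) ?n) _ => apply (ccont_pow u n)
  | |- ccont (fun t => cis (@?u t)) _ => apply (ccont_cis u)
  | |- ccont (fun t => t) _ => apply ccont_id
  | |- ccont (fun _ => ?c) _ => apply ccont_const
  | |- ccont (fun t => RtoC (@?u t)) _ => apply (ccont_RtoC u)
  | |- continuous (fun t => Rplus (@?u t) (@?v t)) _ => apply (continuous_Rplus u v)
  | |- continuous (fun t => Rminus (@?u t) (@?v t)) _ => apply (continuous_Rminus u v)
  | |- continuous (fun t => Rmult (@?u t) (@?v t)) _ => apply (continuous_Rmult u v)
  | |- continuous (fun t => Rdiv (@?u t) (@?v t)) _ => apply (continuous_Rmult u (fun t => Rinv (v t)))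
  | |- continuous (fun t => t) _ => apply continuous_id
  | |- continuous (fun _ => ?c) _ => apply continuous_const
  | |- continuous (fun t => Rinv (@?u t)) _ => apply (continuous_Rinv_comp u)
  | |- continuous (fun t => Ropp (@?u t)) _ => apply (continuous_Ropp u)
  | |- continuous (fun t => pow (@?u t) ?n) _ => apply (continuous_pow_comp u n)
  | |- continuous (fun t => ln (@?u t)) _ => apply (continuous_ln_comp u)
  | |- continuous (fun t => Cmod (@?u t)) _ => apply (continuous_Cmod u)
  | |- continuous (fun t => Re (@?u t)) _ => apply (ccont_Re u)
  | |- continuous (fun t => Im (@?u t)) _ => apply (ccont_Im u)
  | |- continuous (fun t => Rabs (@?u t)) _ => apply (continuous_Rcomp u Rabs); [|apply Rcontinuity_abs]
  | |- continuous fst (_, _) => apply continuous_fst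
  | |- continuous snd (_, _) => apply continuous_snd
  | |- continuous (fun p => fst p) ?q => destruct q; apply continuous_fst
  | |- continuous (fun p => snd p) ?q => destruct q; apply continuous_snd
  | H : ccontR ?f |- ccont ?f _ => apply H
  | H : ccontR ?f |- ccont (fun t => ?f t) _ => apply H
  | H : ccont2 ?f |- ccont ?f _ => apply H
  | H : ccont2 ?f |- ccont (fun t => ?f t) _ => apply H
  | H : cont2 ?f |- continuous ?f _ => apply H
  | H : cont2 ?f |- continuous (fun t => ?f t) _ => apply H
  | H : forall t, continuous ?f t |- continuous ?f _ => apply H
  | H : forall t, continuous ?f t |- continuous (fun t => ?f t) _ => apply H
  | H : ccontR ?f |- ccont (fun p => ?f (fst p)) _ => apply (ccont2_fst f H)
  | H : ccontR ?f |- ccont (fun p => ?f (snd p)) _ => apply (ccont2_snd f H)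
  | H : forall t, continuous ?f t |- continuous (fun p => ?f (fst p)) _ => apply (cont2_fst f H)
  | H : forall t, continuous ?f t |- continuous (fun p => ?f (snd p)) _ => apply (cont2_snd f H)
  | H : forall z, _ -> ccont ?f z |- ccont ?f _ => solve [apply H; auto; lra]
  | H : forall z, _ -> ccont ?f z |- ccont (fun t => ?f t) _ => solve [apply H; auto; lra]
  | H : ccont ?f ?x |- ccont ?f ?x => exact H
  | H : ccont ?f ?x |- ccont (fun t => ?f t) ?x => exact H
  end.

Ltac cts := repeat cts_step; auto; try lra.

(** The non-strict inequality admits w = z. The derivative is an argument, so later statements can
    carry explicit functions [F1], [F2] for the first two derivatives. *)
Definition cder (h : C -> C) (z d : C) : Prop :=
  forall e, 0 < e -> exists del, 0 < del /\
    forall w, Cmod (w - z) < del -> Cmod (h w - h z - d * (w - z)) <= e * Cmod (w - z).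

Lemma cder_ccont h z d : cder h z d -> ccont (X := C_UniformSpace) h z.
Proof.
  intros H. apply ccont_C_eps. intros e He.
  destruct (H 1 Rlt_0_1) as [del [Hdel Hw]].
  pose proof (Cmod_ge_0 d) as Hd.
  exists (Rmin del (e / (2 + Cmod d))). split.
  { apply Rmin_pos; auto. apply Rdiv_lt_0_compat; lra. }
  intros w Hwz.
  assert (H1 : Cmod (w - z) < del) by (eapply Rlt_le_trans; [exact Hwz | apply Rmin_l]).
  assert (H2 : Cmod (w - z) < e / (2 + Cmod d)) by (eapply Rlt_le_trans; [exact Hwz | apply Rmin_r]).
  specialize (Hw w H1).
  replace (h w - h z)%C with ((h w - h z - d * (w - z)) + d * (w - z))%C by ring.
  eapply Rle_lt_trans; [apply Cmod_triangle|]. rewrite Cmod_mult.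
  apply Rle_lt_trans with ((1 + Cmod d) * Cmod (w - z)); [lra|].
  apply Rmult_lt_compat_r with (r := 2 + Cmod d) in H2; [|lra].
  unfold Rdiv in H2. rewrite Rmult_assoc, Rinv_l, Rmult_1_r in H2 by lra.
  pose proof (Cmod_ge_0 (w - z)). nra.
Qed.

(* Caratheodory's criterion: all differentiation rules reduce to continuity of the slope. *)
Lemma cder_iff_slope h z d :
  cder h z d <-> exists s : C -> C, ccont (X := C_UniformSpace) s z /\ s z = d /\
     forall w, (h w = h z + s w * (w - z))%C.
Proof.
  split.
  - intros H.
    exists (fun w => if Ceq_dec w z then d else (h w - h z) / (w - z))%C.
    split; [|split].
    + apply ccont_C_eps. intros e He.
      destruct (H (e / 2)) as [del [Hdel Hw]]; [lra|].
      exists del; split; auto. intros w Hwz.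
      destruct (Ceq_dec z z) as [_|]; [|congruence].
      destruct (Ceq_dec w z) as [->|Hne].
      { replace (d - d)%C with (RtoC 0) by ring. now rewrite Cmod_0. }
      assert (Hne' : (w - z)%C <> RtoC 0).
      { intros E. apply Hne. replace w with ((w - z) + z)%C by ring. rewrite E. ring. }
      specialize (Hw w Hwz).
      replace ((h w - h z) / (w - z) - d)%C with ((h w - h z - d * (w - z)) / (w - z))%C by (field; auto).
      rewrite Cmod_div by auto. apply Cmod_gt_0 in Hne'.
      apply Rle_lt_trans with (e / 2); [|lra].
      apply Rmult_le_reg_r with (Cmod (w - z)); auto.
      unfold Rdiv at 1. rewrite Rmult_assoc, Rinv_l, Rmult_1_r; lra.
    + destruct (Ceq_dec z z); congruence.
    + intros w. destruct (Ceq_dec w z) as [->|Hne]; [ring|].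
      field. intros E. apply Hne. replace w with ((w - z) + z)%C by ring. rewrite E. ring.
  - intros [s [Hs [Hsz Hh]]] e He.
    destruct (proj1 (ccont_C_eps _ _) Hs e He) as [del [Hdel Hw]].
    exists del; split; auto. intros w Hwz. rewrite (Hh w), <- Hsz.
    replace (h z + s w * (w - z) - h z - s z * (w - z))%C with ((s w - s z) * (w - z))%C by ring.
    rewrite Cmod_mult. apply Rmult_le_compat_r; [apply Cmod_ge_0|]. left; auto.
Qed.

Lemma Csub_neq_0 (w z : C) : w <> z -> (w - z)%C <> RtoC 0.
Proof.
  intros H E. apply H. replace w with ((w - z) + z)%C by ring. rewrite E. ring.
Qed.

Lemma cder_ext_loc f g z d :
  @locally C_UniformSpace z (fun w => f w = g w) -> cder f z d -> cder g z d.
Proof.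
  intros Hl H e He. apply locally_Cmod in Hl. destruct Hl as [d1 [Hd1 Hl]].
  destruct (H e He) as [d2 [Hd2 H2]].
  exists (Rmin d1 d2). split; [now apply Rmin_pos|]. intros w Hw.
  rewrite <- (Hl w), <- (Hl z).
  - apply H2. eapply Rlt_le_trans; [exact Hw|apply Rmin_r].
  - replace (z - z)%C with (RtoC 0) by ring. now rewrite Cmod_0.
  - eapply Rlt_le_trans; [exact Hw|apply Rmin_l].
Qed.

Lemma cder_const c z : cder (fun _ => c) z 0.
Proof.
  apply cder_iff_slope. exists (fun _ => RtoC 0). split; [apply ccont_const|split; auto].
  intros w; ring.
Qed.

Lemma cder_id z : cder (fun w => w) z 1.
Proof.
  apply cder_iff_slope. exists (fun _ => RtoC 1). split; [apply ccont_const|split; auto].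
  intros w; ring.
Qed.

Lemma cder_plus f g z df dg :
  cder f z df -> cder g z dg -> cder (fun w => f w + g w)%C z (df + dg).
Proof.
  intros Hf Hg. apply cder_iff_slope in Hf; apply cder_iff_slope in Hg.
  destruct Hf as [s [Hs [Es Hf]]]; destruct Hg as [t [Ht [Et Hg]]].
  apply cder_iff_slope. exists (fun w => s w + t w)%C.
  split; [now apply ccont_plus|split; [now rewrite Es, Et|]].
  intros w. rewrite (Hf w), (Hg w). ring.
Qed.

Lemma cder_mult f g z df dg :
  cder f z df -> cder g z dg -> cder (fun w => f w * g w)%C z (df * g z + f z * dg).
Proof.
  intros Hf Hg. pose proof (cder_ccont _ _ _ Hg) as Cg.
  apply cder_iff_slope in Hf; apply cder_iff_slope in Hg.
  destruct Hf as [s [Hs [Es Hf]]]; destruct Hg as [t [Ht [Et Hg]]].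
  apply cder_iff_slope. exists (fun w => s w * g w + f z * t w)%C.
  split; [|split; [now rewrite Es, Et|]].
  - apply ccont_plus; apply ccont_mult; auto using ccont_const.
  - intros w. rewrite (Hf w), (Hg w). ring.
Qed.

Lemma cder_opp f z df : cder f z df -> cder (fun w => - f w)%C z (- df).
Proof.
  intros Hf. apply cder_iff_slope in Hf.
  destruct Hf as [s [Hs [Es Hf]]].
  apply cder_iff_slope. exists (fun w => - s w)%C.
  split; [now apply ccont_opp|split; [now rewrite Es|]].
  intros w. rewrite (Hf w). ring.
Qed.

Lemma cder_minus f g z df dg :
  cder f z df -> cder g z dg -> cder (fun w => f w - g w)%C z (df - dg).
Proof. intros Hf Hg. apply (cder_plus f (fun w => - g w)%C); auto using cder_opp. Qed.

Lemma ccont_neq_0 (f : C -> C) z :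
  ccont (X := C_UniformSpace) f z -> f z <> RtoC 0 ->
  @locally C_UniformSpace z (fun w => f w <> RtoC 0).
Proof.
  intros Hf H. apply Cmod_gt_0 in H.
  destruct (proj1 (ccont_C_eps f z) Hf (Cmod (f z)) H) as [d [Hd Hw]].
  apply locally_Cmod. exists d; split; auto. intros w Hwz E.
  specialize (Hw w Hwz). rewrite E in Hw.
  replace (RtoC 0 - f z)%C with (- f z)%C in Hw by ring. rewrite Cmod_opp in Hw. lra.
Qed.

Lemma cder_inv f z df : cder f z df -> f z <> RtoC 0 ->
  cder (fun w => / f w)%C z (- df / (f z * f z)).
Proof.
  intros Hf H. pose proof (cder_ccont _ _ _ Hf) as Cf.
  pose proof (ccont_neq_0 f z Cf H) as Hl.
  apply cder_iff_slope in Hf.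
  destruct Hf as [s [Hs [Es Hf]]].
  (* Caratheodory's identity is required at every w, including zeros of f, where the inverse is a
     default value. There the function is redefined so that the identity holds; near z nothing
     changes. *)
  apply cder_ext_loc with (fun w => if Ceq_dec (f w) 0 then / f z - (s w / (f z * f z)) * (w - z) else / f w)%C.
  { apply filter_imp with (2 := Hl). intros w Hw. destruct (Ceq_dec (f w) 0); congruence. }
  apply cder_iff_slope.
  exists (fun w => if Ceq_dec (f w) 0 then - s w / (f z * f z) else - s w / (f w * f z))%C.
  split; [|split].
  - apply ccont_ext_loc with (fun w => - s w / (f w * f z))%C.
    { apply filter_imp with (2 := Hl). intros w Hw. destruct (Ceq_dec (f w) 0); congruence. }
    apply ccont_div; auto using ccont_opp.
    + apply ccont_mult; auto using ccont_const.
    + now apply Cmult_neq_0.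
  - destruct (Ceq_dec (f z) 0); [congruence|]. now rewrite Es.
  - intros w. cbv beta. destruct (Ceq_dec (f z) 0); [congruence|].
    destruct (Ceq_dec (f w) 0).
    + field; auto.
    + assert (E : (s w * (w - z) = f w - f z)%C) by (rewrite (Hf w); ring).
      replace (- s w / (f w * f z) * (w - z))%C with (- (s w * (w - z)) / (f w * f z))%C by (field; auto).
      rewrite E. field; auto.
Qed.

Lemma cder_eq f z d d' : cder f z d -> d = d' -> cder f z d'.
Proof. now intros H <-. Qed.

Lemma cder_div f g z df dg : cder f z df -> cder g z dg -> g z <> RtoC 0 ->
  cder (fun w => f w / g w)%C z ((df * g z - f z * dg) / (g z * g z)).
Proof.
  intros Hf Hg H. eapply cder_eq.
  - apply cder_mult; [exact Hf|apply cder_inv; [exact Hg|auto]].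
  - cbv beta; field; auto.
Qed.

Lemma cder_comp f g z df dg :
  cder g z dg -> cder f (g z) df -> cder (fun w => f (g w)) z (df * dg).
Proof.
  intros Hg Hf. pose proof (cder_ccont _ _ _ Hg) as Cg.
  apply cder_iff_slope in Hf; apply cder_iff_slope in Hg.
  destruct Hf as [s [Hs [Es Hf]]]; destruct Hg as [t [Ht [Et Hg]]].
  apply cder_iff_slope. exists (fun w => s (g w) * t w)%C.
  split; [|split; [now rewrite Es, Et|]].
  - apply ccont_mult; auto. apply (ccont_comp g s); auto.
  - intros w. rewrite (Hf (g w)). rewrite (Hg w) at 2. ring.
Qed.

(** Holomorphy in the form that differentiation under the integral sign requires: a derivative near
    the point, continuous at the point. *)
Definition c1at (h : C -> C) (z : C) : Prop :=
  exists h', @locally C_UniformSpace z (fun w => cder h w (h' w)) /\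
     ccont (X := C_UniformSpace) h' z.

Lemma c1at_cder h z : c1at h z -> exists d, cder h z d.
Proof. intros [h' [H _]]. exists (h' z). now apply locally_singleton in H. Qed.

Lemma c1at_ccont h z : c1at h z -> ccont (X := C_UniformSpace) h z.
Proof. intros H. destruct (c1at_cder h z H) as [d Hd]. now apply cder_ccont in Hd. Qed.

Lemma c1at_const c z : c1at (fun _ => c) z.
Proof.
  exists (fun _ => RtoC 0). split; [|apply ccont_const].
  apply filter_forall. intros; apply cder_const.
Qed.

Lemma c1at_id z : c1at (fun w => w) z.
Proof.
  exists (fun _ => RtoC 1). split; [|apply ccont_const].
  apply filter_forall. intros; apply cder_id.
Qed.

Lemma c1at_plus f g z : c1at f z -> c1at g z -> c1at (fun w => f w + g w)%C z.
Proof.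
  intros [f' [Hf Cf]] [g' [Hg Cg]]. exists (fun w => f' w + g' w)%C. split.
  - apply (filter_imp (fun w => cder f w (f' w) /\ cder g w (g' w))); [|now apply filter_and].
    intros w [H1 H2]. now apply cder_plus.
  - now apply ccont_plus.
Qed.

Lemma c1at_opp f z : c1at f z -> c1at (fun w => - f w)%C z.
Proof.
  intros [f' [Hf Cf]]. exists (fun w => - f' w)%C. split.
  - apply filter_imp with (2 := Hf). intros w; apply cder_opp.
  - now apply ccont_opp.
Qed.

Lemma c1at_minus f g z : c1at f z -> c1at g z -> c1at (fun w => f w - g w)%C z.
Proof. intros Hf Hg. apply (c1at_plus f (fun w => - g w)%C); auto using c1at_opp. Qed.

Lemma c1at_mult f g z : c1at f z -> c1at g z -> c1at (fun w => f w * g w)%C z.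
Proof.
  intros Kf Kg. pose proof (c1at_ccont _ _ Kf). pose proof (c1at_ccont _ _ Kg).
  destruct Kf as [f' [Hf Cf]]; destruct Kg as [g' [Hg Cg]].
  exists (fun w => f' w * g w + f w * g' w)%C. split.
  - apply (filter_imp (fun w => cder f w (f' w) /\ cder g w (g' w))); [|now apply filter_and].
    intros w [H1 H2]. now apply cder_mult.
  - apply ccont_plus; now apply ccont_mult.
Qed.

Lemma c1at_inv f z : c1at f z -> f z <> RtoC 0 -> c1at (fun w => / f w)%C z.
Proof.
  intros Kf H0. pose proof (c1at_ccont _ _ Kf).
  pose proof (ccont_neq_0 f z H H0) as Hl.
  destruct Kf as [f' [Hf Cf]].
  exists (fun w => - f' w / (f w * f w))%C. split.
  - apply (filter_imp (fun w => cder f w (f' w) /\ f w <> RtoC 0)); [|now apply filter_and].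
    intros w [H1 H2]. now apply cder_inv.
  - apply ccont_div; auto using ccont_opp, ccont_mult, Cmult_neq_0.
Qed.

Lemma c1at_div f g z : c1at f z -> c1at g z -> g z <> RtoC 0 -> c1at (fun w => f w / g w)%C z.
Proof. intros Hf Hg H. apply c1at_mult; auto using c1at_inv. Qed.

Lemma c1at_pow f n z : c1at f z -> c1at (fun w => f w ^ n)%C z.
Proof.
  intros H. induction n; simpl; [apply c1at_const|now apply c1at_mult].
Qed.

Lemma locally_locally_C z (P : C -> Prop) : @locally C_UniformSpace z P ->
  @locally C_UniformSpace z (fun w => @locally C_UniformSpace w P).
Proof. apply locally_locally. Qed.

Lemma c1at_ext_loc f g z : @locally C_UniformSpace z (fun w => f w = g w) -> c1at f z -> c1at g z.
Proof.
  intros Hl [f' [Hf Cf]]. exists f'; split; auto.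
  apply locally_locally_C in Hl.
  apply (filter_imp (fun w => cder f w (f' w) /\ @locally C_UniformSpace w (fun w => f w = g w)));
    [|now apply filter_and].
  intros w [H1 H2]. now apply cder_ext_loc with f.
Qed.

Ltac c1 :=
  repeat (cbv beta; match goal with
  | |- c1at (fun t => Cplus (@?u t) (@?v t)) _ => apply (c1at_plus u v)
  | |- c1at (fun t => Cminus (@?u t) (@?v t)) _ => apply (c1at_minus u v)
  | |- c1at (fun t => Cmult (@?u t) (@?v t)) _ => apply (c1at_mult u v)
  | |- c1at (fun t => Cdiv (@?u t) (@?v t)) _ => apply (c1at_div u v)
  | |- c1at (fun t => Cinv (@?u t)) _ => apply (c1at_inv u)
  | |- c1at (fun t => Cpow (@?u t) ?n) _ => apply (c1at_pow u n)
  | |- c1at (fun t => t) _ => apply c1at_id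
  | |- c1at (fun _ => ?c) _ => apply c1at_const
  end); auto.

(** Derivative of a plane curve, directly in Caratheodory form, so that the product and chain rules
    are algebra on slopes. *)
Definition pder (g : R -> C) (t : R) (v : C) : Prop :=
  exists s : R -> C, ccont (X := R_UniformSpace) s t /\ s t = v /\
    forall u, (g u = g t + s u * (u - t))%C.

Lemma pder_ccont g t v : pder g t v -> ccont (X := R_UniformSpace) g t.
Proof.
  intros [s [Hs [Es Hg]]].
  apply ccont_ext with (fun u => g t + s u * (u - t))%C; [now intros|].
  apply ccont_plus; [apply ccont_const|]. apply ccont_mult; auto.
  apply ccont_minus; [|apply ccont_const]. apply ccont_RtoC. apply continuous_id.
Qed.

Lemma pder_eq g t v v' : pder g t v -> v = v' -> pder g t v'.
Proof. now intros H <-. Qed.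

Lemma pder_ext f g t v : (forall u, f u = g u) -> pder f t v -> pder g t v.
Proof.
  intros E [s [Hs [Es H]]]. exists s; split; [|split]; auto.
  intros u. now rewrite <- !E.
Qed.

Lemma pder_mult f g z df dg :
  pder f z df -> pder g z dg -> pder (fun w => f w * g w)%C z (df * g z + f z * dg).
Proof.
  intros Hf Hg. pose proof (pder_ccont _ _ _ Hg) as Cg.
  destruct Hf as [s [Hs [Es Hf]]]; destruct Hg as [t [Ht [Et Hg]]].
  exists (fun w => s w * g w + f z * t w)%C.
  split; [|split; [now rewrite Es, Et|]].
  - apply ccont_plus; apply ccont_mult; auto using ccont_const.
  - intros w. rewrite (Hf w), (Hg w). ring.
Qed.

Lemma pder_const c t : pder (fun _ => c) t 0.
Proof.
  exists (fun _ => RtoC 0). split; [apply ccont_const|split; auto]. intros; ring.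
Qed.

Lemma pder_comp (f : C -> C) g t df dg :
  pder g t dg -> cder f (g t) df -> pder (fun w => f (g w)) t (df * dg).
Proof.
  intros Hg Hf. pose proof (pder_ccont _ _ _ Hg) as Cg.
  apply cder_iff_slope in Hf.
  destruct Hf as [s [Hs [Es Hf]]]; destruct Hg as [u [Ht [Et Hg]]].
  exists (fun w => s (g w) * u w)%C.
  split; [|split; [now rewrite Es, Et|]].
  - apply ccont_mult; auto. apply (ccont_comp g s); auto.
  - intros w. rewrite (Hf (g w)). rewrite (Hg w) at 2. ring.
Qed.

Lemma slope_is_derive (f s : R -> R) (t : R) :
  continuous s t -> (forall u, f u = f t + s u * (u - t)) -> is_derive f t (s t).
Proof.
  intros Hs H. apply is_derive_Reals. intros e He.
  apply continuity_pt_filterlim in Hs.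
  destruct (Hs e He) as [d [Hd Hw]].
  exists (mkposreal d Hd). intros h Hh Hhd. simpl in Hhd.
  rewrite (H (t + h)).
  replace ((f t + s (t + h) * (t + h - t) - f t) / h - s t) with (s (t + h) - s t) by (field; auto).
  apply Hw. split; [split; [exact I|lra]|].
  simpl. unfold Rdist. now replace (t + h - t) with h by ring.
Qed.

Lemma is_derive_slope (f : R -> R) (t l : R) : is_derive f t l ->
  exists s, continuous s t /\ s t = l /\ forall u, f u = f t + s u * (u - t).
Proof.
  intros H. apply is_derive_Reals in H.
  exists (fun u => if Req_EM_T u t then l else (f u - f t) / (u - t)).
  split; [|split].
  - apply continuity_pt_filterlim. intros e He. destruct (H e He) as [d Hd].
    exists d; split; [apply cond_pos|]. intros u [[_ Hne] Hu]. simpl in *. unfold Rdist in *.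
    destruct (Req_EM_T t t); [|congruence]. destruct (Req_EM_T u t); [congruence|].
    replace (f u) with (f (t + (u - t))) by (f_equal; ring). apply Hd; auto. lra.
  - destruct (Req_EM_T t t); congruence.
  - intros u. destruct (Req_EM_T u t) as [->|]; [lra|]. field. lra.
Qed.

Lemma pder_Re g t v : pder g t v -> is_derive (fun u => Re (g u)) t (Re v).
Proof.
  intros [s [Hs [<- Hg]]].
  apply (slope_is_derive (fun u => Re (g u)) (fun u => Re (s u))); [now apply ccont_Re|].
  intros u. rewrite (Hg u). unfold Re. simpl. ring.
Qed.

Lemma pder_Im g t v : pder g t v -> is_derive (fun u => Im (g u)) t (Im v).
Proof.
  intros [s [Hs [<- Hg]]].
  apply (slope_is_derive (fun u => Im (g u)) (fun u => Im (s u))); [now apply ccont_Im|].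
  intros u. rewrite (Hg u). unfold Im. simpl. ring.
Qed.

Lemma pder_pair (f g : R -> R) t a b : is_derive f t a -> is_derive g t b ->
  pder (fun u => (f u, g u)) t (a, b).
Proof.
  intros Hf Hg. apply is_derive_slope in Hf. apply is_derive_slope in Hg.
  destruct Hf as [s [Hs [Es Hf]]]; destruct Hg as [r [Hr [Er Hg]]].
  exists (fun u => (s u, r u)). split; [now apply ccont_pair|split; [now rewrite Es, Er|]].
  intros u. rewrite (Hf u), (Hg u). unfold Cplus, Cmult, Cminus, Copp, RtoC; simpl. f_equal; ring.
Qed.

Lemma pder_RtoC (f : R -> R) t a : is_derive f t a -> pder (fun u => RtoC (f u)) t a.
Proof.
  intros H. apply pder_pair; auto. apply @is_derive_const.
Qed.

Lemma pder_cis k t : pder (fun u => cis (k * u)) t (Ci * k * cis (k * t)).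
Proof.
  eapply pder_eq.
  - apply (pder_pair (fun u => cos (k * u)) (fun u => sin (k * u))); auto_derive; auto.
  - unfold cis, Ci, Cmult, RtoC; simpl. f_equal; ring.
Qed.

Lemma Cmod_sqr z : (Cmod z * Cmod z = Re z * Re z + Im z * Im z)%R.
Proof. pose proof (Cmod2_alt z). simpl in H. lra. Qed.

Lemma Re_le_Cmod z : Re z <= Cmod z.
Proof. eapply Rle_trans; [apply Rle_abs|apply re_le_Cmod]. Qed.

Definition seg (a b : C) (t : R) : C := (a + t * (b - a))%C.

(** The real mean value theorem is applied to the component of h along u = h b - h a, that is to Re
    (conj u h) on the segment; its end values differ by exactly |u|^2. *)
Lemma cmod_mean_value (h dh : C -> C) a b M :
  (forall t, 0 <= t <= 1 -> cder h (seg a b t) (dh (seg a b t)) /\ Cmod (dh (seg a b t)) <= M) ->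
  Cmod (h b - h a) <= M * Cmod (b - a).
Proof.
  intros H. set (u := (h b - h a)%C).
  destruct (Req_dec (Cmod u) 0) as [E|Hne].
  { rewrite E. apply Rmult_le_pos; [|apply Cmod_ge_0].
    destruct (H 0) as [_ H0]; [lra|]. eapply Rle_trans; [apply Cmod_ge_0|exact H0]. }
  pose proof (Cmod_ge_0 u) as Hu.
  assert (D : forall t, 0 <= t <= 1 ->
     is_derive (fun t => Re (Cconj u * h (seg a b t))) t (Re (Cconj u * (dh (seg a b t) * (b - a))))).
  { intros t Ht. apply (pder_Re (fun t => Cconj u * h (seg a b t))%C).
    eapply pder_eq.
    - apply pder_mult; [apply pder_const|]. apply pder_comp; [|apply H; auto].
      instantiate (1 := (b - a)%C).
      exists (fun _ => (b - a)%C). split; [apply ccont_const|split; auto].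
      intros v. unfold seg. ring.
    - cbv beta; ring. }
  destruct (MVT_gen (fun t => Re (Cconj u * h (seg a b t))) 0 1
     (fun t => Re (Cconj u * (dh (seg a b t) * (b - a))))) as [c [Hc E]].
  - intros x Hx. rewrite Rmin_left, Rmax_right in Hx by lra. apply D; lra.
  - intros x Hx. rewrite Rmin_left, Rmax_right in Hx by lra.
    apply continuity_pt_filterlim. apply (ex_derive_continuous (K := R_AbsRing) (V := R_NormedModule)).
    eexists; apply D; lra.
  - rewrite Rmin_left, Rmax_right in Hc by lra.
    replace (seg a b 1) with b in E by (unfold seg; ring).
    replace (seg a b 0) with a in E by (unfold seg; ring).
    replace (Re (Cconj u * h b) - Re (Cconj u * h a)) with (Cmod u * Cmod u) in E.
    2:{ rewrite Cmod_sqr. unfold u, Re, Im. simpl. ring. }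
    assert (L : Cmod u * Cmod u <= Cmod u * (M * Cmod (b - a))).
    { rewrite E, Rminus_0_r, Rmult_1_r. eapply Rle_trans; [apply Re_le_Cmod|].
      rewrite !Cmod_mult, Cmod_conj. apply Rmult_le_compat_l; [lra|].
      apply Rmult_le_compat_r; [apply Cmod_ge_0|]. now apply H. }
    apply Rmult_le_reg_l with (Cmod u); lra.
Qed.

(** * Integrals over the circle *)

Lemma ex_RInt_cont (f : R -> R) a b : (forall t, continuous f t) -> ex_RInt f a b.
Proof. intros H. apply (ex_RInt_continuous (V := R_CompleteNormedModule)). auto. Qed.

Lemma is_derive_RInt_upper (f : R -> R) a s : (forall t, continuous f t) ->
  is_derive (fun s => RInt f a s) s (f s).
Proof.
  intros H. apply (is_derive_RInt f (fun s => RInt f a s) a s); auto.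
  apply filter_forall. intros t. apply (RInt_correct (V := R_CompleteNormedModule)).
  now apply ex_RInt_cont.
Qed.

Lemma continuous_slice_l (k : R * R -> R) x : cont2 k ->
  forall t, continuous (fun t => k (x, t)) t.
Proof.
  intros H t. apply (continuous_comp_2 (fun _ => x) (fun t => t) (fun a b => k (a, b))).
  - apply continuous_const.
  - apply continuous_id.
  - eapply continuous_ext; [|apply H]. now intros [? ?].
Qed.

Lemma continuous_slice_r (k : R * R -> R) x : cont2 k ->
  forall t, continuous (fun t => k (t, x)) t.
Proof.
  intros H t. apply (continuous_comp_2 (fun t => t) (fun _ => x) (fun a b => k (a, b))).
  - apply continuous_id.
  - apply continuous_const.
  - eapply continuous_ext; [|apply H]. now intros [? ?].
Qed.

Lemma continuous_2d (k : R * R -> R) x y : @continuous R2 R_UniformSpace k (x, y) ->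
  continuity_2d_pt (fun u v => k (u, v)) x y.
Proof.
  intros H. apply continuity_2d_pt_filterlim.
  eapply filterlim_ext; [|exact H]. now intros [? ?].
Qed.

Lemma continuous_RInt_param (k : R * R -> R) a b x : a <= b ->
  cont2 k ->
  continuous (fun x => RInt (fun t => k (x, t)) a b) x.
Proof.
  intros Hab H. apply (proj2 (filterlim_locally _ _)). intros e.
  (* The extra 1 keeps the denominator positive when a = b. *)
  assert (He : 0 < e / (2 * (b - a + 1))).
  { apply Rdiv_lt_0_compat; [apply cond_pos|lra]. }
  destruct (uniform_continuity_2d_1d' (fun u v => k (u, v)) a b x
     (fun t _ => continuous_2d k x t (H (x, t))) (mkposreal _ He)) as [d Hd].
  exists d. intros y Hy. change (Rabs (y - x) < d) in Hy.
  change (Rabs (RInt (fun t => k (y, t)) a b - RInt (fun t => k (x, t)) a b) < e).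
  rewrite <- (RInt_minus (V := R_CompleteNormedModule)); try (apply ex_RInt_cont, continuous_slice_l; auto).
  apply Rle_lt_trans with ((b - a) * (e / (2 * (b - a + 1)))).
  - apply (abs_RInt_le_const (fun t => k (y, t) - k (x, t))); auto.
    + apply ex_RInt_cont. intros t. apply continuous_Rminus; apply continuous_slice_l; auto.
    + intros t Ht. left. apply Hd; auto.
      * apply Rabs_lt_between in Hy. pose proof (cond_pos d). lra.
      * apply Rabs_lt_between in Hy. destruct Hy. split; lra.
      * rewrite Rminus_eq_0, Rabs_R0. apply cond_pos.
  - pose proof (cond_pos e).
    apply Rmult_lt_reg_r with (2 * (b - a + 1)); [lra|].
    replace ((b - a) * (e / (2 * (b - a + 1))) * (2 * (b - a + 1))) with ((b - a) * e) by (field; lra).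
    nra.
Qed.

Lemma is_derive_zero_const (f : R -> R) a b : a <= b ->
  (forall t, a < t < b -> is_derive f t 0) ->
  (forall t, a <= t <= b -> continuous f t) -> f b = f a.
Proof.
  intros Hab Hd Hc.
  destruct (MVT_gen f a b (fun _ => 0)) as [c [_ E]].
  - intros x Hx. rewrite Rmin_left, Rmax_right in Hx by lra. auto.
  - intros x Hx. rewrite Rmin_left, Rmax_right in Hx by lra.
    apply continuity_pt_filterlim. now apply Hc.
  - lra.
Qed.

(** As functions of an upper limit s in place of d, both iterated integrals vanish at s = c and have
    the same derivative, the integral of k(x, s) over x. *)
Lemma RInt_Fubini (k : R * R -> R) a b c d : a <= b -> c <= d ->
  cont2 k ->
  RInt (fun x => RInt (fun y => k (x, y)) c d) a b =
  RInt (fun y => RInt (fun x => k (x, y)) a b) c d.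
Proof.
  intros Hab Hcd H.
  set (G1 := fun s => RInt (fun x => RInt (fun y => k (x, y)) c s) a b).
  set (G2 := fun s => RInt (fun y => RInt (fun x => k (x, y)) a b) c s).
  assert (Hsw : cont2 (fun p => k (snd p, fst p))).
  { intros p. apply (continuous_comp_2 (U := R2) snd fst (fun a b => k (a, b))).
    - destruct p; apply continuous_snd.
    - destruct p; apply continuous_fst.
    - eapply continuous_ext; [|apply H]. now intros [? ?]. }
  (* Differentiability is claimed on both sides of c, so reversed limits of integration occur
     too. *)
  assert (Hin : forall s t, continuous (fun x => RInt (fun y => k (x, y)) c s) t).
  { intros s t. destruct (Rle_dec c s) as [Hs|Hs].
    - apply continuous_RInt_param; auto.
    - apply continuous_ext with (fun x => - RInt (fun y => k (x, y)) s c).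
      { intros x. apply (opp_RInt_swap (V := R_CompleteNormedModule)).
        apply ex_RInt_cont. now apply continuous_slice_l. }
      apply continuous_Ropp. apply continuous_RInt_param; auto. lra. }
  assert (D1 : forall s, is_derive G1 s (RInt (fun x => k (x, s)) a b)).
  { intros s. unfold G1.
    assert (DD : forall u v, is_derive (fun z => RInt (fun y => k (v, y)) c z) u (k (v, u))).
    { intros u v. apply (is_derive_RInt_upper (fun y => k (v, y))). now apply continuous_slice_l. }
    replace (RInt (fun x => k (x, s)) a b) with
      (RInt (fun t => Derive (fun u => RInt (fun y => k (t, y)) c u) s) a b).
    2:{ apply RInt_ext. intros t _. apply is_derive_unique, DD. }
    apply (is_derive_RInt_param (fun s x => RInt (fun y => k (x, y)) c s)).
    - apply filter_forall. intros u t _. eexists. apply DD.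
    - intros t _. apply continuity_2d_pt_ext with (fun u v => k (v, u)).
      { intros u v. symmetry. apply is_derive_unique, DD. }
      exact (continuous_2d _ s t (Hsw (s, t))).
    - apply filter_forall. intros u. apply ex_RInt_cont. auto. }
  assert (D2 : forall s, is_derive G2 s (RInt (fun x => k (x, s)) a b)).
  { intros s. unfold G2. apply (is_derive_RInt_upper (fun y => RInt (fun x => k (x, y)) a b)).
    intros t. apply (continuous_RInt_param (fun p => k (snd p, fst p))); auto. }
  assert (E : G1 d - G2 d = G1 c - G2 c).
  { apply (is_derive_zero_const (fun s => G1 s - G2 s)); auto.
    - intros t _. replace 0 with (RInt (fun x => k (x, t)) a b - RInt (fun x => k (x, t)) a b) by ring.
      now apply (is_derive_minus G1 G2).
    - intros t _. apply (ex_derive_continuous (K := R_AbsRing) (V := R_NormedModule)).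
      eexists. now apply (is_derive_minus G1 G2). }
  assert (E1 : G1 c = 0).
  { unfold G1. rewrite (RInt_ext _ (fun _ => 0)).
    - rewrite RInt_const. apply Rmult_0_r.
    - intros x _. apply (RInt_point (V := R_CompleteNormedModule)). }
  assert (E2 : G2 c = 0) by apply (RInt_point (V := R_CompleteNormedModule)).
  fold (G1 d) (G2 d). lra.
Qed.

Definition RI (f : R -> R) : R := RInt f 0 (2 * PI).
Definition CI (h : R -> C) : C := (RI (fun t => Re (h t)), RI (fun t => Im (h t))).

Lemma two_PI_pos : 0 < 2 * PI.
Proof. pose proof PI_RGT_0. lra. Qed.

Lemma RI_ext f g : (forall t, f t = g t) -> RI f = RI g.
Proof. intros H. apply RInt_ext. auto. Qed.
Lemma RI_plus f g : (forall t, continuous f t) -> (forall t, continuous g t) ->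
  RI (fun t => f t + g t) = RI f + RI g.
Proof. intros Hf Hg. apply (RInt_plus (V := R_CompleteNormedModule)); now apply ex_RInt_cont. Qed.
Lemma RI_scal c f : (forall t, continuous f t) ->
  RI (fun t => c * f t) = c * RI f.
Proof. intros Hf. apply (RInt_scal (V := R_CompleteNormedModule)); now apply ex_RInt_cont. Qed.
Lemma RI_const c : RI (fun _ => c) = 2 * PI * c.
Proof. unfold RI. rewrite RInt_const. unfold scal; simpl. unfold mult; simpl. lra. Qed.
Lemma RI_le f g : (forall t, continuous f t) -> (forall t, continuous g t) ->
  (forall t, 0 <= t <= 2 * PI -> f t <= g t) -> RI f <= RI g.
Proof.
  intros Hf Hg H. apply RInt_le; auto using ex_RInt_cont; [left; apply two_PI_pos|].
  intros t Ht. apply H. lra.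
Qed.

Lemma CI_ext f g : (forall t, f t = g t) -> CI f = CI g.
Proof. intros H. unfold CI. f_equal; apply RI_ext; intros t; now rewrite H. Qed.

Lemma CI_plus f g : ccontR f -> ccontR g -> CI (fun t => f t + g t)%C = (CI f + CI g)%C.
Proof.
  intros Hf Hg. unfold CI, Cplus. f_equal.
  - rewrite (RI_ext _ (fun t => Re (f t) + Re (g t))) by (intros; apply re_plus).
    apply RI_plus; intros t; cts.
  - rewrite (RI_ext _ (fun t => Im (f t) + Im (g t))) by (intros; apply im_plus).
    apply RI_plus; intros t; cts.
Qed.

Lemma CI_scal c f : ccontR f -> CI (fun t => c * f t)%C = (c * CI f)%C.
Proof.
  intros Hf. 
  assert (HR : forall t, continuous (fun t => Re (f t)) t) by (intros; now apply ccont_Re).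
  assert (HI : forall t, continuous (fun t => Im (f t)) t) by (intros; now apply ccont_Im).
  unfold CI, Cmult. f_equal; cbn [fst snd].
  - rewrite (RI_ext _ (fun t => Re c * Re (f t) + - Im c * Im (f t))) by (intros; unfold Re, Im; simpl; ring).
    rewrite RI_plus, !RI_scal; auto.
    + unfold Re, Im; ring.
    + intros; apply continuous_Rmult; auto; apply continuous_const.
    + intros; apply continuous_Rmult; auto; apply continuous_const.
  - rewrite (RI_ext _ (fun t => Re c * Im (f t) + Im c * Re (f t))) by (intros; unfold Re, Im; simpl; ring).
    rewrite RI_plus, !RI_scal; auto.
    + intros; apply continuous_Rmult; auto; apply continuous_const.
    + intros; apply continuous_Rmult; auto; apply continuous_const.
Qed.

Lemma CI_scal_r c f : ccontR f -> CI (fun t => f t * c)%C = (CI f * c)%C.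
Proof.
  intros H. rewrite Cmult_comm, <- CI_scal by auto. apply CI_ext; intros; ring.
Qed.

Lemma CI_opp f : ccontR f -> CI (fun t => - f t)%C = (- CI f)%C.
Proof.
  intros H. rewrite (CI_ext _ (fun t => - RtoC 1 * f t)%C) by (intros; ring).
  rewrite CI_scal by auto. ring.
Qed.

Lemma CI_conj f : ccontR f -> CI (fun t => Cconj (f t)) = Cconj (CI f).
Proof.
  intros Hf. unfold CI, Cconj. f_equal. cbn [fst snd Re Im].
  rewrite (RI_ext _ (fun t => -1 * Im (f t))) by (intros; unfold Im; simpl; ring).
  rewrite RI_scal; [ring|]. intros; now apply ccont_Im.
Qed.

Lemma CI_const c : CI (fun _ => c) = (RtoC (2 * PI) * c)%C.
Proof.
  unfold CI. rewrite !RI_const. unfold Cmult, RtoC, Re, Im; cbn [fst snd]. f_equal; ring.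
Qed.

Lemma CI_0 f : (forall t, f t = RtoC 0) -> CI f = RtoC 0.
Proof. intros H. rewrite (CI_ext f (fun _ => RtoC 0)) by auto. rewrite CI_const. ring. Qed.

Lemma ccontR_slice1 k : ccont2 k -> forall x, ccontR (fun t => k (x, t)).
Proof.
  intros H x t. apply (continuous_comp_2 (fun _ => x) (fun t => t) (fun a b => k (a, b))).
  - apply continuous_const.
  - apply continuous_id.
  - eapply continuous_ext; [|apply H]. now intros [? ?].
Qed.

Lemma ccontR_slice2 k : ccont2 k -> forall x, ccontR (fun t => k (t, x)).
Proof.
  intros H x t. apply (continuous_comp_2 (fun t => t) (fun _ => x) (fun a b => k (a, b))).
  - apply continuous_id.
  - apply continuous_const.
  - eapply continuous_ext; [|apply H]. now intros [? ?].
Qed.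

Lemma ccont2_swap k : ccont2 k -> ccont2 (fun p => k (snd p, fst p)).
Proof.
  intros H p. apply (continuous_comp_2 (U := R2) snd fst (fun a b => k (a, b))).
  - destruct p; apply continuous_snd.
  - destruct p; apply continuous_fst.
  - eapply continuous_ext; [|apply H]. now intros [? ?].
Qed.

Lemma ccontR_CI1 k : ccont2 k -> ccontR (fun x => CI (fun t => k (x, t))).
Proof.
  intros H x. apply ccont_pair.
  - apply (continuous_RInt_param (fun p => Re (k p))); [left; apply two_PI_pos|]. intros p; now apply ccont_Re.
  - apply (continuous_RInt_param (fun p => Im (k p))); [left; apply two_PI_pos|]. intros p; now apply ccont_Im.
Qed.

Lemma ccontR_CI2 k : ccont2 k -> ccontR (fun x => CI (fun t => k (t, x))).
Proof. intros H. apply (ccontR_CI1 (fun p => k (snd p, fst p))). now apply ccont2_swap. Qed.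

Lemma CI_Fubini k : ccont2 k ->
  CI (fun x => CI (fun t => k (x, t))) = CI (fun t => CI (fun x => k (x, t))).
Proof.
  intros H. unfold CI at 1 3. cbn [Re Im fst snd CI].
  pose proof two_PI_pos.
  f_equal.
  - apply (RInt_Fubini (fun p => Re (k p))); try lra. intros p; now apply ccont_Re.
  - apply (RInt_Fubini (fun p => Im (k p))); try lra. intros p; now apply ccont_Im.
Qed.

(** Multiplication by the conjugate of [CI h] makes the integral real and nonnegative, after which
    real integrands are compared. *)
Lemma Cmod_CI_le h g : ccontR h -> (forall t, continuous g t) ->
  (forall t, 0 <= t <= 2 * PI -> Cmod (h t) <= g t) -> Cmod (CI h) <= RI g.
Proof.
  intros Hh Hg H.
  destruct (Req_dec (Cmod (CI h)) 0) as [E|Hne].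
  { rewrite E. replace 0 with (RI (fun _ => 0)) by (rewrite RI_const; ring).
    apply RI_le; auto. intros; apply continuous_const.
    intros t Ht. eapply Rle_trans; [apply Cmod_ge_0|apply H; auto]. }
  set (u := CI h) in *.
  pose proof (Cmod_ge_0 u) as Hu.
  apply Rmult_le_reg_l with (Cmod u); [lra|].
  rewrite <- RI_scal by auto.
  replace (Cmod u * Cmod u) with (Re (Cconj u * u)) by (rewrite Cmod_sqr; unfold Re, Im; simpl; ring).
  unfold u at 2. rewrite <- CI_scal by auto. unfold CI at 1. cbn [Re fst].
  apply RI_le.
  - intros t. apply (ccont_Re (fun t => Cconj u * h t)%C). apply ccont_mult; [apply ccont_const|apply Hh].
  - intros t. apply continuous_Rmult; auto. apply continuous_const.
  - intros t Ht. eapply Rle_trans; [apply Re_le_Cmod|]. rewrite Cmod_mult, Cmod_conj.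
    apply Rmult_le_compat_l; auto.
Qed.

Lemma CI_FTC w w' : (forall t, pder w t (w' t)) -> ccontR w' ->
  CI w' = (w (2 * PI)%R - w 0%R)%C.
Proof.
  intros Hd Hc. unfold CI.
  assert (E : (w (2 * PI)%R - w 0%R)%C = (Re (w (2 * PI)) - Re (w 0), Im (w (2 * PI)) - Im (w 0))).
  { unfold Cminus, Cplus, Copp, Re, Im. simpl. reflexivity. }
  rewrite E. f_equal; apply is_RInt_unique.
  - apply (is_RInt_derive (V := R_CompleteNormedModule) (fun t => Re (w t)) (fun t => Re (w' t))).
    + intros; now apply pder_Re.
    + intros; now apply ccont_Re.
  - apply (is_RInt_derive (V := R_CompleteNormedModule) (fun t => Im (w t)) (fun t => Im (w' t))).
    + intros; now apply pder_Im.
    + intros; now apply ccont_Im.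
Qed.

Lemma CI_by_parts u v u' v' : (forall t, pder u t (u' t)) -> (forall t, pder v t (v' t)) ->
  ccontR u' -> ccontR v' -> (u (2 * PI)%R * v (2 * PI)%R)%C = (u 0%R * v 0%R)%C ->
  CI (fun t => u' t * v t)%C = (- CI (fun t => u t * v' t))%C.
Proof.
  intros Hu Hv Cu Cv E.
  assert (Cu0 : ccontR u) by (intros t; now apply (pder_ccont _ _ _ (Hu t))).
  assert (Cv0 : ccontR v) by (intros t; now apply (pder_ccont _ _ _ (Hv t))).
  pose proof (CI_FTC (fun t => u t * v t)%C (fun t => u' t * v t + u t * v' t)%C) as H.
  rewrite CI_plus in H; try (intros t; now apply ccont_mult).
  cbv beta in H. rewrite E in H.
  assert (H0 : (CI (fun t : R => u' t * v t) + CI (fun t : R => u t * v' t) = 0)%C).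
  { rewrite H; [ring| |].
    - intros t. now apply pder_mult.
    - intros t. apply ccont_plus; now apply ccont_mult. }
  replace (CI (fun t : R => u' t * v t)%C) with
   ((CI (fun t : R => u' t * v t) + CI (fun t : R => u t * v' t)) - CI (fun t : R => u t * v' t))%C by ring.
  rewrite H0. ring.
Qed.

(** * The mean value property *)

Lemma RtoC_neq (x y : R) : x <> y -> RtoC x <> RtoC y.
Proof. intros H E. now apply RtoC_inj in E. Qed.

Lemma Ci_neq_0 : Ci <> RtoC 0.
Proof. intros E. apply (f_equal snd) in E. simpl in E. lra. Qed.

Lemma Cmod_scal_cis s t : 0 <= s -> Cmod (s * cis t) = s.
Proof. intros H. rewrite Cmod_mult, Cmod_cis, Cmod_R, Rabs_pos_eq; lra. Qed.

(** Taken componentwise with the total operator [Derive], so that it is a function of s and t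
    without choosing a complex derivative at each point. *)
Definition radial_D (h : C -> C) (s t : R) : C :=
  (Derive (fun u => Re (h (RtoC u * cis t)%C)) s, Derive (fun u => Im (h (RtoC u * cis t)%C)) s).

Lemma pder_ray t s : pder (fun u => RtoC u * cis t)%C s (cis t).
Proof.
  exists (fun _ => cis t). split; [apply ccont_const|split; auto]. intros u; ring.
Qed.

Lemma radial_D_cder h s t d : cder h (RtoC s * cis t)%C d -> radial_D h s t = (d * cis t)%C.
Proof.
  intros H.
  assert (P : pder (fun u => h (RtoC u * cis t)%C) s (d * cis t)).
  { apply pder_comp; auto. apply pder_ray. }
  assert (E1 : Derive (fun u => Re (h (RtoC u * cis t)%C)) s = Re (d * cis t)%C)
    by exact (is_derive_unique _ _ _ (pder_Re _ _ _ P)).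
  assert (E2 : Derive (fun u => Im (h (RtoC u * cis t)%C)) s = Im (d * cis t)%C)
    by exact (is_derive_unique _ _ _ (pder_Im _ _ _ P)).
  unfold radial_D. now rewrite E1, E2.
Qed.

Lemma ccont_polar (p : R * R) : ccont (X := R2) (fun p => RtoC (fst p) * cis (snd p))%C p.
Proof.
  destruct p as [s t]. apply ccont_mult.
  - apply ccont_RtoC. apply continuous_fst.
  - apply ccont_cis. apply continuous_snd.
Qed.

Lemma radial_D_cont h s t : c1at h (RtoC s * cis t)%C ->
  ccont (X := R2) (fun p => radial_D h (fst p) (snd p)) (s, t).
Proof.
  intros [h' [Hl Hc]].
  apply ccont_ext_loc with (fun p => h' (RtoC (fst p) * cis (snd p)) * cis (snd p))%C.
  - pose proof (ccont_polar (s, t) _ Hl) as H.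
    apply (filter_imp (fun p : R2 => cder h (RtoC (fst p) * cis (snd p))%C (h' (RtoC (fst p) * cis (snd p))%C)));
      [|exact H]. intros [u v] Huv. cbn [fst snd] in *.
    symmetry. now apply radial_D_cder.
  - apply ccont_mult.
    + apply (ccont_comp (X := R2) (fun p => RtoC (fst p) * cis (snd p))%C h'); auto. apply ccont_polar.
    + apply ccont_cis. apply continuous_snd.
Qed.

Lemma annulus_locally r s : 0 < s < r -> locally s (fun u => 0 < u < r).
Proof.
  intros H. assert (Hd : 0 < Rmin s (r - s)) by (apply Rmin_pos; lra).
  exists (mkposreal _ Hd). intros u Hu. change (Rabs (u - s) < Rmin s (r - s)) in Hu.
  apply Rabs_lt_between in Hu. pose proof (Rmin_l s (r - s)). pose proof (Rmin_r s (r - s)). lra.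
Qed.

(** Differentiation under the integral sign; [pr] stands for either component, so that one proof
    serves both. *)
Lemma circle_mean_derive (h : C -> C) r s (pr : C -> R) :
  pr = Re \/ pr = Im -> 0 < s < r ->
  (forall z, 0 < Cmod z < r -> c1at h z) ->
  is_derive (fun u => RI (fun t => pr (h (RtoC u * cis t)%C))) s (RI (fun t => pr (radial_D h s t))).
Proof.
  intros Hpr Hs Hh.
  assert (Hc1 : forall u t, 0 < u < r -> c1at h (RtoC u * cis t)%C).
  { intros u t Hu. apply Hh. rewrite Cmod_scal_cis; lra. }
  assert (Hd : forall u t, 0 < u < r -> 
     is_derive (fun u => pr (h (RtoC u * cis t)%C)) u (pr (radial_D h u t))).
  { intros u t Hu. destruct (c1at_cder _ _ (Hc1 u t Hu)) as [d Hd].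
    rewrite (radial_D_cder h u t d Hd).
    assert (P : pder (fun u => h (RtoC u * cis t)%C) u (d * cis t)).
    { apply pder_comp; auto. apply pder_ray. }
    destruct Hpr as [-> | ->]; [now apply (pder_Re (fun u => h (RtoC u * cis t)%C))|now apply (pder_Im (fun u => h (RtoC u * cis t)%C))]. }
  assert (Hprc : forall (X : UniformSpace) (f : X -> C) x, ccont f x -> continuous (fun y => pr (f y)) x).
  { intros. destruct Hpr as [-> | ->]; [now apply ccont_Re|now apply ccont_Im]. }
  unfold RI at 2. rewrite (RInt_ext _ (fun t => Derive (fun u => pr (h (RtoC u * cis t)%C)) s)).
  2:{ intros t _. symmetry. apply is_derive_unique. auto. }
  apply (is_derive_RInt_param (fun u t => pr (h (RtoC u * cis t)%C))).
  - apply filter_imp with (2 := annulus_locally r s Hs). intros u Hu t _.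
    eexists; apply Hd; auto.
  - intros t _. apply continuity_2d_pt_ext_loc with (fun u v => pr (radial_D h u v)).
    + destruct (annulus_locally r s Hs) as [d Hdl]. exists d. intros u v Hu _.
      symmetry. apply is_derive_unique. apply Hd. apply Hdl. exact Hu.
    + apply (continuous_2d (fun p => pr (radial_D h (fst p) (snd p)))).
      apply (Hprc R2 (fun p => radial_D h (fst p) (snd p))). now apply radial_D_cont, Hc1.
  - apply filter_imp with (2 := annulus_locally r s Hs). intros u Hu.
    apply ex_RInt_cont. intros t. apply (Hprc R_UniformSpace (fun t => h (RtoC u * cis t)%C)).
    apply (ccont_comp (X := R_UniformSpace) (fun t => RtoC u * cis t)%C h).
    + cts.
    + apply c1at_ccont. auto.
Qed.

(** The angular derivative of h(s e^(it)) is i s times the radial one, so up to this factor the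
    integral is that of a derivative over a full period. *)
Lemma radial_D_integral (h : C -> C) r s : 0 < s < r ->
  (forall z, 0 < Cmod z < r -> c1at h z) -> CI (radial_D h s) = RtoC 0.
Proof.
  intros Hs Hh.
  assert (Hc1 : forall t, c1at h (RtoC s * cis t)%C).
  { intros t. apply Hh. rewrite Cmod_scal_cis; lra. }
  assert (Cc : ccontR (radial_D h s)).
  { intros t. apply (continuous_comp_2 (fun _ => s) (fun t => t) (radial_D h)).
    - apply continuous_const.
    - apply continuous_id.
    - now apply radial_D_cont. }
  assert (E : CI (fun t => (Ci * s) * radial_D h s t)%C = RtoC 0).
  { rewrite (CI_FTC (fun t => h (RtoC s * cis t)%C)).
    - rewrite <- (Rplus_0_l (2 * PI)), cis_2PI. ring.
    - intros t. destruct (c1at_cder _ _ (Hc1 t)) as [d Hd].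
      rewrite (radial_D_cder h s t d Hd).
      eapply pder_eq.
      + apply pder_comp; [|exact Hd].
        apply pder_mult; [apply pder_const|].
        apply (pder_ext (fun u => cis (1 * u))); [intros; now rewrite Rmult_1_l|].
        apply pder_cis.
      + rewrite Rmult_1_l. ring.
    - intros t. cts. }
  rewrite CI_scal in E by auto.
  assert (N : (Ci * s)%C <> RtoC 0).
  { apply Cmult_neq_0; [apply Ci_neq_0|apply RtoC_neq; lra]. }
  replace (CI (radial_D h s)) with (/ (Ci * s) * ((Ci * s) * CI (radial_D h s)))%C by (field; split; [apply RtoC_neq; lra|apply Ci_neq_0]).
  rewrite E. ring.
Qed.

(** The mean over the circle of radius s does not depend on s, and at s = 0 it is the value at the
    centre. Asking only continuity at the centre and on the circle admits quotients that are
    extended by their limits. *)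
Theorem circle_mean (h : C -> C) r : 0 < r ->
  (forall z, Cmod z <= r -> ccont (X := C_UniformSpace) h z) ->
  (forall z, 0 < Cmod z < r -> c1at h z) ->
  CI (fun t => h (RtoC r * cis t)%C) = (RtoC (2 * PI) * h (RtoC 0))%C.
Proof.
  intros Hr Hc Hh.
  (* Radii are clamped to [0, r], because the lemmas on parametric integrals ask for a kernel
     continuous on the whole plane. *)
  set (cl := fun s => Rmax 0 (Rmin s r)).
  assert (Hcl : forall s, 0 <= cl s <= r).
  { intros s. unfold cl. split; [apply Rmax_l|]. apply Rmax_lub; [lra|apply Rmin_r]. }
  assert (Hcl' : forall s, 0 <= s <= r -> cl s = s).
  { intros s Hs. unfold cl. rewrite Rmin_left, Rmax_right; lra. }
  assert (Hclc : forall s, continuous cl s).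
  { intros s. apply continuous_ext with (fun s => (0 + (s + r - Rabs (s - r)) / 2 + Rabs (0 - (s + r - Rabs (s - r)) / 2)) / 2).
    - intros u. unfold cl.
      replace (Rmin u r) with ((u + r - Rabs (u - r)) / 2).
      + set (v := (u + r - Rabs (u - r)) / 2). unfold Rmax, Rabs. destruct Rcase_abs; destruct Rle_dec; lra.
      + unfold Rmin, Rabs. destruct Rcase_abs; destruct Rle_dec; lra.
    - cts. }
  set (k := fun p : R * R => h (RtoC (cl (fst p)) * cis (snd p))%C).
  assert (Hk : ccont2 k).
  { intros [s t]. apply (ccont_comp (X := R2) (fun p => RtoC (cl (fst p)) * cis (snd p))%C h).
    - cts.
    - apply Hc. cbn [fst snd]. rewrite Cmod_scal_cis; apply Hcl. }
  set (M := fun s => CI (fun t => k (s, t))).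
  assert (E : forall pr, pr = Re \/ pr = Im -> pr (M r) = pr (M 0)).
  { intros pr Hpr. apply (is_derive_zero_const (fun s => pr (M s))); [lra| |].
    - intros s Hs. replace 0 with (RI (fun t => pr (radial_D h s t))).
      + apply is_derive_ext_loc with (fun u => RI (fun t => pr (h (RtoC u * cis t)%C))).
        * apply filter_imp with (2 := annulus_locally r s Hs). intros u Hu.
          unfold M, k. cbn [fst snd]. rewrite Hcl' by lra.
          destruct Hpr as [-> | ->]; reflexivity.
        * now apply circle_mean_derive with r.
      + pose proof (radial_D_integral h r s Hs Hh) as Z.
        destruct Hpr as [-> | ->]; [apply (f_equal Re) in Z | apply (f_equal Im) in Z]; exact Z.
    - intros s _. destruct Hpr as [-> | ->]; [apply ccont_Re|apply ccont_Im]; now apply ccontR_CI1. }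
  assert (EM : M r = M 0).
  { rewrite (surjective_pairing (M r)), (surjective_pairing (M 0)). f_equal; [apply (E Re)|apply (E Im)]; auto. }
  unfold M, k in EM. cbn [fst snd] in EM. rewrite !Hcl' in EM by lra.
  rewrite EM. rewrite <- CI_const. apply CI_ext. intros t. f_equal. ring.
Qed.

(** * Energy forms *)

Lemma ccont2_mult f g : ccont2 f -> ccont2 g -> ccont2 (fun p => f p * g p)%C.
Proof. intros Hf Hg p. now apply ccont_mult. Qed.
Lemma ccontR_mult f g : ccontR f -> ccontR g -> ccontR (fun p => f p * g p)%C.
Proof. intros Hf Hg p. now apply ccont_mult. Qed.
Lemma ccontR_conj f : ccontR f -> ccontR (fun p => Cconj (f p))%C.
Proof. intros Hf p. now apply ccont_conj. Qed.
Lemma ccontR_const c : ccontR (fun _ => c).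
Proof. intros p. apply ccont_const. Qed.

(** Mutual energy of the complex charge densities x and y for the kernel K, kept as an iterated
    integral so that no integration over the plane is involved. *)
Definition form (K : R * R -> C) (x y : R -> C) : C :=
  CI (fun s => Cconj (y s) * CI (fun t => x t * K (t, s)))%C.

Lemma ccontR_inner K x : ccont2 K -> ccontR x -> ccontR (fun s => CI (fun t => x t * K (t, s))%C).
Proof.
  intros HK Hx. apply (ccontR_CI2 (fun p => x (fst p) * K p)%C).
  apply ccont2_mult; auto. now apply ccont2_fst.
Qed.

Lemma ccontR_slice_mult K x s : ccont2 K -> ccontR x -> ccontR (fun t => x t * K (t, s))%C.
Proof. intros HK Hx. apply ccontR_mult; auto. now apply ccontR_slice2. Qed.

Lemma ccontR_form K x y : ccont2 K -> ccontR x -> ccontR y ->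
  ccontR (fun s => Cconj (y s) * CI (fun t => x t * K (t, s)))%C.
Proof. intros. apply ccontR_mult; [now apply ccontR_conj|now apply ccontR_inner]. Qed.

Lemma form_ext K K' x y : (forall p, K p = K' p) -> form K x y = form K' x y.
Proof.
  intros H. apply CI_ext. intros s. f_equal. apply CI_ext. intros t. now rewrite H.
Qed.

Lemma form_plus K K' x y : ccont2 K -> ccont2 K' -> ccontR x -> ccontR y ->
  form (fun p => K p + K' p)%C x y = (form K x y + form K' x y)%C.
Proof.
  intros. unfold form. rewrite <- CI_plus; try now apply ccontR_form.
  apply CI_ext. intros s. rewrite <- Cmult_plus_distr_l. f_equal.
  rewrite <- CI_plus; try now apply ccontR_slice_mult.
  apply CI_ext. intros t. ring.
Qed.

Lemma form_scal c K x y : ccont2 K -> ccontR x -> ccontR y ->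
  form (fun p => c * K p)%C x y = (c * form K x y)%C.
Proof.
  intros. unfold form. rewrite <- CI_scal; try now apply ccontR_form.
  apply CI_ext. intros s.
  replace (c * (Cconj (y s) * CI (fun t : R => x t * K (t, s))))%C with
   (Cconj (y s) * (c * CI (fun t : R => x t * K (t, s))))%C by ring. f_equal.
  rewrite <- CI_scal; try now apply ccontR_slice_mult.
  apply CI_ext. intros t. ring.
Qed.

Lemma form_opp K x y : ccont2 K -> ccontR x -> ccontR y ->
  form (fun p => - K p)%C x y = (- form K x y)%C.
Proof.
  intros. rewrite (form_ext _ (fun p => - RtoC 1 * K p)%C) by (intros; ring).
  rewrite form_scal by auto. ring.
Qed.

Lemma form_plus_l K x x' y : ccont2 K -> ccontR x -> ccontR x' -> ccontR y ->
  form K (fun t => x t + x' t)%C y = (form K x y + form K x' y)%C.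
Proof.
  intros. unfold form. rewrite <- CI_plus; try now apply ccontR_form.
  apply CI_ext. intros s. rewrite <- Cmult_plus_distr_l. f_equal.
  rewrite <- CI_plus; try now apply ccontR_slice_mult.
  apply CI_ext. intros t. ring.
Qed.

Lemma form_plus_r K x y y' : ccont2 K -> ccontR x -> ccontR y -> ccontR y' ->
  form K x (fun t => y t + y' t)%C = (form K x y + form K x y')%C.
Proof.
  intros. unfold form. rewrite <- CI_plus; try now apply ccontR_form.
  apply CI_ext. intros s. rewrite Cplus_conj. ring.
Qed.

Lemma form_scal_l K c x y : ccont2 K -> ccontR x -> ccontR y ->
  form K (fun t => c * x t)%C y = (c * form K x y)%C.
Proof.
  intros. unfold form. rewrite <- CI_scal; try now apply ccontR_form.
  apply CI_ext. intros s.
  replace (c * (Cconj (y s) * CI (fun t : R => x t * K (t, s))))%C with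
   (Cconj (y s) * (c * CI (fun t : R => x t * K (t, s))))%C by ring. f_equal.
  rewrite <- CI_scal; try now apply ccontR_slice_mult.
  apply CI_ext. intros t. ring.
Qed.

Lemma form_scal_r K c x y : ccont2 K -> ccontR x -> ccontR y ->
  form K x (fun t => c * y t)%C = (Cconj c * form K x y)%C.
Proof.
  intros. unfold form. rewrite <- CI_scal; try now apply ccontR_form.
  apply CI_ext. intros s. rewrite Cmult_conj. ring.
Qed.

(** Schur-type estimate: only the integrals of the majorant in one variable enter. This matters for
    a majorant that stays equal to 1 on the diagonal while its mass tends to 0. *)
Lemma form_bound K g x X G : ccont2 K -> cont2 g -> ccontR x ->
  (forall t, 0 <= t <= 2 * PI -> Cmod (x t) <= X) ->
  (forall t s, 0 <= t <= 2 * PI -> 0 <= s <= 2 * PI -> Cmod (K (t, s)) <= g (t, s)) ->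
  (forall s, RI (fun t => g (t, s)) <= G) ->
  Cmod (form K x x) <= 2 * PI * (X * (X * G)).
Proof.
  intros HK Hg Hx HX Hb HG. rewrite <- RI_const.
  pose proof two_PI_pos as H2.
  assert (X0 : 0 <= X).
  { eapply Rle_trans; [apply Cmod_ge_0|apply (HX 0); lra]. }
  apply Cmod_CI_le.
  - now apply ccontR_form.
  - intros; apply continuous_const.
  - intros s Hs. rewrite Cmod_mult, Cmod_conj.
    apply Rmult_le_compat; auto using Cmod_ge_0.
    apply Rle_trans with (X * RI (fun t => g (t, s))); [|now apply Rmult_le_compat_l].
    rewrite <- RI_scal by (now apply (continuous_slice_r g)).
    apply Cmod_CI_le.
    + now apply ccontR_slice_mult.
    + intros t. apply continuous_Rmult; [apply continuous_const|now apply (continuous_slice_r g)].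
    + intros t Ht. rewrite Cmod_mult. apply Rmult_le_compat; auto using Cmod_ge_0.
Qed.

(** Neutrality of the charge enters here and in the next lemma: a kernel that depends on one
    variable only carries no energy. *)
Lemma form_const_l l x : ccontR l -> ccontR x -> CI x = RtoC 0 ->
  form (fun p => l (fst p)) x x = RtoC 0.
Proof.
  intros Hl Hx H0. unfold form.
  rewrite (CI_ext _ (fun s => Cconj (x s) * CI (fun t => x t * l t))%C) by reflexivity.
  rewrite CI_scal_r by now apply ccontR_conj. rewrite CI_conj by auto. rewrite H0.
  replace (Cconj 0) with (RtoC 0) by (unfold Cconj, RtoC; simpl; f_equal; ring). ring.
Qed.

Lemma form_const_r l x : ccontR l -> ccontR x -> CI x = RtoC 0 ->
  form (fun p => l (snd p)) x x = RtoC 0.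
Proof.
  intros Hl Hx H0. unfold form. apply CI_0. intros s. cbn [snd].
  rewrite CI_scal_r by auto. rewrite H0. ring.
Qed.

Section Positivity.
Variables v1 v2 v3 : R -> R.
Hypothesis c1 : forall t, continuous v1 t.
Hypothesis c2 : forall t, continuous v2 t.
Hypothesis c3 : forall t, continuous v3 t.

Let k (p : R * R) : R := v1 (fst p) * v1 (snd p) + v2 (fst p) * v2 (snd p) + v3 (fst p) * v3 (snd p).

Lemma cont2_gram : cont2 k.
Proof.
  pose proof (cont2_fst v1 c1). pose proof (cont2_fst v2 c2). pose proof (cont2_fst v3 c3).
  pose proof (cont2_snd v1 c1). pose proof (cont2_snd v2 c2). pose proof (cont2_snd v3 c3).
  intros p. unfold k. cts.
Qed.

Lemma ccont2_gram_pow n : ccont2 (fun p => RtoC (k p ^ n)).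
Proof. intros p. apply ccont_RtoC, continuous_pow_comp, cont2_gram. Qed.

(** The factor v(t) v(s) of the kernel is absorbed into the charge; v is real, so conjugation leaves
    it unchanged. *)
Lemma form_gram_step n (v : R -> R) x : (forall t, continuous v t) -> ccontR x ->
  form (fun p => RtoC (v (fst p) * v (snd p)) * RtoC (k p ^ n))%C x x =
  form (fun p => RtoC (k p ^ n)) (fun t => x t * v t)%C (fun t => x t * v t)%C.
Proof.
  intros Hv Hx. apply CI_ext. intros s. cbn [fst snd].
  assert (Hxv : ccontR (fun t => x t * v t)%C).
  { apply ccontR_mult; auto. intros t. now apply ccont_RtoC. }
  rewrite Cmult_conj.
  replace (Cconj (v s)) with (RtoC (v s)) by (unfold Cconj, RtoC; simpl; f_equal; ring).
  rewrite <- Cmult_assoc. f_equal. rewrite <- CI_scal.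
  - apply CI_ext. intros t. rewrite RtoC_mult. ring.
  - apply (ccontR_slice_mult (fun p => RtoC (k p ^ n))); auto. apply ccont2_gram_pow.
Qed.

(** Schur's product argument: splitting off one factor of the Gram kernel leaves three forms of the
    lower power, with charges x v1, x v2, x v3. For n = 0 the form is |CI x|^2. *)
Lemma form_gram_pow_nonneg n : forall x, ccontR x -> 0 <= Re (form (fun p => RtoC (k p ^ n)) x x).
Proof.
  induction n as [|n IH]; intros x Hx.
  - rewrite (form_ext _ (fun _ => RtoC 1)) by reflexivity. unfold form.
    rewrite (CI_ext _ (fun s => Cconj (x s) * CI x)%C).
    2:{ intros s. f_equal. apply CI_ext. intros; ring. }
    rewrite CI_scal_r by now apply ccontR_conj. rewrite CI_conj by auto.
    replace (Re (Cconj (CI x) * CI x)) with (Cmod (CI x) * Cmod (CI x)) by (rewrite Cmod_sqr; unfold Re, Im; simpl; ring).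
    pose proof (Cmod_ge_0 (CI x)). nra.
  - assert (Hxv : forall v, (forall t, continuous v t) -> ccontR (fun t => x t * RtoC (v t))%C).
    { intros v Hv. apply ccontR_mult; auto. intros t. now apply ccont_RtoC. }
    assert (HK : forall v, (forall t, continuous v t) -> ccont2 (fun p => RtoC (v (fst p) * v (snd p)) * RtoC (k p ^ n))%C).
    { intros v Hv. apply ccont2_mult; [|apply ccont2_gram_pow].
      intros p. apply ccont_RtoC. apply continuous_Rmult; [now apply (cont2_fst v)|now apply (cont2_snd v)]. }
    rewrite (form_ext _ (fun p => (RtoC (v1 (fst p) * v1 (snd p)) * RtoC (k p ^ n) + RtoC (v2 (fst p) * v2 (snd p)) * RtoC (k p ^ n))
      + RtoC (v3 (fst p) * v3 (snd p)) * RtoC (k p ^ n))%C).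
    2:{ intros p. rewrite <- !RtoC_mult, <- !RtoC_plus. f_equal. simpl. unfold k. ring. }
    rewrite !form_plus; auto.
    + rewrite !form_gram_step by auto. rewrite !re_plus.
      pose proof (IH _ (Hxv _ c1)). pose proof (IH _ (Hxv _ c2)). pose proof (IH _ (Hxv _ c3)). lra.
    + intros p. apply ccont_plus; now apply HK.
Qed.

(** Taylor polynomial of degree n of -ln (1 - u). Its coefficients are nonnegative, which carries
    positivity over from the powers. *)
Fixpoint log_partial (n : nat) (u : R) : R :=
  match n with O => 0 | S n => log_partial n u + u ^ S n / INR (S n) end.

Lemma log_partial_derive n u : u < 1 ->
  is_derive (fun u => - ln (1 - u) - log_partial n u) u (u ^ n / (1 - u)).
Proof.
  intros Hu.
  assert (D : is_derive (log_partial n) u ((1 - u ^ n) / (1 - u))).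
  { induction n as [|n IH]; simpl log_partial.
    - eapply is_derive_ext; [intros; reflexivity|]. replace ((1 - u ^ 0) / (1 - u)) with 0 by (simpl; field; lra).
      apply @is_derive_const.
    - replace ((1 - u ^ S n) / (1 - u)) with ((1 - u ^ n) / (1 - u) + u ^ n) by (simpl; field; lra).
      apply (is_derive_plus (K := R_AbsRing) (V := R_NormedModule) (log_partial n)); auto.
      assert (Hn : INR (S n) <> 0) by (apply not_0_INR; lia).
      apply is_derive_ext with (fun u => / INR (S n) * u ^ S n).
      { intros v. change (/ INR (S n) * v ^ S n = v ^ S n / INR (S n)). unfold Rdiv. ring. }
      replace (u ^ n) with (/ INR (S n) * (INR (S n) * u ^ n)) by (field; auto).
      apply (is_derive_scal (fun v => v ^ S n)).
      apply is_derive_Reals, (derivable_pt_lim_pow u (S n)). }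
  replace (u ^ n / (1 - u)) with (1 / (1 - u) - (1 - u ^ n) / (1 - u)) by (field; lra).
  apply (is_derive_minus (K := R_AbsRing) (V := R_NormedModule) (fun u => - ln (1 - u))); auto.
  auto_derive; [lra|]. field. lra.
Qed.

Lemma log_partial_0 n : log_partial n 0 = 0.
Proof. induction n; simpl; [auto|]. rewrite IHn. rewrite Rmult_0_l. unfold Rdiv. ring. Qed.

(** Mean value theorem between 0 and u: by the geometric sum, the remainder has derivative u^n/(1 -
    u). *)
Lemma log_partial_error n u q : 0 < q < 1 -> Rabs u <= q ->
  Rabs (- ln (1 - u) - log_partial n u) <= q ^ n / (1 - q).
Proof.
  intros Hq Hu.
  destruct (MVT_gen (fun u => - ln (1 - u) - log_partial n u) 0 u (fun u => u ^ n / (1 - u))) as [c [Hc E]].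
  - intros y Hy. apply log_partial_derive. apply Rabs_le_between in Hu.
    assert (Rmax 0 u < 1) by (apply Rmax_lub_lt; lra). lra.
  - intros y Hy. apply continuity_pt_filterlim. apply (ex_derive_continuous (K := R_AbsRing) (V := R_NormedModule) (fun u => - ln (1 - u) - log_partial n u) y).
    exists (y ^ n / (1 - y)). apply (log_partial_derive n y). apply Rabs_le_between in Hu.
    assert (Rmax 0 u < 1) by (apply Rmax_lub_lt; lra). lra.
  - assert (E0 : - ln (1 - 0) - log_partial n 0 = 0).
    { rewrite log_partial_0, (Rminus_0_r 1), ln_1. ring. }
    cbv beta in E. rewrite E0, !Rminus_0_r in E. rewrite E.
    assert (Hc' : Rabs c <= q).
    { apply Rabs_le_between in Hu. apply Rabs_le_between.
      assert (- q <= Rmin 0 u) by (apply Rmin_glb; lra). assert (Rmax 0 u <= q) by (apply Rmax_lub; lra). lra. }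
    assert (Hcq := Hc'). apply Rabs_le_between in Hcq.
    rewrite Rabs_mult. unfold Rdiv. rewrite Rabs_mult.
    rewrite (Rabs_pos_eq (/ (1 - c))) by (left; apply Rinv_0_lt_compat; lra).
    rewrite <- RPow_abs.
    apply Rle_trans with (q ^ n * / (1 - q) * 1); [|lra].
    apply Rmult_le_compat; [|apply Rabs_pos| |lra].
    + apply Rmult_le_pos; [apply pow_le, Rabs_pos|left; apply Rinv_0_lt_compat; lra].
    + apply Rmult_le_compat; [apply pow_le, Rabs_pos|left; apply Rinv_0_lt_compat; lra| |].
      * apply pow_incr. split; [apply Rabs_pos|auto].
      * apply Rinv_le_contravar; lra.
Qed.

Lemma cont2_log_partial n : cont2 (fun p => log_partial n (k p)).
Proof.
  induction n as [|n IH]; intros p; simpl.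
  - apply continuous_const.
  - apply continuous_Rplus; [apply IH|].
    unfold Rdiv. apply continuous_Rmult; [|apply continuous_const].
    apply (continuous_pow_comp (X := R2) k (S n)). apply cont2_gram.
Qed.

Lemma form_log_partial_nonneg n x : ccontR x ->
  0 <= Re (form (fun p => RtoC (log_partial n (k p))) x x).
Proof.
  intros Hx. induction n as [|n IH].
  - unfold form. rewrite CI_0; [apply Rle_refl|]. intros s. rewrite CI_0; [ring|]. intros t. simpl. ring.
  - assert (Hp : 0 < / INR (S n)) by (apply Rinv_0_lt_compat, lt_0_INR; lia).
    rewrite (form_ext _ (fun p => RtoC (log_partial n (k p)) + RtoC (/ INR (S n)) * RtoC (k p ^ S n))%C).
    2:{ intros p. simpl log_partial. rewrite RtoC_plus. f_equal. unfold Rdiv. rewrite RtoC_mult. apply Cmult_comm. }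
    rewrite form_plus; auto.
    + rewrite form_scal; auto using ccont2_gram_pow.
      rewrite re_plus, re_scal_l. pose proof (form_gram_pow_nonneg (S n) x Hx). nra.
    + intros p. apply ccont_RtoC, cont2_log_partial.
    + apply ccont2_mult; [|apply ccont2_gram_pow]. intros p. apply ccont_const.
Qed.

(** A limit of nonnegative forms: the bound q on the square of integration makes the truncation
    error geometric, and k < 1 on the whole plane keeps the logarithmic kernel continuous there. *)
Lemma form_log_nonneg x X q : ccontR x -> 0 < q < 1 ->
  (forall t, 0 <= t <= 2 * PI -> Cmod (x t) <= X) ->
  (forall p, k p < 1) ->
  (forall t s, 0 <= t <= 2 * PI -> 0 <= s <= 2 * PI -> Rabs (k (t, s)) <= q) ->
  0 <= Re (form (fun p => RtoC (- ln (1 - k p))) x x).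
Proof.
  intros Hx Hq HX Hk1 Hkq.
  assert (HL : ccont2 (fun p => RtoC (- ln (1 - k p)))).
  { intros p. apply ccont_RtoC, continuous_Ropp, continuous_ln_comp; [|specialize (Hk1 p); lra].
    apply continuous_Rminus; [apply continuous_const|apply cont2_gram]. }
  assert (HP : forall n, ccont2 (fun p => RtoC (log_partial n (k p)))).
  { intros n p. apply ccont_RtoC, cont2_log_partial. }
  destruct (Rle_or_lt 0 (Re (form (fun p => RtoC (- ln (1 - k p))) x x))) as [|Hneg]; auto.
  exfalso.
  (* A negative value would be within A q^n of a nonnegative number for every n. *)
  set (A := 2 * PI * (X * (X * (2 * PI))) / (1 - q)).
  assert (B : forall n, - Re (form (fun p => RtoC (- ln (1 - k p))) x x) <= A * q ^ n).
  { intros n.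
    assert (E : form (fun p => RtoC (- ln (1 - k p))) x x =
      (form (fun p => RtoC (log_partial n (k p))) x x +
       form (fun p => RtoC (- ln (1 - k p) - log_partial n (k p))) x x)%C).
    { rewrite <- form_plus; auto.
      - apply form_ext. intros p. rewrite RtoC_minus. ring.
      - intros p. 
        apply ccont_ext with (fun p => RtoC (- ln (1 - k p)) - RtoC (log_partial n (k p)))%C.
        + intros; now rewrite RtoC_minus.
        + apply ccont_minus; [apply HL|apply HP]. }
    rewrite E, re_plus.
    pose proof (form_log_partial_nonneg n x Hx).
    assert (Bd : Cmod (form (fun p => RtoC (- ln (1 - k p) - log_partial n (k p))) x x) <=
       2 * PI * (X * (X * (2 * PI * (q ^ n / (1 - q)))))).
    { apply (form_bound _ (fun _ => q ^ n / (1 - q))); auto.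
      - intros p. apply ccont_ext with (fun p => RtoC (- ln (1 - k p)) - RtoC (log_partial n (k p)))%C.
        + intros; now rewrite RtoC_minus.
        + apply ccont_minus; [apply HL|apply HP].
      - intros p; apply continuous_const.
      - intros t s Ht Hs. rewrite Cmod_R. apply log_partial_error; auto.
      - intros s. rewrite RI_const. lra. }
    pose proof (re_le_Cmod (form (fun p => RtoC (- ln (1 - k p) - log_partial n (k p))) x x)) as R1.
    apply Rabs_le_between in R1. unfold A.
    replace (2 * PI * (X * (X * (2 * PI))) / (1 - q) * q ^ n) with (2 * PI * (X * (X * (2 * PI * (q ^ n / (1 - q)))))) by (field; lra).
    lra. }
  set (d := - Re (form (fun p => RtoC (- ln (1 - k p))) x x)) in *.
  assert (Hd : 0 < d) by (unfold d; lra).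
  assert (HA : 0 < A) by (specialize (B 0%nat); simpl in B; lra).
  destruct (pow_lt_1_zero q) with (y := d / A) as [N HN].
  - rewrite Rabs_pos_eq; lra.
  - now apply Rdiv_lt_0_compat.
  - specialize (HN N (le_n N)). rewrite Rabs_pos_eq in HN by (apply pow_le; lra).
    specialize (B N). apply Rmult_lt_compat_l with (r := A) in HN; auto.
    replace (A * (d / A)) with d in HN by (field; lra). lra.
Qed.
End Positivity.

Lemma form_log_energy_nonpos (w x : R -> C) (e X W : R) :
  ccontR w -> ccontR x -> CI x = RtoC 0 -> 0 < e ->
  (forall t, 0 <= t <= 2 * PI -> Cmod (x t) <= X) ->
  (forall t, 0 <= t <= 2 * PI -> Cmod (w t) <= W) ->
  Re (form (fun p => RtoC (ln (Cmod (w (fst p) - w (snd p)) ^ 2 + e))) x x) <= 0.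
Proof.
  intros Hw Hx H0 He HX HW.
  (* The summand e/2 pushes the stereographic image strictly inside the ball: |v|^2 = 1 - 2 e/(1 +
     A)^2. On a bounded curve this yields one bound q < 1 for all inner products. *)
  set (A := fun t => Re (w t) ^ 2 + Im (w t) ^ 2 + e / 2).
  set (v1 := fun t => (1 - A t) / (1 + A t)).
  set (v2 := fun t => 2 * Re (w t) / (1 + A t)).
  set (v3 := fun t => 2 * Im (w t) / (1 + A t)).
  assert (HA : forall t, e / 2 <= A t).
  { intros t. unfold A. pose proof (pow2_ge_0 (Re (w t))). pose proof (pow2_ge_0 (Im (w t))). lra. }
  assert (CA : forall t, continuous A t).
  { intros t. unfold A. cts. }
  assert (CA1 : forall t, continuous (fun t => / (1 + A t)) t).
  { intros t. apply continuous_Rinv_comp.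
    - cts.
    - specialize (HA t). lra. }
  assert (C1 : forall t, continuous v1 t).
  { intros t. apply continuous_Rmult; [|apply CA1]. apply continuous_Rminus; [apply continuous_const|apply CA]. }
  assert (C2 : forall t, continuous v2 t).
  { intros t. apply continuous_Rmult; [|apply CA1]. apply continuous_Rmult; [apply continuous_const|apply ccont_Re, Hw]. }
  assert (C3 : forall t, continuous v3 t).
  { intros t. apply continuous_Rmult; [|apply CA1]. apply continuous_Rmult; [apply continuous_const|apply ccont_Im, Hw]. }
  set (k := fun p : R * R => v1 (fst p) * v1 (snd p) + v2 (fst p) * v2 (snd p) + v3 (fst p) * v3 (snd p)).
  assert (Ek : forall p, 1 - k p = 2 * (Cmod (w (fst p) - w (snd p)) ^ 2 + e) / ((1 + A (fst p)) * (1 + A (snd p)))).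
  { intros [t s]. unfold k, v1, v2, v3. cbn [fst snd].
    rewrite Cmod2_alt. pose proof (HA t). pose proof (HA s).
    unfold Cminus. rewrite re_plus, im_plus, re_opp, im_opp.
    field_simplify_eq; [|lra]. unfold A. field. }
  assert (Hk1 : forall p, k p < 1).
  { intros p. pose proof (Ek p) as E. pose proof (HA (fst p)). pose proof (HA (snd p)).
    assert (0 < 2 * (Cmod (w (fst p) - w (snd p)) ^ 2 + e) / ((1 + A (fst p)) * (1 + A (snd p)))).
    { pose proof (pow2_ge_0 (Cmod (w (fst p) - w (snd p)))). apply Rdiv_lt_0_compat; [lra|]. apply Rmult_lt_0_compat; lra. }
    lra. }
  set (a := W ^ 2 + e / 2).
  (* The maximum with 1/2 only secures q > 0. *)
  set (q := Rmax (1 / 2) (1 - 2 * e / (1 + a) ^ 2)).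
  assert (Ha : 0 < a) by (unfold a; pose proof (pow2_ge_0 W); lra).
  assert (Hq : 0 < q < 1).
  { unfold q. split; [apply Rlt_le_trans with (1 / 2); [lra|apply Rmax_l]|].
    apply Rmax_lub_lt; [lra|].
    assert (0 < 2 * e / (1 + a) ^ 2) by (apply Rdiv_lt_0_compat; [lra|apply pow_lt; lra]). lra. }
  assert (Hn : forall t, 0 <= t <= 2 * PI -> v1 t ^ 2 + v2 t ^ 2 + v3 t ^ 2 <= q).
  { intros t Ht. apply Rle_trans with (1 - 2 * e / (1 + a) ^ 2); [|apply Rmax_r].
    pose proof (HA t).
    replace (v1 t ^ 2 + v2 t ^ 2 + v3 t ^ 2) with (1 - 2 * e / (1 + A t) ^ 2).
    2:{ unfold v1, v2, v3. field_simplify_eq; [|lra]. unfold A. field. }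
    assert (A t <= a).
    { unfold A, a. rewrite <- Cmod2_alt. pose proof (HW t Ht). pose proof (Cmod_ge_0 (w t)). nra. }
    assert (/ (1 + a) ^ 2 <= / (1 + A t) ^ 2).
    { apply Rinv_le_contravar; [apply pow_lt; lra|]. apply pow_incr. lra. }
    unfold Rdiv. nra. }
  assert (Hkq : forall t s, 0 <= t <= 2 * PI -> 0 <= s <= 2 * PI -> Rabs (k (t, s)) <= q).
  { intros t s Ht Hs. pose proof (Hn t Ht). pose proof (Hn s Hs). unfold k. cbn [fst snd].
    pose proof (pow2_ge_0 (v1 t - v1 s)). pose proof (pow2_ge_0 (v1 t + v1 s)).
    pose proof (pow2_ge_0 (v2 t - v2 s)). pose proof (pow2_ge_0 (v2 t + v2 s)).
    pose proof (pow2_ge_0 (v3 t - v3 s)). pose proof (pow2_ge_0 (v3 t + v3 s)).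
    apply Rabs_le. split; nra. }
  pose proof (form_log_nonneg v1 v2 v3 C1 C2 C3 x X q Hx Hq HX Hk1 Hkq) as Hpos.
  fold k in Hpos.
  assert (Cl : ccontR (fun t => RtoC (ln ((1 + A t) / 2)))).
  { intros t. apply ccont_RtoC, continuous_ln_comp; [|specialize (HA t); lra].
    apply continuous_Rmult; [|apply continuous_const]. apply continuous_Rplus; [apply continuous_const|apply CA]. }
  assert (Cr : ccontR (fun t => RtoC (ln (1 + A t)))).
  { intros t. apply ccont_RtoC, continuous_ln_comp; [|specialize (HA t); lra].
    apply continuous_Rplus; [apply continuous_const|apply CA]. }
  assert (Ck : ccont2 (fun p => RtoC (- ln (1 - k p)))).
  { intros p. apply ccont_RtoC, continuous_Ropp, continuous_ln_comp; [|specialize (Hk1 p); lra].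
    apply continuous_Rminus; [apply continuous_const|]. now apply cont2_gram. }
  (* The logarithm is the sum of two one-variable terms, invisible to a neutral charge, and of the
     negative of the positive kernel -ln (1 - k). *)
  rewrite (form_ext _ (fun p => (RtoC (ln ((1 + A (fst p)) / 2)) + RtoC (ln (1 + A (snd p)))) + - RtoC (- ln (1 - k p)))%C).
  - rewrite form_plus; auto.
    + rewrite form_plus; auto.
      * rewrite (form_const_l (fun t => RtoC (ln ((1 + A t) / 2)))), (form_const_r (fun t => RtoC (ln (1 + A t)))); auto.
        rewrite form_opp by auto. rewrite !re_plus, re_opp. change (Re (RtoC 0)) with 0. cbv beta in *. lra.
      * now apply (ccont2_fst (fun t => RtoC (ln ((1 + A t) / 2)))).
      * now apply (ccont2_snd (fun t => RtoC (ln (1 + A t)))).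
    + intros p. apply ccont_plus.
      * now apply (ccont2_fst (fun t => RtoC (ln ((1 + A t) / 2)))).
      * now apply (ccont2_snd (fun t => RtoC (ln (1 + A t)))).
    + intros p. apply ccont_opp, Ck.
  - intros p. rewrite <- RtoC_opp, <- !RtoC_plus. f_equal.
    pose proof (HA (fst p)). pose proof (HA (snd p)). pose proof (Hk1 p).
    rewrite Ropp_involutive. rewrite <- !ln_mult; try lra.
    + f_equal. rewrite Ek. field. lra.
    + apply Rmult_lt_0_compat; lra.
Qed.

(** * Injective holomorphic functions *)

Definition CC := prod_UniformSpace C_UniformSpace C_UniformSpace.

Lemma locally_CC (z0 w0 : C) (P : C * C -> Prop) :
  (exists d, 0 < d /\ forall z w, Cmod (z - z0) < d -> Cmod (w - w0) < d -> P (z, w)) ->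
  @locally CC (z0, w0) P.
Proof.
  intros [d [Hd H]].
  assert (L : forall u : C, @locally C_UniformSpace u (fun z => Cmod (z - u) < d)).
  { intros u. apply locally_Cmod. exists d; auto. }
  destruct (L z0) as [e1 H1]. destruct (L w0) as [e2 H2].
  assert (He : 0 < Rmin e1 e2) by (apply Rmin_pos; apply cond_pos).
  exists (mkposreal _ He). intros [z w] [Hz Hw]. apply H.
  - apply H1. eapply ball_le; [|exact Hz]. apply Rmin_l.
  - apply H2. eapply ball_le; [|exact Hw]. apply Rmin_r.
Qed.

Lemma locally_disk Rad z : Cmod z < Rad -> @locally C_UniformSpace z (fun w => Cmod w < Rad).
Proof.
  intros H. apply locally_Cmod. exists (Rad - Cmod z). split; [lra|]. intros w Hw.
  replace w with ((w - z) + z)%C by ring. eapply Rle_lt_trans; [apply Cmod_triangle|]. lra.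
Qed.

Lemma locally_not_eq (a z : C) : z <> a -> @locally C_UniformSpace z (fun w => w <> a).
Proof.
  intros H. assert (H' : (z - a)%C <> RtoC 0) by now apply Csub_neq_0. apply Cmod_gt_0 in H'.
  apply locally_Cmod. exists (Cmod (z - a)); split; auto. intros w Hw ->.
  replace (a - z)%C with (- (z - a))%C in Hw by ring. rewrite Cmod_opp in Hw. lra.
Qed.

Lemma Cmod_seg_lt z w p d : Cmod (z - p) < d -> Cmod (w - p) < d ->
  forall t, 0 <= t <= 1 -> Cmod (seg z w t - p) < d.
Proof.
  intros Hz Hw t Ht. unfold seg.
  replace (z + t * (w - z) - p)%C with (RtoC (1 - t) * (z - p) + RtoC t * (w - p))%C by (rewrite RtoC_minus; ring).
  eapply Rle_lt_trans; [apply Cmod_triangle|]. rewrite !Cmod_mult, !Cmod_R, !Rabs_pos_eq by lra.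
  destruct (Req_dec t 0) as [->|].
  - lra.
  - assert (t * Cmod (w - p) < t * d) by (apply Rmult_lt_compat_l; lra).
    assert ((1 - t) * Cmod (z - p) <= (1 - t) * d) by (apply Rmult_le_compat_l; lra). lra.
Qed.

Lemma Cmod_sub_sym z w : Cmod (z - w) = Cmod (w - z).
Proof. rewrite <- Cmod_opp. f_equal. ring. Qed.

Lemma Cmod_triangle_inv a b : Cmod a - Cmod b <= Cmod (a - b).
Proof.
  assert (Cmod a <= Cmod (a - b) + Cmod b); [|lra].
  eapply Rle_trans; [|apply Cmod_triangle]. right. f_equal. ring.
Qed.

Section DiskFunction.
Variables (F F1 F2 : C -> C) (Rad : R).
Hypothesis dF : forall z, Cmod z < Rad -> cder F z (F1 z).
Hypothesis dF1 : forall z, Cmod z < Rad -> cder F1 z (F2 z).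
Hypothesis cF2 : forall z, Cmod z < Rad -> ccont (X := C_UniformSpace) F2 z.
Hypothesis injF : forall z w, Cmod z < Rad -> Cmod w < Rad -> F z = F w -> z = w.
Hypothesis F1_0 : F1 (RtoC 0) <> RtoC 0.

Lemma F_cont z : Cmod z < Rad -> ccont (X := C_UniformSpace) F z.
Proof. intros H. eapply cder_ccont. now apply dF. Qed.

Lemma F1_cont z : Cmod z < Rad -> ccont (X := C_UniformSpace) F1 z.
Proof. intros H. eapply cder_ccont. now apply dF1. Qed.

Lemma F_c1at z : Cmod z < Rad -> c1at F z.
Proof.
  intros H. exists F1. split; [|now apply F1_cont].
  apply filter_imp with (2 := locally_disk Rad z H). auto.
Qed.

Lemma F1_c1at z : Cmod z < Rad -> c1at F1 z.
Proof.
  intros H. exists F2. split; [|now apply cF2].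
  apply filter_imp with (2 := locally_disk Rad z H). auto.
Qed.

(** Mean value inequality for u -> G u - G1 p u near p. Both points may move, which continuity of
    difference quotients on the diagonal requires and differentiability at p alone does not give. *)
Lemma strict_diff (G G1 : C -> C) p e : Cmod p < Rad -> 0 < e ->
  (forall z, Cmod z < Rad -> cder G z (G1 z)) -> ccont (X := C_UniformSpace) G1 p ->
  exists d, 0 < d /\ (forall z, Cmod (z - p) < d -> Cmod z < Rad) /\
    forall z w, Cmod (z - p) < d -> Cmod (w - p) < d ->
    Cmod (G z - G w - G1 p * (z - w)) <= e * Cmod (z - w).
Proof.
  intros Hp He HG Hc.
  destruct (proj1 (locally_Cmod _ _) (locally_disk Rad p Hp)) as [d1 [Hd1 H1]].
  destruct (proj1 (ccont_C_eps _ _) Hc e He) as [d2 [Hd2 H2]].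
  exists (Rmin d1 d2). split; [now apply Rmin_pos|]. split.
  { intros z Hz. apply H1. eapply Rlt_le_trans; [exact Hz|apply Rmin_l]. }
  intros z w Hz Hw.
  pose proof (cmod_mean_value (fun u => G u - G1 p * u)%C (fun u => G1 u - G1 p)%C w z e) as M.
  replace (G z - G w - G1 p * (z - w))%C with (G z - G1 p * z - (G w - G1 p * w))%C by ring.
  apply M. intros t Ht.
  pose proof (Cmod_seg_lt w z p _ Hw Hz t Ht) as Hs. split.
  - apply cder_minus.
    + apply HG, H1. eapply Rlt_le_trans; [exact Hs|apply Rmin_l].
    + eapply cder_eq; [apply cder_mult; [apply cder_const|apply cder_id]|]. cbv beta; ring.
  - left. apply H2. eapply Rlt_le_trans; [exact Hs|apply Rmin_r].
Qed.

(** As a function of u in place of w the expression vanishes at u = z, and its derivative F1 u - F1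
    z + F2 p (z - u) is controlled by strict differentiability of F1. *)
Lemma strict_diff2 p e : Cmod p < Rad -> 0 < e ->
  exists d, 0 < d /\
    forall z w, Cmod (z - p) < d -> Cmod (w - p) < d ->
    Cmod (F1 z * (z - w) - (F z - F w) - F2 p / 2 * ((z - w) * (z - w))) <= e * (Cmod (z - w) * Cmod (z - w)).
Proof.
  intros Hp He.
  destruct (strict_diff F1 F2 p e Hp He dF1 (cF2 p Hp)) as [d [Hd [Hb H]]].
  exists d; split; auto. intros z w Hz Hw.
  pose proof (cmod_mean_value (fun u => F1 z * (z - u) - (F z - F u) - F2 p / 2 * ((z - u) * (z - u)))%C
    (fun u => F1 u - F1 z + F2 p * (z - u))%C z w (e * Cmod (z - w))) as M.
  cbv beta in M.
  replace (F1 z * (z - w) - (F z - F w) - F2 p / 2 * ((z - w) * (z - w)))%C with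
   (F1 z * (z - w) - (F z - F w) - F2 p / 2 * ((z - w) * (z - w)) -
       (F1 z * (z - z) - (F z - F z) - F2 p / 2 * ((z - z) * (z - z))))%C by ring.
  rewrite <- Rmult_assoc. rewrite (Cmod_sub_sym z w) at 2. apply M. intros t Ht.
  pose proof (Cmod_seg_lt z w p _ Hz Hw t Ht) as Hs. split.
  - eapply cder_eq.
    + apply cder_minus; [apply cder_minus|].
      * apply cder_mult; [apply cder_const|apply cder_minus; [apply cder_const|apply cder_id]].
      * apply cder_minus; [apply cder_const|apply dF, Hb, Hs].
      * apply cder_mult; [apply cder_const|].
        apply cder_mult; (apply cder_minus; [apply cder_const|apply cder_id]).
    + cbv beta. field.
  - replace (F1 (seg z w t) - F1 z + F2 p * (z - seg z w t))%C with
      (F1 (seg z w t) - F1 z - F2 p * (seg z w t - z))%C by ring.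
    eapply Rle_trans; [apply H; auto|]. apply Rmult_le_compat_l; [lra|].
    unfold seg. replace (z + t * (w - z) - z)%C with (t * (w - z))%C by ring.
    rewrite Cmod_mult, Cmod_R, Rabs_pos_eq, (Cmod_sub_sym z w) by lra.
    pose proof (Cmod_ge_0 (w - z)). nra.
Qed.

(* If [F1 p' <> 0] for [p'] near a zero [p] of [F1], the mean value property of the reciprocal of
   [(F (p' + h) - F (p' - h)) / (2 h)], which has no zeros by injectivity, bounds [1 / F1 p']. *)
Lemma F1_zeros_open p : Cmod p < Rad -> F1 p = RtoC 0 ->
  @locally C_UniformSpace p (fun w => F1 w = RtoC 0).
Proof.
  intros Hp Hz.
  destruct (strict_diff F F1 p 1 Hp Rlt_0_1 dF (F1_cont p Hp)) as [d [Hd [Hb HL]]].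
  (* For |p' - p| < r and |h| <= r the points p' + h and p' - h stay within d of p. *)
  set (r := d / 3).
  assert (Hr : 0 < r) by (unfold r; lra).
  assert (Hin : forall p' h, Cmod (p' - p) < r -> Cmod h <= r -> Cmod (p' + h - p) < d).
  { intros p' h H1 H2. replace (p' + h - p)%C with ((p' - p) + h)%C by ring.
    eapply Rle_lt_trans; [apply Cmod_triangle|]. unfold r in *; lra. }
  assert (Hpp : Cmod (p - p) < r).
  { replace (p - p)%C with (RtoC 0) by ring. rewrite Cmod_0. exact Hr. }
  assert (Hinj : forall p' h, Cmod (p' - p) < r -> Cmod h <= r -> h <> RtoC 0 -> (F (p' + h) - F (p' - h))%C <> RtoC 0).
  { intros p' h H1 H2 H3. apply Csub_neq_0. intros E. apply H3.
    apply injF in E.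
    - replace h with (((p' + h) - (p' - h)) / 2)%C by (field; apply RtoC_neq; lra). rewrite E. field.
    - apply Hb, Hin; auto.
    - apply Hb. apply (Hin p' (- h)%C); auto. now rewrite Cmod_opp. }
  set (g := fun t => Cmod (F (p + r * cis t) - F (p - r * cis t))).
  destruct (continuity_ab_min g 0 (2 * PI)) as [t0 [Hmin _]].
  { left; apply two_PI_pos. }
  { intros t _. apply continuity_pt_filterlim. apply continuous_Cmod.
    assert (C1 : ccont (X := R_UniformSpace) (fun t => r * cis t)%C t).
    { cts. }
    assert (Cmod (r * cis t) <= r) by (rewrite Cmod_scal_cis; lra).
    apply ccont_minus.
    - apply (ccont_comp (X := R_UniformSpace) (fun t => p + r * cis t)%C F).
      + apply ccont_plus; auto. apply ccont_const.
      + apply F_cont, Hb, Hin; auto.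
    - apply (ccont_comp (X := R_UniformSpace) (fun t => p - r * cis t)%C F).
      + apply ccont_minus; auto. apply ccont_const.
      + apply F_cont, Hb. apply (Hin p (- (r * cis t))%C); auto. now rewrite Cmod_opp. }
  set (m := g t0) in *.
  assert (Hm : 0 < m).
  { apply Cmod_gt_0. apply Hinj; auto.
    - rewrite Cmod_scal_cis; lra.
    - apply Cmult_neq_0; [apply RtoC_neq; lra|apply cis_neq_0]. }
  destruct (proj1 (ccont_C_eps _ _) (F1_cont p Hp) (m / (4 * r))) as [d2 [Hd2 H2]].
  { apply Rdiv_lt_0_compat; lra. }
  apply locally_Cmod. exists (Rmin (Rmin r (m / 4)) d2).
  split. { repeat apply Rmin_pos; auto. lra. }
  intros p' Hp'.
  pose proof (Rmin_l (Rmin r (m / 4)) d2) as M1. pose proof (Rmin_r (Rmin r (m / 4)) d2) as M2.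
  pose proof (Rmin_l r (m / 4)) as M3. pose proof (Rmin_r r (m / 4)) as M4.
  destruct (Ceq_dec (F1 p') 0) as [|Hne]; auto. exfalso.
  assert (Hp'0 : Cmod p' < Rad).
  { apply Hb. unfold r in *; lra. }
  (* As F1 p = 0, the linear term drops out of strict differentiability: moving from p to p' changes
     F by at most |p' - p| < m/4 at each of the two points, so at least m/2 of the minimum m
     survives. *)
  assert (HF : forall h, Cmod h <= r -> Cmod (F (p' + h) - F (p + h)) <= Cmod (p' - p)).
  { intros h Hh. assert (A : Cmod (p' + h - p) < d) by (apply Hin; auto; lra).
    assert (B : Cmod (p + h - p) < d) by (apply Hin; auto).
    specialize (HL _ _ A B). rewrite Hz in HL.
    replace (p' + h - (p + h))%C with (p' - p)%C in HL by ring.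
    replace (F (p' + h) - F (p + h) - 0 * (p' - p))%C with (F (p' + h) - F (p + h))%C in HL by ring. lra. }
  (* The value at 0 is the limit F1 p' of the quotient, assumed nonzero here, so 1/G is continuous
     on the closed disk. *)
  set (G := fun h => if Ceq_dec h 0 then F1 p' else ((F (p' + h) - F (p' - h)) / (2 * h))%C).
  assert (HGne : forall h, Cmod h <= r -> G h <> RtoC 0).
  { intros h Hh. unfold G. destruct (Ceq_dec h (RtoC 0)) as [|H0]; auto.
    intros E. apply (Hinj p' h); auto. lra.
    replace (F (p' + h) - F (p' - h))%C with ((F (p' + h) - F (p' - h)) / (2 * h) * (2 * h))%C.
    - rewrite E. ring.
    - field; auto. }
  assert (HGc1 : forall h, 0 < Cmod h <= r -> c1at G h).
  { intros h Hh. assert (Hh0 : h <> RtoC 0) by (apply Cmod_gt_0; lra).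
    apply c1at_ext_loc with (fun h => (F (p' + h) - F (p' - h)) / (2 * h))%C.
    { apply filter_imp with (2 := locally_not_eq (RtoC 0) h Hh0). intros w Hw. unfold G.
      destruct (Ceq_dec w (RtoC 0)); congruence. }
    assert (shift : forall s : C, s = RtoC 1 \/ s = (- RtoC 1)%C -> c1at (fun h => F (p' + s * h)%C) h).
    { intros s Hs. exists (fun h => F1 (p' + s * h) * (0 + (0 * h + s * 1)))%C.
      assert (Hsm : Cmod s = 1) by (destruct Hs as [-> | ->]; [|rewrite Cmod_opp]; apply Cmod_1).
      assert (Hsh : Cmod (p' + s * h) < Rad).
      { apply Hb, Hin; [lra|]. rewrite Cmod_mult, Hsm. lra. }
      assert (Cc : ccont (X := C_UniformSpace) (fun h => p' + s * h)%C h).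
      { cts. }
      split.
      - apply (filter_imp (fun w => Cmod (p' + s * w) < Rad)).
        + intros w Hw. apply (cder_comp F (fun h => p' + s * h)%C); [|now apply dF].
          apply cder_plus; [apply cder_const|]. apply cder_mult; [apply cder_const|apply cder_id].
        + exact (Cc _ (locally_disk Rad _ Hsh)).
      - apply ccont_mult.
        + apply (ccont_comp (X := C_UniformSpace) (fun h => p' + s * h)%C F1); auto. now apply F1_cont.
        + cts. }
    apply c1at_div.
    - apply c1at_minus.
      + apply c1at_ext_loc with (fun h => F (p' + 1 * h)%C); [|apply shift; auto].
        apply filter_forall. intros w. f_equal. ring.
      + apply c1at_ext_loc with (fun h => F (p' + - RtoC 1 * h)%C); [|apply shift; auto].
        apply filter_forall. intros w. f_equal. ring.
    - apply c1at_mult; [apply c1at_const|apply c1at_id].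
    - apply Cmult_neq_0; auto. apply RtoC_neq; lra. }
  assert (HGc0 : ccont (X := C_UniformSpace) G (RtoC 0)).
  { apply ccont_C_eps. intros e He.
    destruct (strict_diff F F1 p' (e / 2) Hp'0 ltac:(lra) dF (F1_cont p' Hp'0)) as [d3 [Hd3 [_ H3]]].
    exists d3; split; auto. intros h Hh. unfold G. destruct (Ceq_dec (RtoC 0) (RtoC 0)) as [_|]; [|congruence].
    replace (h - 0)%C with h in Hh by ring.
    destruct (Ceq_dec h (RtoC 0)) as [->|H0].
    { replace (F1 p' - F1 p')%C with (RtoC 0) by ring. now rewrite Cmod_0. }
    assert (A : Cmod (p' + h - p') < d3) by (now replace (p' + h - p')%C with h by ring).
    assert (B : Cmod (p' - h - p') < d3) by (replace (p' - h - p')%C with (- h)%C by ring; now rewrite Cmod_opp).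
    specialize (H3 _ _ A B).
    replace (p' + h - (p' - h))%C with (2 * h)%C in H3 by ring.
    assert (H20 : (2 * h)%C <> RtoC 0) by (apply Cmult_neq_0; auto; apply RtoC_neq; lra).
    replace ((F (p' + h) - F (p' - h)) / (2 * h) - F1 p')%C with
      ((F (p' + h) - F (p' - h) - F1 p' * (2 * h)) / (2 * h))%C by (field; auto).
    rewrite Cmod_div by auto. apply Cmod_gt_0 in H20.
    apply Rle_lt_trans with (e / 2); [|lra].
    apply Rmult_le_reg_r with (Cmod (2 * h)); auto. unfold Rdiv at 1. rewrite Rmult_assoc, Rinv_l; lra. }
  pose proof (circle_mean (fun h => / G h)%C r Hr) as M.
  rewrite <- CI_const in M.
  assert (HGc : forall h, Cmod h <= r -> ccont (X := C_UniformSpace) G h).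
  { intros h Hh. destruct (Ceq_dec h (RtoC 0)) as [->|H0]; auto. apply c1at_ccont, HGc1.
    split; auto. now apply Cmod_gt_0. }
  assert (E : (RtoC (2 * PI) * / F1 p')%C = CI (fun t => / G (r * cis t)%C)%C).
  { rewrite M.
    - rewrite CI_const. unfold G. destruct (Ceq_dec (RtoC 0) (RtoC 0)); [reflexivity|congruence].
    - intros h Hh. apply ccont_inv; auto.
    - intros h Hh. apply c1at_inv; [apply HGc1; lra|apply HGne; lra]. }
  apply (f_equal Cmod) in E. rewrite Cmod_mult, Cmod_inv, Cmod_R, Rabs_pos_eq in E by (auto; left; apply two_PI_pos).
  assert (B : Cmod (CI (fun t => / G (r * cis t)%C)%C) <= RI (fun _ => 4 * r / m)).
  { apply Cmod_CI_le.
    - intros t. apply ccont_inv; [|apply HGne; rewrite Cmod_scal_cis; lra].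
      apply (ccont_comp (X := R_UniformSpace) (fun t => r * cis t)%C G).
      + cts.
      + apply HGc. rewrite Cmod_scal_cis; lra.
    - intros; apply continuous_const.
    - intros t Ht.
      assert (Hc : Cmod (r * cis t) = r) by (rewrite Cmod_scal_cis; lra).
      set (h := (r * cis t)%C) in *.
      assert (Hh0 : h <> RtoC 0) by (apply Cmod_gt_0; lra).
      rewrite Cmod_inv by (apply HGne; lra).
      unfold G. destruct (Ceq_dec h (RtoC 0)); [congruence|].
      assert (H20 : (2 * h)%C <> RtoC 0) by (apply Cmult_neq_0; auto; apply RtoC_neq; lra).
      rewrite Cmod_div by auto. rewrite Cmod_mult, Cmod_R, Hc, Rabs_pos_eq by lra.
      assert (Lb : m / 2 <= Cmod (F (p' + h) - F (p' - h))).
      { pose proof (Hmin t Ht) as Hgt. unfold g in Hgt. fold h in Hgt.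
        pose proof (HF h ltac:(lra)) as K1. pose proof (HF (- h)%C ltac:(rewrite Cmod_opp; lra)) as K2.
        change (p' + - h)%C with (p' - h)%C in K2. change (p + - h)%C with (p - h)%C in K2.
        assert (T : Cmod (F (p + h) - F (p - h)) <= Cmod (F (p' + h) - F (p' - h)) + Cmod (F (p' + h) - F (p + h)) + Cmod (F (p' - h) - F (p - h))).
        { replace (F (p + h) - F (p - h))%C with ((F (p' + h) - F (p' - h)) + - (F (p' + h) - F (p + h)) + (F (p' - h) - F (p - h)))%C by ring.
          eapply Rle_trans; [apply Cmod_triangle|]. apply Rplus_le_compat_r.
          eapply Rle_trans; [apply Cmod_triangle|]. rewrite Cmod_opp. lra. }
        fold m in Hgt. lra. }
      set (D := Cmod (F (p' + h) - F (p' - h))) in *.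
      unfold Rdiv. rewrite Rinv_mult, Rinv_inv.
      apply Rle_trans with (/ (m / 2) * (2 * r)).
      + apply Rmult_le_compat_r; [lra|]. apply Rinv_le_contravar; lra.
      + right. field. lra. }
  rewrite RI_const, <- E in B.
  pose proof two_PI_pos as H2P.
  apply Rmult_le_reg_l in B; auto.
  (* The mean value property has given 1/|F1 p'| <= 4 r/m; continuity of F1 at its zero p gives the
     opposite strict bound. *)
  assert (K : Cmod (F1 p') < m / (4 * r)).
  { specialize (H2 p'). rewrite Hz in H2. replace (F1 p' - 0)%C with (F1 p') in H2 by ring. apply H2. lra. }
  assert (Kp : 0 < Cmod (F1 p')) by now apply Cmod_gt_0.
  apply Rinv_lt_contravar in K; [|apply Rmult_lt_0_compat; auto; apply Rdiv_lt_0_compat; lra].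
  replace (/ (m / (4 * r))) with (4 * r / m) in K by (field; lra). lra.
Qed.

(** The zeros of F1 form a set that is open by the previous lemma and closed by continuity. Along
    the segment from 0 to p its indicator is locally constant, hence has derivative 0 and is
    constant; [F1_0] makes it 0 at the start. *)
Lemma F1_neq_0 p : Cmod p < Rad -> F1 p <> RtoC 0.
Proof.
  intros Hp E.
  set (b := fun t : R => if Ceq_dec (F1 (t * p)%C) 0 then 1 else 0).
  assert (Hin : forall t, 0 <= t <= 1 -> Cmod (t * p) < Rad).
  { intros t Ht. rewrite Cmod_mult, Cmod_R, Rabs_pos_eq by lra. pose proof (Cmod_ge_0 p). nra. }
  assert (Cs : forall t, ccont (X := R_UniformSpace) (fun t => RtoC t * p)%C t).
  { intros t. cts. }
  assert (HD : forall t, 0 <= t <= 1 -> is_derive b t 0).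
  { intros t Ht.
    assert (L : locally t (fun u => b u = b t)).
    { unfold b. destruct (Ceq_dec (F1 (t * p)%C) 0) as [Z|Z].
      - pose proof (Cs t _ (F1_zeros_open _ (Hin t Ht) Z)) as L.
        apply (filter_imp (fun u => F1 (RtoC u * p)%C = RtoC 0)); [|exact L].
        intros u Hu. destruct (Ceq_dec (F1 (u * p)%C) 0); congruence.
      - pose proof (Cs t _ (ccont_neq_0 F1 _ (F1_cont _ (Hin t Ht)) Z)) as L.
        apply (filter_imp (fun u => F1 (RtoC u * p)%C <> RtoC 0)); [|exact L].
        intros u Hu. destruct (Ceq_dec (F1 (u * p)%C) 0); congruence. }
    apply is_derive_ext_loc with (fun _ => b t).
    - apply filter_imp with (2 := L). auto.
    - apply @is_derive_const. }
  assert (E2 : b 1 = b 0).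
  { apply is_derive_zero_const; [lra| |].
    - intros t Ht. apply HD. lra.
    - intros t Ht. apply (ex_derive_continuous (K := R_AbsRing) (V := R_NormedModule) b t).
      exists 0. now apply HD. }
  unfold b in E2.
  destruct (Ceq_dec (F1 (1%R * p)%C) 0) as [|N]; [|apply N; replace (1%R * p)%C with p by ring; exact E].
  destruct (Ceq_dec (F1 (0%R * p)%C) 0) as [N|]; [|lra].
  apply F1_0. replace (0%R * p)%C with (RtoC 0) in N by ring. exact N.
Qed.
End DiskFunction.

(** * Difference quotients and their logarithmic derivative *)

Definition dq (F F1 : C -> C) (z w : C) : C :=
  if Ceq_dec z w then F1 z else ((F z - F w) / (z - w))%C.

(** Partial derivative of [dq] in z; the diagonal value is its limit, from the second-order Taylor
    expansion. *)
Definition dq2 (F F1 F2 : C -> C) (z w : C) : C :=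
  if Ceq_dec z w then (F2 z / 2)%C
  else ((F1 z * (z - w) - (F z - F w)) / ((z - w) * (z - w)))%C.

(** Logarithmic derivative in z of (F z - F w)/(z - w). It takes the place of a holomorphic
    logarithm of two variables. *)
Definition lq (F F1 F2 : C -> C) (z w : C) : C := (dq2 F F1 F2 z w / dq F F1 z w)%C.

Section DifferenceQuotient.
Variables (F F1 F2 : C -> C) (Rad : R).
Hypothesis dF : forall z, Cmod z < Rad -> cder F z (F1 z).
Hypothesis dF1 : forall z, Cmod z < Rad -> cder F1 z (F2 z).
Hypothesis cF2 : forall z, Cmod z < Rad -> ccont (X := C_UniformSpace) F2 z.
Hypothesis injF : forall z w, Cmod z < Rad -> Cmod w < Rad -> F z = F w -> z = w.
Hypothesis F1_0 : F1 (RtoC 0) <> RtoC 0.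

Lemma dq_neq_0 z w : Cmod z < Rad -> Cmod w < Rad -> dq F F1 z w <> RtoC 0.
Proof.
  intros Hz Hw. unfold dq. destruct (Ceq_dec z w) as [->|H].
  - now apply (F1_neq_0 F F1 F2 Rad).
  - intros E. apply H. apply injF; auto.
    replace (F z) with ((F z - F w) / (z - w) * (z - w) + F w)%C.
    + rewrite E. ring.
    + field. now apply Csub_neq_0.
Qed.

Lemma dq_sym z w : dq F F1 z w = dq F F1 w z.
Proof.
  destruct (Ceq_dec z w) as [->|H]; [reflexivity|].
  unfold dq. destruct (Ceq_dec z w) as [|_]; [congruence|]. destruct (Ceq_dec w z) as [|H']; [congruence|].
  field. split; now apply Csub_neq_0.
Qed.

Lemma ccont_CC_fst z w : ccont (X := CC) fst (z, w).
Proof. apply continuous_fst. Qed.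
Lemma ccont_CC_snd z w : ccont (X := CC) snd (z, w).
Proof. apply continuous_snd. Qed.

Lemma locally_CC_neq z w : z <> w -> @locally CC (z, w) (fun p => fst p <> snd p).
Proof.
  intros H. apply locally_CC. apply Csub_neq_0, Cmod_gt_0 in H.
  exists (Cmod (z - w) / 2). split; [lra|]. intros u v Hu Hv E. cbn [fst snd] in E. subst v.
  replace (z - w)%C with ((u - w) - (u - z))%C in Hu, Hv, H by ring.
  pose proof (Cmod_triangle (u - w) (- (u - z))) as T. rewrite Cmod_opp in T.
  replace ((u - w) + - (u - z))%C with ((u - w) - (u - z))%C in T by ring. lra.
Qed.

Lemma ccont_CC_comp_fst (G : C -> C) z w : ccont (X := C_UniformSpace) G z ->
  ccont (X := CC) (fun p => G (fst p)) (z, w).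
Proof. intros H. apply (ccont_comp (X := CC) fst G); auto. apply ccont_CC_fst. Qed.
Lemma ccont_CC_comp_snd (G : C -> C) z w : ccont (X := C_UniformSpace) G w ->
  ccont (X := CC) (fun p => G (snd p)) (z, w).
Proof. intros H. apply (ccont_comp (X := CC) snd G); auto. apply ccont_CC_snd. Qed.

Lemma dq_cont z w : Cmod z < Rad -> Cmod w < Rad ->
  ccont (X := CC) (fun p => dq F F1 (fst p) (snd p)) (z, w).
Proof.
  intros Hz Hw. destruct (Ceq_dec z w) as [<-|H].
  - apply ccont_eps. intros e He.
    destruct (strict_diff Rad F F1 z (e / 2) Hz ltac:(lra) dF (F1_cont F1 F2 Rad dF1 z Hz)) as [d [Hd [_ HL]]].
    destruct (proj1 (ccont_C_eps _ _) (F1_cont F1 F2 Rad dF1 z Hz) e He) as [d' [Hd' HL']].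
    apply locally_CC. exists (Rmin d d'). split; [now apply Rmin_pos|]. intros u v Hu Hv.
    cbn [fst snd]. unfold dq. destruct (Ceq_dec z z) as [_|]; [|congruence].
    destruct (Ceq_dec u v) as [<-|Hne].
    + apply HL'. eapply Rlt_le_trans; [exact Hu|apply Rmin_r].
    + apply Csub_neq_0 in Hne.
      replace ((F u - F v) / (u - v) - F1 z)%C with ((F u - F v - F1 z * (u - v)) / (u - v))%C by (field; auto).
      rewrite Cmod_div by auto. apply Cmod_gt_0 in Hne.
      apply Rle_lt_trans with (e / 2); [|lra]. apply Rmult_le_reg_r with (Cmod (u - v)); auto.
      unfold Rdiv at 1. rewrite Rmult_assoc, Rinv_l, Rmult_1_r by lra.
      apply HL; (eapply Rlt_le_trans; [eassumption|apply Rmin_l]).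
  - apply ccont_ext_loc with (fun p => (F (fst p) - F (snd p)) / (fst p - snd p))%C.
    + apply filter_imp with (2 := locally_CC_neq z w H). intros [u v] Huv. cbn [fst snd] in *.
      unfold dq. destruct (Ceq_dec u v); congruence.
    + apply ccont_div.
      * apply ccont_minus; [apply ccont_CC_comp_fst|apply ccont_CC_comp_snd]; now apply (F_cont F F1 Rad dF).
      * apply ccont_minus; [apply ccont_CC_fst|apply ccont_CC_snd].
      * now apply Csub_neq_0.
Qed.

Lemma dq2_cont z w : Cmod z < Rad -> Cmod w < Rad ->
  ccont (X := CC) (fun p => dq2 F F1 F2 (fst p) (snd p)) (z, w).
Proof.
  intros Hz Hw. destruct (Ceq_dec z w) as [<-|H].
  - apply ccont_eps. intros e He.
    destruct (strict_diff2 F F1 F2 Rad dF dF1 cF2 z (e / 2) Hz ltac:(lra)) as [d [Hd HL]].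
    destruct (proj1 (ccont_C_eps _ _) (cF2 z Hz) e He) as [d' [Hd' HL']].
    apply locally_CC. exists (Rmin d d'). split; [now apply Rmin_pos|]. intros u v Hu Hv.
    cbn [fst snd]. unfold dq2. destruct (Ceq_dec z z) as [_|]; [|congruence].
    destruct (Ceq_dec u v) as [<-|Hne].
    + replace (F2 u / 2 - F2 z / 2)%C with ((F2 u - F2 z) / 2)%C by field.
      rewrite Cmod_div by (apply RtoC_neq; lra). rewrite Cmod_R, Rabs_pos_eq by lra.
      assert (Cmod (F2 u - F2 z) < e) by (apply HL'; eapply Rlt_le_trans; [exact Hu|apply Rmin_r]).
      pose proof (Cmod_ge_0 (F2 u - F2 z)). lra.
    + apply Csub_neq_0 in Hne.
      replace ((F1 u * (u - v) - (F u - F v)) / ((u - v) * (u - v)) - F2 z / 2)%C with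
       ((F1 u * (u - v) - (F u - F v) - F2 z / 2 * ((u - v) * (u - v))) / ((u - v) * (u - v)))%C by (field; auto).
      rewrite Cmod_div by now apply Cmult_neq_0. rewrite Cmod_mult. apply Cmod_gt_0 in Hne.
      assert (P : 0 < Cmod (u - v) * Cmod (u - v)) by now apply Rmult_lt_0_compat.
      apply Rle_lt_trans with (e / 2); [|lra]. apply Rmult_le_reg_r with (Cmod (u - v) * Cmod (u - v)); auto.
      unfold Rdiv at 1. rewrite Rmult_assoc, Rinv_l, Rmult_1_r by lra.
      apply HL; (eapply Rlt_le_trans; [eassumption|apply Rmin_l]).
  - apply ccont_ext_loc with (fun p => (F1 (fst p) * (fst p - snd p) - (F (fst p) - F (snd p))) / ((fst p - snd p) * (fst p - snd p)))%C.
    + apply filter_imp with (2 := locally_CC_neq z w H). intros [u v] Huv. cbn [fst snd] in *.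
      unfold dq2. destruct (Ceq_dec u v); congruence.
    + assert (D : ccont (X := CC) (fun p => fst p - snd p)%C (z, w)).
      { apply ccont_minus; [apply ccont_CC_fst|apply ccont_CC_snd]. }
      apply ccont_div.
      * apply ccont_minus.
        -- apply ccont_mult; auto. apply ccont_CC_comp_fst. now apply (F1_cont F1 F2 Rad dF1).
        -- apply ccont_minus; [apply ccont_CC_comp_fst|apply ccont_CC_comp_snd]; now apply (F_cont F F1 Rad dF).
      * now apply ccont_mult.
      * cbn [fst snd]. apply Cmult_neq_0; now apply Csub_neq_0.
Qed.

Lemma lq_cont z w : Cmod z < Rad -> Cmod w < Rad ->
  ccont (X := CC) (fun p => lq F F1 F2 (fst p) (snd p)) (z, w).
Proof.
  intros Hz Hw. apply ccont_div; [now apply dq2_cont|now apply dq_cont|now apply dq_neq_0].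
Qed.

Lemma ccont_CC_compose {X : UniformSpace} (G : C -> C -> C) (f g : X -> C) x :
  ccont (X := CC) (fun p => G (fst p) (snd p)) (f x, g x) -> ccont f x -> ccont g x ->
  ccont (fun y => G (f y) (g y)) x.
Proof. intros HG Hf Hg. exact (continuous_comp_2 f g G x Hf Hg HG). Qed.

Lemma dq_cder z w : Cmod z < Rad -> Cmod w < Rad -> cder (fun z => dq F F1 z w) z (dq2 F F1 F2 z w).
Proof.
  intros Hz Hw. destruct (Ceq_dec z w) as [<-|H].
  - intros e He.
    destruct (strict_diff2 F F1 F2 Rad dF dF1 cF2 z e Hz He) as [d [Hd HL]].
    exists d; split; auto. intros u Hu. unfold dq, dq2.
    destruct (Ceq_dec z z) as [_|]; [|congruence].
    destruct (Ceq_dec u z) as [->|Hne].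
    + replace (F1 z - F1 z - F2 z / 2 * (z - z))%C with (RtoC 0) by field.
      rewrite Cmod_0. apply Rmult_le_pos; [lra|apply Cmod_ge_0].
    + apply Csub_neq_0 in Hne.
      assert (Hzz : Cmod (z - z) < d).
      { replace (z - z)%C with (RtoC 0) by ring. now rewrite Cmod_0. }
      specialize (HL z u Hzz Hu).
      replace ((F u - F z) / (u - z) - F1 z - F2 z / 2 * (u - z))%C with
       ((F1 z * (z - u) - (F z - F u) - F2 z / 2 * ((z - u) * (z - u))) / (u - z))%C by (field; auto).
      rewrite Cmod_div by auto. rewrite (Cmod_sub_sym z u) in HL. apply Cmod_gt_0 in Hne.
      apply Rmult_le_reg_r with (Cmod (u - z)); auto.
      unfold Rdiv at 1. rewrite Rmult_assoc, Rinv_l, Rmult_1_r by lra. lra.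
  - apply cder_ext_loc with (fun z => (F z - F w) / (z - w))%C.
    { apply filter_imp with (2 := locally_not_eq w z H). intros u Hu. unfold dq.
      destruct (Ceq_dec u w); congruence. }
    unfold dq2. destruct (Ceq_dec z w) as [|_]; [congruence|].
    apply Csub_neq_0 in H.
    eapply cder_eq.
    + apply cder_div; [apply cder_minus; [apply dF; auto|apply cder_const]|apply cder_minus; [apply cder_id|apply cder_const]|auto].
    + cbv beta. field; auto.
Qed.

Lemma lq_off z w : z <> w -> lq F F1 F2 z w =
  (((F1 z * (z - w) - (F z - F w)) / ((z - w) * (z - w))) / ((F z - F w) / (z - w)))%C.
Proof.
  intros H. unfold lq, dq, dq2. destruct (Ceq_dec z w); congruence.
Qed.

Lemma slope_neq_0 z w : z <> w -> Cmod z < Rad -> Cmod w < Rad -> ((F z - F w) / (z - w))%C <> RtoC 0.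
Proof.
  intros H Hz Hw. pose proof (dq_neq_0 z w Hz Hw) as D. unfold dq in D.
  destruct (Ceq_dec z w); congruence.
Qed.

Lemma lq_c1at_l z w : z <> w -> Cmod z < Rad -> Cmod w < Rad -> c1at (fun z => lq F F1 F2 z w) z.
Proof.
  intros H Hz Hw.
  apply c1at_ext_loc with (fun z => ((F1 z * (z - w) - (F z - F w)) / ((z - w) * (z - w))) / ((F z - F w) / (z - w)))%C.
  { apply filter_imp with (2 := locally_not_eq w z H). intros u Hu. now rewrite lq_off. }
  assert (D : c1at (fun z => z - w)%C z) by (apply c1at_minus; [apply c1at_id|apply c1at_const]).
  assert (DF : c1at (fun z => F z - F w)%C z) by (apply c1at_minus; [now apply (F_c1at F F1 F2 Rad)|apply c1at_const]).
  pose proof (Csub_neq_0 _ _ H) as N.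
  apply c1at_div; [apply c1at_div| |].
  - apply c1at_minus; auto. apply c1at_mult; auto. now apply (F1_c1at F1 F2 Rad).
  - now apply c1at_mult.
  - now apply Cmult_neq_0.
  - now apply c1at_div.
  - now apply slope_neq_0.
Qed.

Lemma lq_c1at_r z w : z <> w -> Cmod z < Rad -> Cmod w < Rad -> c1at (fun w => lq F F1 F2 z w) w.
Proof.
  intros H Hz Hw.
  apply c1at_ext_loc with (fun w => ((F1 z * (z - w) - (F z - F w)) / ((z - w) * (z - w))) / ((F z - F w) / (z - w)))%C.
  { apply filter_imp with (2 := locally_not_eq z w (fun E => H (eq_sym E))). intros u Hu. rewrite lq_off; auto. }
  assert (D : c1at (fun w => z - w)%C w) by (apply c1at_minus; [apply c1at_const|apply c1at_id]).
  assert (DF : c1at (fun w => F z - F w)%C w) by (apply c1at_minus; [apply c1at_const|now apply (F_c1at F F1 F2 Rad)]).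
  pose proof (Csub_neq_0 _ _ H) as N.
  apply c1at_div; [apply c1at_div| |].
  - apply c1at_minus; auto. apply c1at_mult; auto. apply c1at_const.
  - now apply c1at_mult.
  - now apply Cmult_neq_0.
  - now apply c1at_div.
  - now apply slope_neq_0.
Qed.

(** At z = 0 the logarithmic derivative F'(z)/(F z - F w) - 1/(z - w) becomes the generating
    function of the b_k; this identity ties the energy to the expansion of 1/F. *)
Lemma lq_0 w : F (RtoC 0) = RtoC 0 -> F1 (RtoC 0) = RtoC 1 -> 0 < Cmod w < Rad ->
  lq F F1 F2 (RtoC 0) w = (/ w - / F w)%C.
Proof.
  intros HF0 HF1 Hw. assert (Hw0 : w <> RtoC 0) by (apply Cmod_gt_0; lra).
  assert (HFw : F w <> RtoC 0).
  { intros E. apply Hw0. apply injF; [lra|rewrite Cmod_0; lra|congruence]. }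
  rewrite lq_off by congruence. rewrite HF0, HF1. field.
  repeat split; auto.
Qed.
End DifferenceQuotient.

(** * Fourier coefficients of logarithmic kernels *)

Lemma ccontR_cis k : ccontR (fun t => cis (k * t)).
Proof. intros t. apply ccont_cis. apply continuous_Rmult; [apply continuous_const|apply continuous_id]. Qed.

Lemma ccontR_circle r : ccontR (fun t => RtoC r * cis t)%C.
Proof. intros t. apply ccont_mult; [apply ccont_const|]. apply ccont_cis, continuous_id. Qed.

Lemma ccontR_comp (h : C -> C) r : 0 <= r ->
  (forall z, Cmod z <= r -> ccont (X := C_UniformSpace) h z) -> ccontR (fun t => h (RtoC r * cis t)%C).
Proof.
  intros Hr H t. apply (ccont_comp (X := R_UniformSpace) (fun t => RtoC r * cis t)%C h).
  - apply ccontR_circle.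
  - apply H. rewrite Cmod_scal_cis; lra.
Qed.

Lemma Cconj_RtoC x : Cconj (RtoC x) = RtoC x.
Proof. unfold Cconj, RtoC; simpl. f_equal. ring. Qed.

Lemma circle_pow r k t : ((RtoC r * cis t) ^ k)%C = (RtoC (r ^ k) * cis (INR k * t))%C.
Proof. rewrite Cpow_mult_l, cis_pow, RtoC_pow. reflexivity. Qed.

(** Up to the factor r^k the integrand is z^k h(z), which vanishes at the centre because k >= 1. *)
Lemma circle_mean_pow (h : C -> C) r k : 0 < r -> (1 <= k)%nat ->
  (forall z, Cmod z <= r -> ccont (X := C_UniformSpace) h z) ->
  (forall z, 0 < Cmod z < r -> c1at h z) ->
  CI (fun t => cis (INR k * t) * h (RtoC r * cis t))%C = RtoC 0.
Proof.
  intros Hr Hk Hc Hd.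
  assert (Hrk : RtoC (r ^ k) <> RtoC 0) by (apply RtoC_neq, pow_nonzero; lra).
  pose proof (circle_mean (fun z => z ^ k * h z)%C r Hr) as M.
  assert (E : CI (fun t => RtoC (r ^ k) * (cis (INR k * t) * h (RtoC r * cis t)))%C = RtoC 0).
  { rewrite (CI_ext _ (fun t => (RtoC r * cis t) ^ k * h (RtoC r * cis t))%C) by (intros t; rewrite circle_pow; ring).
    rewrite M.
    - destruct k; [lia|]. simpl. ring.
    - intros z Hz. cts.
    - intros z Hz. c1. }
  rewrite CI_scal in E.
  - replace (CI (fun t : R => (cis (INR k * t) * h (r * cis t))%C)) with
      (/ RtoC (r ^ k) * (RtoC (r ^ k) * CI (fun t : R => (cis (INR k * t) * h (r * cis t))%C)))%C by (field; auto).
    rewrite E. ring.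
  - apply ccontR_mult; [apply ccontR_cis|]. apply ccontR_comp; auto. lra.
Qed.

Lemma CI_cis_nat k : (1 <= k)%nat -> CI (fun t => cis (INR k * t)) = RtoC 0.
Proof.
  intros Hk. rewrite (CI_ext _ (fun t => cis (INR k * t) * 1)%C) by (intros; ring).
  apply (circle_mean_pow (fun _ => RtoC 1) 1); auto; try lra; intros; [apply ccont_const|apply c1at_const].
Qed.

Lemma CI_cis_nat_opp k : (1 <= k)%nat -> CI (fun t => cis (- INR k * t)) = RtoC 0.
Proof.
  intros Hk. rewrite (CI_ext _ (fun t => Cconj (cis (INR k * t)))).
  - rewrite CI_conj by apply ccontR_cis. rewrite CI_cis_nat by auto. apply Cconj_RtoC.
  - intros t. rewrite <- cis_opp. f_equal. ring.
Qed.

Lemma CI_cis_IZR m : m <> 0%Z -> CI (fun t => cis (IZR m * t)) = RtoC 0.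
Proof.
  intros Hm. destruct m as [|p|p]; [congruence| |].
  - rewrite <- (CI_cis_nat (Pos.to_nat p)) by lia. apply CI_ext. intros t.
    rewrite INR_IZR_INZ, positive_nat_Z. reflexivity.
  - rewrite <- (CI_cis_nat_opp (Pos.to_nat p)) by lia. apply CI_ext. intros t.
    rewrite INR_IZR_INZ, positive_nat_Z. reflexivity.
Qed.

(* Index 0 stands for the antianalytic mode [e^(-it)], index [j >= 1] for [e^(ijt)]. *)
Definition mode (j : nat) : Z := match j with O => (-1)%Z | _ => Z.of_nat j end.
Definition emode (j : nat) (t : R) : C := cis (IZR (mode j) * t).

Lemma ccontR_emode j : ccontR (emode j).
Proof. apply ccontR_cis. Qed.

Lemma emode_0 t : emode 0 t = cis (- INR 1 * t).
Proof. unfold emode. simpl mode. f_equal. Qed.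

Lemma emode_pos j t : (1 <= j)%nat -> emode j t = cis (INR j * t).
Proof. intros H. unfold emode. destruct j; [lia|]. simpl mode. now rewrite INR_IZR_INZ. Qed.

Lemma Cconj_cis_mul k t : Cconj (cis (k * t)) = cis (- k * t).
Proof. rewrite <- cis_opp. f_equal. ring. Qed.

Lemma CI_emode_orth j l :
  CI (fun t => Cconj (emode l t) * emode j t)%C = if Nat.eq_dec j l then RtoC (2 * PI) else RtoC 0.
Proof.
  rewrite (CI_ext _ (fun t => cis (IZR (mode j - mode l) * t))).
  - destruct (Nat.eq_dec j l) as [->|H].
    + rewrite Z.sub_diag. rewrite (CI_ext _ (fun _ => RtoC 1)).
      * rewrite CI_const. ring.
      * intros t. now rewrite Rmult_0_l, cis_0.
    + apply CI_cis_IZR. unfold mode. destruct j, l; lia.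
  - intros t. unfold emode. rewrite Cconj_cis_mul, <- cis_plus. f_equal. rewrite minus_IZR. ring.
Qed.

Lemma CI_emode_0 j : CI (emode j) = RtoC 0.
Proof. apply CI_cis_IZR. unfold mode. destruct j; lia. Qed.

Lemma pder_ln_Cmod2 g t v : pder g t v -> g t <> RtoC 0 ->
  pder (fun u => RtoC (ln (Cmod (g u) ^ 2))) t (v / g t + Cconj (v / g t)).
Proof.
  intros Hg H0. pose proof (Re_Im_sq_pos _ H0) as P.
  pose proof (pder_Re _ _ _ Hg) as D1. pose proof (pder_Im _ _ _ Hg) as D2.
  eapply pder_eq.
  - apply pder_RtoC with (a := (2 * Re (g t) * Re v + 2 * Im (g t) * Im v) / (Re (g t) ^ 2 + Im (g t) ^ 2)).
    apply is_derive_ext with (fun u => ln (Re (g u) ^ 2 + Im (g u) ^ 2)).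
    { intros u. now rewrite Cmod2_alt. }
    set (a := fun u => Re (g u)) in *. set (b := fun u => Im (g u)) in *.
    change (is_derive (fun u => ln (a u ^ 2 + b u ^ 2)) t ((2 * a t * Re v + 2 * b t * Im v) / (a t ^ 2 + b t ^ 2))).
    change (0 < a t ^ 2 + b t ^ 2) in P.
    assert (E1 : Derive (fun x => a x) t = Re v) by exact (is_derive_unique _ _ _ D1).
    assert (E2 : Derive (fun x => b x) t = Im v) by exact (is_derive_unique _ _ _ D2).
    assert (X1 : ex_derive (fun x => a x) t) by (eexists; exact D1).
    assert (X2 : ex_derive (fun x => b x) t) by (eexists; exact D2).
    clearbody a b.
    auto_derive; [repeat split; auto; simpl in P; lra|].
    rewrite E1, E2. field. lra.
  - destruct (g t) as [a b], v as [c d]. unfold Re, Im in *. cbn [fst snd] in *.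
    unfold Cdiv, Cmult, Cinv, Cconj, Cplus, RtoC. cbn [fst snd]. f_equal; field; lra.
Qed.

(* Fourier coefficients of [ln |H|^2], by integration by parts: the derivative along the circle is
   twice the real part of [i z H'/H], and only its analytic half contributes. *)
Lemma log_fourier (H H1 : C -> C) r k : 0 < r -> (1 <= k)%nat ->
  (forall z, Cmod z <= r -> cder H z (H1 z)) ->
  (forall z, Cmod z <= r -> H z <> RtoC 0) ->
  (forall z, Cmod z <= r -> ccont (X := C_UniformSpace) H1 z) ->
  (forall z, 0 < Cmod z < r -> c1at (fun z => H1 z / H z)%C z) ->
  CI (fun t => cis (- INR k * t) * RtoC (ln (Cmod (H (RtoC r * cis t)) ^ 2)))%C =
  (/ INR k * CI (fun t => cis (- INR k * t) * ((RtoC r * cis t) * (H1 (RtoC r * cis t) / H (RtoC r * cis t)))))%C.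
Proof.
  intros Hr Hk HD HN HC Hq.
  assert (Hk0 : INR k <> 0) by (apply not_0_INR; lia).
  assert (HkC : RtoC (INR k) <> RtoC 0) by now apply RtoC_neq.
  set (q := fun z => (H1 z / H z)%C).
  assert (Hin : forall t, Cmod (RtoC r * cis t) <= r) by (intros; rewrite Cmod_scal_cis; lra).
  assert (Cq : forall z, Cmod z <= r -> ccont (X := C_UniformSpace) q z).
  { intros z Hz. apply ccont_div; auto. eapply cder_ccont; now apply HD. }
  set (X := fun t : R => (Ci * ((RtoC r * cis t) * q (RtoC r * cis t)))%C).
  assert (CX : ccontR X).
  { apply ccontR_mult; [apply ccontR_const|]. apply ccontR_mult; [apply ccontR_circle|].
    apply ccontR_comp; auto; lra. }
  assert (PU : forall t, pder (fun t => RtoC (ln (Cmod (H (RtoC r * cis t)%C) ^ 2))) t (X t + Cconj (X t))).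
  { intros t.
    assert (PH : pder (fun t => H (RtoC r * cis t)%C) t (H1 (RtoC r * cis t) * (Ci * (RtoC r * cis t)))%C).
    { apply pder_comp; [|now apply HD]. eapply pder_eq.
      - apply pder_mult; [apply pder_const|].
        apply (pder_ext (fun u => cis (1 * u))); [intros; now rewrite Rmult_1_l|]. apply pder_cis.
      - rewrite Rmult_1_l. cbv beta. ring. }
    eapply pder_eq; [apply pder_ln_Cmod2; [exact PH|now apply HN]|].
    assert (EX : X t = (H1 (RtoC r * cis t) * (Ci * (RtoC r * cis t)) / H (RtoC r * cis t))%C).
    { unfold X, q. field. now apply HN. }
    now rewrite EX. }
  (* The primitive (i/k) e^(-ikt) of e^(-ikt) has period 2 pi, so integration by parts leaves no
     boundary term. *)
  assert (PE : forall t, pder (fun t => Ci / INR k * cis (- INR k * t))%C t (cis (- INR k * t))).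
  { intros t. eapply pder_eq; [apply pder_mult; [apply pder_const|apply pder_cis]|].
    cbv beta. rewrite RtoC_opp. replace (0 * cis (- INR k * t) + Ci / INR k * (Ci * - INR k * cis (- INR k * t)))%C with
      (- (Ci * Ci) * cis (- INR k * t))%C by (field; auto).
    replace (Ci * Ci)%C with (- RtoC 1)%C; [ring|].
    unfold Ci, Cmult, Copp, RtoC; simpl. f_equal; ring. }
  rewrite (CI_by_parts _ _ _ _ PE PU).
  - rewrite (CI_ext _ (fun t => (- / INR k) * (cis (- INR k * t) * ((RtoC r * cis t) * q (RtoC r * cis t))) +
       (Ci / INR k * (- Ci)) * Cconj (cis (INR k * t) * ((RtoC r * cis t) * q (RtoC r * cis t))))%C).
    + assert (C1 : forall c, ccontR (fun t => cis (c * t) * ((RtoC r * cis t) * q (RtoC r * cis t)))%C).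
      { intros c. apply ccontR_mult; [apply ccontR_cis|]. apply ccontR_mult; [apply ccontR_circle|].
        apply ccontR_comp; auto; lra. }
      rewrite CI_plus.
      * rewrite CI_scal by apply C1. rewrite CI_scal by apply ccontR_conj, C1.
        rewrite CI_conj by apply C1.
        rewrite (circle_mean_pow (fun z => z * q z)%C r k); auto.
        -- rewrite Cconj_RtoC. unfold q. cbv beta. ring.
        -- intros z Hz. cts.
        -- intros z Hz. c1.
      * apply ccontR_mult; [apply ccontR_const|apply C1].
      * apply ccontR_mult; [apply ccontR_const|apply ccontR_conj, C1].
    + intros t. unfold X.
      replace (Cconj (cis (INR k * t) * (r * cis t * q (r * cis t)%C)))%C with
        (cis (- INR k * t) * Cconj (r * cis t * q (r * cis t)%C))%C
        by (rewrite (Cmult_conj (cis _)), Cconj_cis_mul; reflexivity).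
      rewrite (Cmult_conj Ci).
      replace (Cconj Ci) with (- Ci)%C by (unfold Ci, Cconj, Copp; simpl; f_equal; ring).
      set (Y := (r * cis t * q (r * cis t)%C)%C).
      replace (- / INR k)%C with (Ci / INR k * Ci)%C; [field; auto|].
      replace (Ci / INR k * Ci)%C with ((Ci * Ci) / INR k)%C by (field; auto).
      replace (Ci * Ci)%C with (- RtoC 1)%C; [field; auto|].
      unfold Ci, Cmult, Copp, RtoC; simpl. f_equal; ring.
  - intros t. apply ccontR_cis.
  - intros t. cts.
  - rewrite <- (Rplus_0_l (2 * PI)) at 2. rewrite cis_2PI.
    replace (cis (- INR k * (2 * PI))) with (cis (- INR k * 0)); [reflexivity|].
    rewrite <- !Cconj_cis_mul, <- !cis_pow. f_equal. f_equal.
    rewrite <- (Rplus_0_l (2 * PI)). now rewrite cis_2PI.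
Qed.

(** Regularized form of ln |z - w|^2 on the circle: up to an additive constant it is ln (|z - w|^2 +
    e), with e a function of rho and the radius. *)
Definition lam_kernel (rho : R) (p : R * R) : R := ln (Cmod (RtoC 1 - RtoC rho * cis (fst p - snd p)) ^ 2).

Lemma one_minus_neq_0 (w : C) : Cmod w < 1 -> (RtoC 1 - w)%C <> RtoC 0.
Proof.
  intros H E. replace w with (RtoC 1 - (RtoC 1 - w))%C in H by ring. rewrite E in H.
  replace (RtoC 1 - RtoC 0)%C with (RtoC 1) in H by ring. rewrite Cmod_1 in H. lra.
Qed.

Lemma Cmod_rho_cis rho u : 0 < rho < 1 -> Cmod (RtoC rho * cis u) < 1.
Proof. intros H. rewrite Cmod_scal_cis; lra. Qed.

Lemma cont2_lam_kernel rho : 0 < rho < 1 -> cont2 (lam_kernel rho).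
Proof.
  intros H p. apply continuous_ln_comp.
  - cts.
  - apply pow_lt, Cmod_gt_0, one_minus_neq_0. now apply Cmod_rho_cis.
Qed.

(** With x = a e^(it), the identity x/(1 - x) = x (1 + x/(1 - x)) lowers k by one and extracts a
    factor a; for k = 1 the integrand is a/(1 - x), with mean a. *)
Lemma geometric_fourier (a : C) k : Cmod a < 1 -> (1 <= k)%nat ->
  CI (fun t => cis (- INR k * t) * (a * cis t / (RtoC 1 - a * cis t)))%C = (RtoC (2 * PI) * a ^ k)%C.
Proof.
  intros Ha Hk.
  assert (HN : forall z, Cmod z <= 1 -> (RtoC 1 - a * z)%C <> RtoC 0).
  { intros z Hz. apply one_minus_neq_0. rewrite Cmod_mult. pose proof (Cmod_ge_0 a). pose proof (Cmod_ge_0 z). nra. }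
  assert (HNt : forall t, (RtoC 1 - a * cis t)%C <> RtoC 0).
  { intros t. apply HN. rewrite Cmod_cis. lra. }
  assert (C0 : ccontR cis) by (intros t; apply ccont_cis, continuous_id).
  assert (C1 : ccontR (fun t => RtoC 1 - a * cis t)%C).
  { intros t. cts. }
  induction k as [|k IH]; [lia|]. destruct (Nat.eq_dec k 0) as [->|Hk0].
  - rewrite (CI_ext _ (fun t => a / (RtoC 1 - a * (RtoC 1 * cis t)))%C).
    + rewrite (circle_mean (fun z => a / (RtoC 1 - a * z))%C 1); try lra.
      * simpl. field.
      * intros z Hz. cts.
      * intros z Hz. apply c1at_div; [apply c1at_const| |apply HN; lra].
        apply c1at_minus; [apply c1at_const|]. apply c1at_mult; [apply c1at_const|apply c1at_id].
    + intros t. replace (cis (- INR 1 * t)) with (/ cis t)%C.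
      * rewrite Cmult_1_l. field. split; auto using cis_neq_0.
      * assert (E : (cis (- INR 1 * t) * cis t)%C = RtoC 1).
        { rewrite <- cis_plus. replace (- INR 1 * t + t) with 0 by (simpl; ring). apply cis_0. }
        replace (cis (- INR 1 * t)) with (cis (- INR 1 * t) * cis t * / cis t)%C by (field; apply cis_neq_0).
        rewrite E. ring.
  - rewrite (CI_ext _ (fun t => a * (cis (- INR k * t) + cis (- INR k * t) * (a * cis t / (RtoC 1 - a * cis t))))%C).
    + assert (C2 : ccontR (fun t => cis (- INR k * t) * (a * cis t / (RtoC 1 - a * cis t)))%C).
      { apply ccontR_mult; [apply ccontR_cis|]. intros t. apply ccont_div; [|apply C1|auto].
        apply ccont_mult; [apply ccont_const|apply C0]. }
      rewrite CI_scal.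
      * rewrite CI_plus by (auto; apply ccontR_cis). rewrite IH by lia.
        rewrite CI_cis_nat_opp by lia. simpl Cpow. ring.
      * intros t. cts.
    + intros t. rewrite S_INR.
      replace (- (INR k + 1) * t) with (- INR k * t + - t) by ring. rewrite cis_plus.
      assert (E : (cis (- t) * cis t)%C = RtoC 1).
      { rewrite <- cis_plus. replace (- t + t) with 0 by ring. apply cis_0. }
      replace (cis (- INR k * t) * cis (- t) * (a * cis t / (1 - a * cis t)))%C with
         (cis (- INR k * t) * a * (cis (- t) * cis t) / (1 - a * cis t))%C by (field; auto).
      rewrite E. field. auto.
Qed.

(** This is [log_fourier] on the unit circle for H(z) = 1 - a z, the phase of s being part of a. *)
Lemma lam_fourier rho k s : 0 < rho < 1 -> (1 <= k)%nat ->
  CI (fun t => cis (- INR k * t) * RtoC (lam_kernel rho (t, s)))%C =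
  (RtoC (- (2 * PI * rho ^ k / INR k)) * cis (- INR k * s))%C.
Proof.
  intros Hrho Hk. set (a := (RtoC rho * cis (- s))%C).
  assert (Hk0 : INR k <> 0) by (apply not_0_INR; lia).
  assert (Ha : Cmod a < 1) by now apply Cmod_rho_cis.
  assert (HN : forall z, Cmod z <= 1 -> (RtoC 1 - a * z)%C <> RtoC 0).
  { intros z Hz. apply one_minus_neq_0. rewrite Cmod_mult. pose proof (Cmod_ge_0 a). pose proof (Cmod_ge_0 z). nra. }
  assert (HNt : forall t, (RtoC 1 - a * cis t)%C <> RtoC 0).
  { intros t. apply HN. rewrite Cmod_cis. lra. }
  pose proof (log_fourier (fun z => RtoC 1 - a * z)%C (fun _ => - a)%C 1 k Rlt_0_1 Hk) as L.
  rewrite (CI_ext _ (fun t => cis (- INR k * t) * RtoC (ln (Cmod (RtoC 1 - a * (RtoC 1 * cis t)) ^ 2)))%C).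
  - rewrite L; auto.
    + rewrite (CI_ext _ (fun t => - (cis (- INR k * t) * (a * cis t / (RtoC 1 - a * cis t))))%C).
      * rewrite CI_opp.
        -- rewrite geometric_fourier by auto. unfold a. rewrite Cpow_mult_l, cis_pow.
           replace (INR k * - s) with (- INR k * s) by ring.
           unfold Rdiv. rewrite RtoC_opp, !RtoC_mult, RtoC_inv, RtoC_pow by auto. ring.
        -- apply ccontR_mult; [apply ccontR_cis|]. intros t.
           assert (C0 : ccontR cis) by (intros u; apply ccont_cis, continuous_id).
           apply ccont_div; auto.
           ++ cts.
           ++ cts.
      * intros t. rewrite !Cmult_1_l. field. auto.
    + intros z Hz. eapply cder_eq; [apply cder_minus; [apply cder_const|apply cder_mult; [apply cder_const|apply cder_id]]|].
      cbv beta. ring.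
    + intros; apply ccont_const.
    + intros z Hz. apply c1at_div; [apply c1at_const| |apply HN; lra].
      apply c1at_minus; [apply c1at_const|]. apply c1at_mult; [apply c1at_const|apply c1at_id].
  - intros t. unfold lam_kernel. cbn [fst snd]. unfold Rminus. rewrite cis_plus.
    unfold a. do 5 f_equal. ring.
Qed.

(** * Finite sums, forms on combinations of modes, and the Poisson weight *)

Fixpoint csum (f : nat -> C) (n : nat) : C :=
  match n with O => RtoC 0 | S n => (csum f n + f n)%C end.
Fixpoint rsum (f : nat -> R) (n : nat) : R :=
  match n with O => 0 | S n => rsum f n + f n end.

Lemma csum_ext f g n : (forall j, (j < n)%nat -> f j = g j) -> csum f n = csum g n.
Proof. induction n; intros H; simpl; auto. rewrite IHn, H; auto. Qed.
Lemma rsum_le f g n : (forall j, (j < n)%nat -> f j <= g j) -> rsum f n <= rsum g n.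
Proof.
  induction n; intros H; simpl; [lra|]. apply Rplus_le_compat; [apply IHn; auto|apply H; auto].
Qed.
Lemma csum_0 f n : (forall j, (j < n)%nat -> f j = RtoC 0) -> csum f n = RtoC 0.
Proof. induction n; intros H; simpl; auto. rewrite IHn, H; auto. ring. Qed.
Lemma csum_S_left f n : csum f (S n) = (f 0%nat + csum (fun j => f (S j)) n)%C.
Proof. induction n; simpl in *; [ring|]. rewrite IHn. ring. Qed.
Lemma rsum_S_left f n : rsum f (S n) = f 0%nat + rsum (fun j => f (S j)) n.
Proof. induction n; simpl in *; [ring|]. rewrite IHn. ring. Qed.
Lemma csum_scal c f n : csum (fun j => c * f j)%C n = (c * csum f n)%C.
Proof. induction n; simpl; [ring|]. rewrite IHn. ring. Qed.
Lemma rsum_scal c f n : rsum (fun j => c * f j) n = c * rsum f n.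
Proof. induction n; simpl; [ring|]. rewrite IHn. ring. Qed.
Lemma csum_plus f g n : csum (fun j => f j + g j)%C n = (csum f n + csum g n)%C.
Proof. induction n; simpl; [ring|]. rewrite IHn. ring. Qed.
Lemma csum_delta j f n : csum (fun l => if Nat.eq_dec j l then f l else RtoC 0) n =
  if lt_dec j n then f j else RtoC 0.
Proof.
  induction n as [|n IH]; simpl.
  - destruct (lt_dec j 0); [lia|auto].
  - rewrite IH. destruct (lt_dec j n), (Nat.eq_dec j n), (lt_dec j (S n)); subst; try lia; try ring.
Qed.
Lemma csum_Re f n : Re (csum f n) = rsum (fun j => Re (f j)) n.
Proof. induction n; [reflexivity|]. cbn [csum rsum]. now rewrite re_plus, IHn. Qed.

Lemma ccontR_csum (f : nat -> R -> C) n : (forall j, ccontR (f j)) -> ccontR (fun t => csum (fun j => f j t) n).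
Proof.
  intros H. induction n; intros t; simpl; [apply ccont_const|]. apply ccont_plus; [apply IHn|apply H].
Qed.

Lemma CI_csum (f : nat -> R -> C) n : (forall j, ccontR (f j)) ->
  CI (fun t => csum (fun j => f j t) n) = csum (fun j => CI (f j)) n.
Proof.
  intros H. induction n; simpl.
  - now apply CI_0.
  - rewrite CI_plus, IHn; auto. now apply ccontR_csum.
Qed.

Lemma form_0_l K y : form K (fun _ => RtoC 0) y = RtoC 0.
Proof. apply CI_0. intros s. rewrite CI_0; [ring|]. intros; ring. Qed.
Lemma form_0_r K x : form K x (fun _ => RtoC 0) = RtoC 0.
Proof. apply CI_0. intros s. rewrite Cconj_RtoC. ring. Qed.

Lemma form_csum_l K (a : nat -> C) (f : nat -> R -> C) y n : ccont2 K -> (forall j, ccontR (f j)) -> ccontR y ->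
  form K (fun t => csum (fun j => a j * f j t)%C n) y = csum (fun j => a j * form K (f j) y)%C n.
Proof.
  intros HK Hf Hy. assert (Hc : forall j, ccontR (fun t => a j * f j t)%C).
  { intros j. apply ccontR_mult; auto. apply ccontR_const. }
  induction n; simpl.
  - apply form_0_l.
  - rewrite (form_plus_l K (fun t => csum (fun j => a j * f j t)%C n)); auto.
    + now rewrite IHn, form_scal_l.
    + now apply (ccontR_csum (fun j t => a j * f j t)%C).
Qed.

Lemma form_csum_r K (a : nat -> C) (f : nat -> R -> C) x n : ccont2 K -> (forall j, ccontR (f j)) -> ccontR x ->
  form K x (fun t => csum (fun j => a j * f j t)%C n) = csum (fun j => Cconj (a j) * form K x (f j))%C n.
Proof.
  intros HK Hf Hy. assert (Hc : forall j, ccontR (fun t => a j * f j t)%C).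
  { intros j. apply ccontR_mult; auto. apply ccontR_const. }
  induction n; simpl.
  - apply form_0_r.
  - rewrite (form_plus_r K x (fun t => csum (fun j => a j * f j t)%C n)); auto.
    + now rewrite IHn, form_scal_r.
    + now apply (ccontR_csum (fun j t => a j * f j t)%C).
Qed.

(** Hermitian symmetry for a real symmetric kernel, by exchanging the integrations. *)
Lemma form_conj_sym (k : R * R -> R) x y : cont2 k -> (forall t s, k (t, s) = k (s, t)) ->
  ccontR x -> ccontR y ->
  form (fun p => RtoC (k p)) y x = Cconj (form (fun p => RtoC (k p)) x y).
Proof.
  intros Hk Hs Hx Hy.
  assert (HK : ccont2 (fun p => RtoC (k p))) by (intros p; apply ccont_RtoC, Hk).
  unfold form.
  rewrite <- (CI_conj (fun s => Cconj (y s) * CI (fun t => x t * RtoC (k (t, s))))%C)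
    by exact (ccontR_form (fun p => RtoC (k p)) x y HK Hx Hy).
  rewrite (CI_ext (fun s => Cconj (Cconj (y s) * CI (fun t => x t * RtoC (k (t, s)))))%C
     (fun s => CI (fun t => (y s * Cconj (x t)) * RtoC (k (t, s))))%C).
  - pose proof (CI_Fubini (fun p => (y (fst p) * Cconj (x (snd p))) * RtoC (k (snd p, fst p)))%C) as FB.
    cbn [fst snd] in FB. rewrite FB.
    + apply CI_ext. intros s. rewrite <- CI_scal.
      * apply CI_ext. intros t. rewrite (Hs t s). ring.
      * exact (ccontR_slice_mult (fun p => RtoC (k p)) y s HK Hy).
    + apply ccont2_mult; [apply ccont2_mult|].
      * now apply ccont2_fst.
      * apply (ccont2_snd (fun t => Cconj (x t))). now apply ccontR_conj.
      * now apply (ccont2_swap (fun p => RtoC (k p))).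
  - intros s. rewrite Cmult_conj, Cconj_conj.
    pose proof (ccontR_slice_mult (fun p => RtoC (k p)) x s HK Hx) as Cx.
    rewrite <- (CI_conj (fun t => x t * RtoC (k (t, s)))%C) by exact Cx.
    rewrite <- CI_scal.
    + apply CI_ext. intros t. rewrite Cmult_conj, Cconj_RtoC. ring.
    + now apply ccontR_conj.
Qed.

(** The point (t, s) is reached from the origin in N equal steps below the radius of uniform
    continuity for 1, and each step changes f by less than 1. *)
Lemma cont2_bounded (f : R * R -> R) L : 0 <= L -> cont2 f -> exists M, forall t s, 0 <= t <= L -> 0 <= s <= L -> f (t, s) <= M.
Proof.
  intros HL Hf.
  destruct (uniform_continuity_2d (fun u v => f (u, v)) 0 L 0 L (fun x y _ _ => continuous_2d f x y (Hf (x, y))) (mkposreal 1 Rlt_0_1)) as [d Hd].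
  simpl in Hd. pose proof (cond_pos d) as Hd0.
  destruct (archimed (L / d)) as [A _].
  assert (A0 : 0 <= L / d) by (apply Rdiv_le_0_compat; lra).
  assert (Hz : (0 <= up (L / d))%Z) by (apply le_IZR; simpl; lra).
  set (N := Z.to_nat (up (L / d))).
  assert (HN : INR N = IZR (up (L / d))) by (unfold N; rewrite INR_IZR_INZ, Z2Nat.id; auto).
  assert (HNp : 0 < INR N) by lra.
  assert (HNd : L / INR N < d).
  { rewrite <- HN in A. apply Rmult_lt_reg_r with (INR N); auto. unfold Rdiv. rewrite Rmult_assoc, Rinv_l, Rmult_1_r by lra.
    apply Rmult_lt_compat_r with (r := d) in A; auto. unfold Rdiv in A. rewrite Rmult_assoc, Rinv_l, Rmult_1_r in A by lra. lra. }
  exists (f (0, 0) + INR N). intros t s Ht Hs.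
  assert (Hb : forall u k, 0 <= u <= L -> (k <= N)%nat -> 0 <= INR k / INR N * u <= L).
  { intros u k Hu Hk. apply le_INR in Hk. pose proof (pos_INR k).
    assert (0 <= INR k / INR N <= 1).
    { split; [apply Rdiv_le_0_compat; lra|]. apply Rmult_le_reg_r with (INR N); auto.
      unfold Rdiv. rewrite Rmult_assoc, Rinv_l; lra. }
    nra. }
  assert (I : forall k, (k <= N)%nat -> f (INR k / INR N * t, INR k / INR N * s) <= f (0, 0) + INR k).
  { induction k as [|k IH]; intros Hk.
    - simpl. unfold Rdiv. rewrite !Rmult_0_l. lra.
    - assert (St : forall u, 0 <= u <= L -> Rabs (INR (S k) / INR N * u - INR k / INR N * u) < d).
      { intros u Hu. rewrite S_INR. replace ((INR k + 1) / INR N * u - INR k / INR N * u) with (u / INR N) by (field; lra).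
        rewrite Rabs_pos_eq by (apply Rdiv_le_0_compat; lra).
        apply Rle_lt_trans with (L / INR N); auto. unfold Rdiv. apply Rmult_le_compat_r; [left; now apply Rinv_0_lt_compat|lra]. }
      specialize (Hd (INR k / INR N * t) (INR k / INR N * s) (INR (S k) / INR N * t) (INR (S k) / INR N * s)).
      assert (D := Hd ltac:(apply Hb; auto; lia) ltac:(apply Hb; auto; lia) ltac:(apply Hb; auto) ltac:(apply Hb; auto) (St t Ht) (St s Hs)).
      apply Rabs_lt_between in D. specialize (IH ltac:(lia)). rewrite S_INR in *. lra. }
  specialize (I N (le_n N)). unfold Rdiv in I. rewrite Rinv_r, !Rmult_1_l in I by lra. exact I.
Qed.

(** The Poisson kernel times (1 - rho)/(1 + rho). It equals 1 on the diagonal and will turn out to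
    be e/(|z - w|^2 + e). *)
Definition poisson_weight (rho : R) (p : R * R) : R :=
  (1 - rho) ^ 2 / Cmod (RtoC 1 - RtoC rho * cis (fst p - snd p)) ^ 2.

Lemma Cmod_one_minus rho u : Cmod (RtoC 1 - RtoC rho * cis u) ^ 2 = 1 + rho ^ 2 - 2 * rho * cos u.
Proof.
  rewrite Cmod2_alt. unfold cis, Cminus, Cplus, Copp, Cmult, RtoC, Re, Im. cbn [fst snd].
  pose proof (sin2_cos2 u) as H. unfold Rsqr in H.
  replace ((1 + - (rho * cos u - 0 * sin u)) ^ 2 + (0 + - (rho * sin u + 0 * cos u)) ^ 2) with
    (1 - 2 * rho * cos u + rho ^ 2 * (sin u * sin u + cos u * cos u)) by ring.
  rewrite H. ring.
Qed.

Lemma Cmod_one_minus_pos rho u : 0 < rho < 1 -> 0 < Cmod (RtoC 1 - RtoC rho * cis u) ^ 2.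
Proof. intros H. apply pow_lt, Cmod_gt_0, one_minus_neq_0. now apply Cmod_rho_cis. Qed.

Lemma cont2_poisson rho : 0 < rho < 1 -> cont2 (poisson_weight rho).
Proof.
  intros H p. apply continuous_Rmult; [apply continuous_const|]. apply continuous_Rinv_comp.
  - cts.
  - apply Rgt_not_eq. now apply Cmod_one_minus_pos.
Qed.

(** Up to the factor (1 - rho)/(1 + rho) the weight is the real part of (1 + a z)/(1 - a z) on the
    unit circle, and this function has value 1 at the centre. *)
Lemma RI_poisson rho s : 0 < rho < 1 ->
  RI (fun t => poisson_weight rho (t, s)) = 2 * PI * ((1 - rho) / (1 + rho)).
Proof.
  intros H. set (a := (RtoC rho * cis (- s))%C).
  assert (Ha : Cmod a < 1) by now apply Cmod_rho_cis.
  assert (HN : forall z, Cmod z <= 1 -> (RtoC 1 - a * z)%C <> RtoC 0).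
  { intros z Hz. apply one_minus_neq_0. rewrite Cmod_mult. pose proof (Cmod_ge_0 a). pose proof (Cmod_ge_0 z). nra. }
  pose proof (circle_mean (fun z => (RtoC 1 + a * z) / (RtoC 1 - a * z))%C 1 Rlt_0_1) as M.
  assert (E : CI (fun t => (RtoC 1 + a * (RtoC 1 * cis t)) / (RtoC 1 - a * (RtoC 1 * cis t)))%C = RtoC (2 * PI)).
  { rewrite M.
    - field.
    - intros z Hz. cts.
    - intros z Hz. apply c1at_div; [| |apply HN; lra].
      + c1.
      + c1. }
  apply (f_equal Re) in E. unfold CI in E. cbn [Re fst RtoC] in E.
  assert (Cp : forall t, continuous (fun t => poisson_weight rho (t, s)) t) by (apply (continuous_slice_r (poisson_weight rho)); now apply cont2_poisson).
  rewrite (RI_ext _ (fun t => (1 + rho) / (1 - rho) * poisson_weight rho (t, s))) in E.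
  - rewrite RI_scal in E by auto.
    replace (RI (fun t => poisson_weight rho (t, s))) with ((1 - rho) / (1 + rho) * ((1 + rho) / (1 - rho) * RI (fun t => poisson_weight rho (t, s)))) by (field; lra).
    rewrite E. ring.
  - intros t. rewrite Cmult_1_l. unfold a.
    replace (rho * cis (- s) * cis t)%C with (rho * cis (t - s))%C
      by (unfold Rminus; rewrite cis_plus; ring).
    unfold poisson_weight. cbn [fst snd].
    pose proof (Cmod_one_minus_pos rho (t - s) H) as P.
    rewrite Cmod2_alt in P |- *.
    assert (SC : sin (t - s) * sin (t - s) = 1 - cos (t - s) * cos (t - s)).
    { pose proof (sin2_cos2 (t - s)) as Q. unfold Rsqr in Q. lra. }
    unfold cis, Cdiv, Cinv, Cminus, Cplus, Copp, Cmult, RtoC, Re, Im in *. cbn [fst snd] in *.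
    set (c := cos (t - s)) in *. set (n := sin (t - s)) in *.
    assert (P' : 0 < (1 - rho * c) ^ 2 + (rho * n) ^ 2).
    { replace ((1 - rho * c) ^ 2 + (rho * n) ^ 2) with ((1 + - (rho * c - 0 * n)) ^ 2 + (0 + - (rho * n + 0 * c)) ^ 2) by ring. exact P. }
    replace ((1 + - (rho * c - 0 * n)) ^ 2 + (0 + - (rho * n + 0 * c)) ^ 2) with ((1 - rho * c) ^ 2 + (rho * n) ^ 2) by ring.
    set (D := (1 - rho * c) ^ 2 + (rho * n) ^ 2) in *.
    replace ((1 + (rho * c - 0 * n)) * ((1 + - (rho * c - 0 * n)) / D) - (0 + (rho * n + 0 * c)) * (- (0 + - (rho * n + 0 * c)) / D))
     with ((1 - rho ^ 2 * c * c - rho ^ 2 * (n * n)) / D) by (field; lra).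
    rewrite SC. field. lra.
Qed.

(** * The area inequality *)

(** Both signs follow from ln x <= x - 1, applied to (q a + e)/(q (a + e)) and to its inverse; each
    of these differs from 1 by a bounded multiple of e/(a + e). *)
Lemma log_ratio_bound (a e q m M : R) : 0 <= a -> 0 < e -> 0 < m -> m <= q <= M ->
  Rabs (ln (q * a + e) - ln q - ln (a + e)) <= (/ m + 1 + (M + 1) / Rmin m 1) * (e / (a + e)).
Proof.
  intros Ha He Hm Hq.
  assert (Hln : forall x, 0 < x -> ln x <= x - 1).
  { intros x Hx. pose proof (exp_ineq1_le (ln x)) as L. rewrite exp_ln in L by auto. lra. }
  assert (Hqa : 0 < q * a + e) by (assert (0 <= q * a) by (apply Rmult_le_pos; lra); lra).
  set (mm := Rmin m 1). assert (Hmm : 0 < mm) by (apply Rmin_pos; lra).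
  assert (Hmm1 : mm <= m) by apply Rmin_l. assert (Hmm2 : mm <= 1) by apply Rmin_r.
  assert (Hea : 0 < e / (a + e)) by (apply Rdiv_lt_0_compat; lra).
  assert (Hm' : 0 < / m) by now apply Rinv_0_lt_compat.
  assert (HMm : 0 < (M + 1) / mm) by (apply Rdiv_lt_0_compat; lra).
  assert (E1 : ln (q * a + e) - ln q - ln (a + e) = ln ((q * a + e) / (q * (a + e)))).
  { rewrite ln_div by (auto; apply Rmult_lt_0_compat; lra). rewrite ln_mult by lra. ring. }
  assert (E2 : - ln ((q * a + e) / (q * (a + e))) = ln ((q * (a + e)) / (q * a + e))).
  { rewrite !ln_div by (auto; apply Rmult_lt_0_compat; lra). ring. }
  assert (U : ln ((q * a + e) / (q * (a + e))) <= (/ m + 1) * (e / (a + e))).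
  { eapply Rle_trans; [apply Hln; apply Rdiv_lt_0_compat; auto; apply Rmult_lt_0_compat; lra|].
    replace ((q * a + e) / (q * (a + e)) - 1) with ((/ q - 1) * (e / (a + e))) by (field; lra).
    apply Rmult_le_compat_r; [lra|]. assert (/ q <= / m) by (apply Rinv_le_contravar; lra). lra. }
  assert (L : - ln ((q * a + e) / (q * (a + e))) <= (M + 1) / mm * (e / (a + e))).
  { rewrite E2. eapply Rle_trans; [apply Hln; apply Rdiv_lt_0_compat; auto; apply Rmult_lt_0_compat; lra|].
    replace (q * (a + e) / (q * a + e) - 1) with ((q - 1) * e * / (q * a + e)) by (field; lra).
    apply Rle_trans with ((M + 1) * e * / (mm * (a + e))).
    - apply Rle_trans with ((M + 1) * e * / (q * a + e)).
      + apply Rmult_le_compat_r; [left; now apply Rinv_0_lt_compat|]. nra.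
      + apply Rmult_le_compat_l; [nra|]. apply Rinv_le_contravar; [apply Rmult_lt_0_compat; lra|]. nra.
    - right. field. lra. }
  rewrite E1. apply Rabs_le. fold mm. split; nra.
Qed.

(** The passage rho -> 1, made explicit with rho = 1 - d for a small d. *)
Lemma nonpos_of_vanishing_bound (S c : R) : 0 <= c ->
  (forall rho, 0 < rho < 1 -> S <= c * ((1 - rho) / (1 + rho))) -> S <= 0.
Proof.
  intros Hc H. destruct (Rle_or_lt S 0) as [|HS]; auto. exfalso.
  set (d := Rmin (1 / 2) (S / (2 * (c + 1)))).
  assert (Hd1 : d <= 1 / 2) by apply Rmin_l.
  assert (Hd2 : d <= S / (2 * (c + 1))) by apply Rmin_r.
  assert (Hd : 0 < d). { apply Rmin_pos; [lra|]. apply Rdiv_lt_0_compat; lra. }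
  specialize (H (1 - d) ltac:(lra)).
  replace (1 - (1 - d)) with d in H by ring.
  assert (d / (1 + (1 - d)) <= d).
  { apply Rmult_le_reg_r with (1 + (1 - d)); [lra|]. unfold Rdiv. rewrite Rmult_assoc, Rinv_l by lra. nra. }
  assert (d * (2 * (c + 1)) <= S).
  { apply Rmult_le_compat_r with (r := 2 * (c + 1)) in Hd2; [|lra].
    unfold Rdiv in Hd2. rewrite Rmult_assoc, Rinv_l in Hd2; lra. }
  nra.
Qed.

Lemma continuous_bounded (f : R -> R) L : 0 <= L -> (forall t, continuous f t) ->
  exists M, forall t, 0 <= t <= L -> f t <= M.
Proof.
  intros HL H. destruct (continuity_ab_maj f 0 L HL) as [t0 [Ht _]].
  - intros t _. apply continuity_pt_filterlim, H.
  - exists (f t0). auto.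
Qed.

(** The kernel depends on t - s only, so the modes are eigenfunctions. [Nat.max j 1] is the absolute
    frequency, since index 0 stands for e^(-it). *)
Lemma lam_emode rho j s : 0 < rho < 1 ->
  CI (fun t => emode j t * RtoC (lam_kernel rho (t, s)))%C =
  (RtoC (- (2 * PI * (rho ^ Nat.max j 1 / INR (Nat.max j 1)))) * emode j s)%C.
Proof.
  intros H. destruct (Nat.eq_dec j 0) as [->|Hj].
  - change (Nat.max 0 1) with 1%nat. rewrite emode_0.
    rewrite (CI_ext _ (fun t => cis (- INR 1 * t) * RtoC (lam_kernel rho (t, s)))%C) by (intros; now rewrite emode_0).
    rewrite lam_fourier by auto. f_equal. f_equal. unfold Rdiv. ring.
  - replace (Nat.max j 1) with j by lia.
    rewrite (CI_ext _ (fun t => Cconj (cis (- INR j * t) * RtoC (lam_kernel rho (t, s))))%C).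
    + rewrite CI_conj.
      * rewrite lam_fourier by (auto; lia). rewrite Cmult_conj, Cconj_RtoC, Cconj_cis_mul, Ropp_involutive, emode_pos by lia.
        f_equal. f_equal. unfold Rdiv. ring.
      * apply ccontR_mult; [apply ccontR_cis|]. intros t. apply ccont_RtoC.
        apply (continuous_slice_r (lam_kernel rho)). now apply cont2_lam_kernel.
    + intros t. rewrite Cmult_conj, Cconj_RtoC, Cconj_cis_mul, Ropp_involutive, emode_pos; auto. lia.
Qed.

Lemma lam_form rho j l : 0 < rho < 1 ->
  form (fun p => RtoC (lam_kernel rho p)) (emode j) (emode l) =
  if Nat.eq_dec j l then RtoC (- (4 * PI ^ 2 * (rho ^ Nat.max j 1 / INR (Nat.max j 1)))) else RtoC 0.
Proof.
  intros H. unfold form.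
  rewrite (CI_ext _ (fun s => RtoC (- (2 * PI * (rho ^ Nat.max j 1 / INR (Nat.max j 1)))) * (Cconj (emode l s) * emode j s))%C).
  - rewrite CI_scal.
    + rewrite CI_emode_orth. destruct (Nat.eq_dec j l); [|ring].
      rewrite <- RtoC_mult. f_equal. ring.
    + apply ccontR_mult; [apply ccontR_conj|]; apply ccontR_emode.
  - intros s. rewrite lam_emode by auto. ring.
Qed.

Lemma form_csum K (a : nat -> C) n : ccont2 K ->
  let x := fun t => csum (fun j => a j * emode j t)%C n in
  form K x x = csum (fun j => csum (fun l => a j * Cconj (a l) * form K (emode j) (emode l)) n)%C n.
Proof.
  intros HK x. assert (Hx : ccontR x).
  { apply (ccontR_csum (fun j t => a j * emode j t)%C). intros j. apply ccontR_mult; [apply ccontR_const|apply ccontR_emode]. }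
  unfold x at 1. rewrite form_csum_l; auto using ccontR_emode.
  apply csum_ext. intros j _. unfold x. rewrite form_csum_r; auto using ccontR_emode.
  rewrite <- csum_scal. apply csum_ext. intros l _. ring.
Qed.

Section AreaInequality.
Variables (F F1 F2 : C -> C) (Rad r : R).
Hypothesis dF : forall z, Cmod z < Rad -> cder F z (F1 z).
Hypothesis dF1 : forall z, Cmod z < Rad -> cder F1 z (F2 z).
Hypothesis cF2 : forall z, Cmod z < Rad -> ccont (X := C_UniformSpace) F2 z.
Hypothesis injF : forall z w, Cmod z < Rad -> Cmod w < Rad -> F z = F w -> z = w.
Hypothesis F_0 : F (RtoC 0) = RtoC 0.
Hypothesis F1_0 : F1 (RtoC 0) = RtoC 1.
Hypothesis Hr : 0 < r < Rad.

Let F1_0' : F1 (RtoC 0) <> RtoC 0.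
Proof. rewrite F1_0. apply RtoC_neq. lra. Qed.

Let gam (t : R) : C := (RtoC r * cis t)%C.

Lemma gam_disk t : Cmod (gam t) = r.
Proof. apply Cmod_scal_cis. lra. Qed.

Lemma ccontR_gam : ccontR gam.
Proof. apply ccontR_circle. Qed.

Definition dq_kernel (p : R * R) : R := Cmod (dq F F1 (gam (fst p)) (gam (snd p))) ^ 2.
(** What remains of ln |F(z) - F(w)|^2 on the circle after removal of ln |z - w|^2; on the diagonal
    it is ln |F'(z)|^2. *)
Definition U_kernel (p : R * R) : R := ln (dq_kernel p).

Lemma dq_kernel_pos p : 0 < dq_kernel p.
Proof.
  apply pow_lt, Cmod_gt_0. apply (dq_neq_0 F F1 F2 Rad); auto; rewrite gam_disk; lra.
Qed.

Lemma ccont2_gam (G : C -> C -> C) :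
  (forall z w, Cmod z < Rad -> Cmod w < Rad -> ccont (X := CC) (fun p => G (fst p) (snd p)) (z, w)) ->
  ccont2 (fun p => G (gam (fst p)) (gam (snd p))).
Proof.
  intros H p. apply (ccont_CC_compose (X := R2) G (fun p => gam (fst p)) (fun p => gam (snd p))).
  - apply H; rewrite gam_disk; lra.
  - apply (ccont2_fst gam), ccontR_gam.
  - apply (ccont2_snd gam), ccontR_gam.
Qed.

Lemma cont2_dq_kernel : cont2 dq_kernel.
Proof.
  intros p. apply continuous_pow_comp, continuous_Cmod.
  apply (ccont2_gam (dq F F1)). intros z w Hz Hw. now apply (dq_cont F F1 F2 Rad).
Qed.

Lemma cont2_U_kernel : cont2 U_kernel.
Proof. intros p. apply continuous_ln_comp; [apply cont2_dq_kernel|apply dq_kernel_pos]. Qed.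

Lemma ccont2_U : ccont2 (fun p => RtoC (U_kernel p)).
Proof. intros p. apply ccont_RtoC, cont2_U_kernel. Qed.

Lemma U_kernel_sym t s : U_kernel (t, s) = U_kernel (s, t).
Proof. unfold U_kernel, dq_kernel. cbn [fst snd]. now rewrite dq_sym. Qed.

Lemma slice_l_cont (G : C -> C -> C) z w :
  ccont (X := CC) (fun p => G (fst p) (snd p)) (z, w) -> ccont (X := C_UniformSpace) (fun z => G z w) z.
Proof.
  intros H. apply (ccont_CC_compose (X := C_UniformSpace) G (fun z => z) (fun _ => w)); auto.
  - apply ccont_id.
  - apply ccont_const.
Qed.

Lemma slice_r_cont (G : C -> C -> C) z w :
  ccont (X := CC) (fun p => G (fst p) (snd p)) (z, w) -> ccont (X := C_UniformSpace) (fun w => G z w) w.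
Proof.
  intros H. apply (ccont_CC_compose (X := C_UniformSpace) G (fun _ => z) (fun w => w)); auto.
  - apply ccont_const.
  - apply ccont_id.
Qed.

Lemma U_fourier k s : (1 <= k)%nat ->
  CI (fun t => cis (- INR k * t) * RtoC (U_kernel (t, s)))%C =
  (/ INR k * CI (fun t => cis (- INR k * t) * (gam t * lq F F1 F2 (gam t) (gam s))))%C.
Proof.
  intros Hk. pose proof (gam_disk s) as Hs.
  apply (log_fourier (fun z => dq F F1 z (gam s)) (fun z => dq2 F F1 F2 z (gam s)) r k); auto; try lra.
  - intros z Hz. apply (dq_cder F F1 F2 Rad); auto; lra.
  - intros z Hz. apply (dq_neq_0 F F1 F2 Rad); auto; lra.
  - intros z Hz. apply (slice_l_cont (dq2 F F1 F2)). apply (dq2_cont F F1 F2 Rad); auto; lra.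
  (* A point z of the open disk cannot meet [gam s], which lies on the circle. *)
  - intros z Hz. apply (lq_c1at_l F F1 F2 Rad); auto; try lra. intros ->. lra.
Qed.

Definition hfun (w : C) : C := (/ w - / F w)%C.

Lemma F_neq_0 w : 0 < Cmod w < Rad -> F w <> RtoC 0.
Proof.
  intros Hw E. assert (w = RtoC 0); [|subst w; rewrite Cmod_0 in Hw; lra].
  apply injF; [lra|rewrite Cmod_0; lra|congruence].
Qed.

(** The weight e^(-it) cancels the factor e^(it) brought in by angular differentiation, so the mean
    value property evaluates [lq] at z = 0. *)
Lemma U_moment_0 s : CI (fun t => emode 0 t * RtoC (U_kernel (t, s)))%C = (RtoC (2 * PI * r) * hfun (gam s))%C.
Proof.
  pose proof (gam_disk s) as Hs.
  rewrite (CI_ext _ (fun t => cis (- INR 1 * t) * RtoC (U_kernel (t, s)))%C) by (intros; now rewrite emode_0).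
  rewrite U_fourier by auto.
  rewrite (CI_ext _ (fun t => RtoC r * lq F F1 F2 (RtoC r * cis t) (gam s))%C).
  - assert (Cc : forall z, Cmod z <= r -> ccont (X := C_UniformSpace) (fun z => lq F F1 F2 z (gam s)) z).
    { intros z Hz. apply (slice_l_cont (lq F F1 F2)). apply (lq_cont F F1 F2 Rad); auto; lra. }
    rewrite CI_scal.
    + rewrite (circle_mean (fun z => lq F F1 F2 z (gam s)) r); auto; try lra.
      * rewrite (lq_0 F F1 F2 Rad) by (auto; lra). unfold hfun. simpl INR.
        rewrite !RtoC_mult. field. split; [apply F_neq_0; lra|]. apply Cmod_gt_0; lra.
      * intros z Hz. apply (lq_c1at_l F F1 F2 Rad); auto; try lra. intros ->. lra.
    + apply (ccontR_comp (fun z => lq F F1 F2 z (gam s)) r); auto; lra.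
  - intros t. unfold gam. 
    assert (E : (cis (- INR 1 * t) * cis t)%C = RtoC 1).
    { rewrite <- cis_plus. replace (- INR 1 * t + t) with 0 by (simpl; ring). apply cis_0. }
    set (X := lq F F1 F2 (r * cis t) (r * cis s)).
    replace (cis (- INR 1 * t) * (r * cis t * X))%C with ((cis (- INR 1 * t) * cis t) * (r * X))%C by ring.
    rewrite E. ring.
Qed.

(** Conjugation turns the inner integral into a moment of [lq], which is holomorphic in w as well.
    After exchanging the integrations, the one over s against e^(ils) vanishes because l >= 1. *)
Lemma U_form_pos j l : (1 <= j)%nat -> (1 <= l)%nat ->
  form (fun p => RtoC (U_kernel p)) (emode j) (emode l) = RtoC 0.
Proof.
  intros Hj Hl. unfold form.
  set (Y := fun p : R * R => (cis (- INR j * snd p) * (gam (snd p) * lq F F1 F2 (gam (snd p)) (gam (fst p))))%C).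
  assert (CY : ccont2 Y).
  { apply ccont2_mult; [apply (ccont2_snd (fun t => cis (- INR j * t))), ccontR_cis|].
    apply ccont2_mult; [apply (ccont2_snd gam), ccontR_gam|].
    apply (ccont2_swap (fun p => lq F F1 F2 (gam (fst p)) (gam (snd p)))).
    apply (ccont2_gam (lq F F1 F2)). intros z w Hz Hw. now apply (lq_cont F F1 F2 Rad). }
  assert (HjC : RtoC (INR j) <> RtoC 0) by (apply RtoC_neq, not_0_INR; lia).
  rewrite (CI_ext _ (fun s => Cconj (/ INR j * CI (fun t => cis (INR l * s) * Y (s, t))))%C).
  - assert (CZ : ccont2 (fun p => cis (INR l * fst p) * Y p)%C).
    { apply ccont2_mult; auto. apply (ccont2_fst (fun t => cis (INR l * t))), ccontR_cis. }
    pose proof (ccontR_CI1 _ CZ) as CW. cbn [fst] in CW.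
    rewrite (CI_conj (fun s => / INR j * CI (fun t => cis (INR l * s) * Y (s, t)))%C).
    2:{ apply ccontR_mult; [apply ccontR_const|exact CW]. }
    rewrite CI_scal by exact CW.
    pose proof (CI_Fubini _ CZ) as FB. cbn [fst] in FB. rewrite FB.
    rewrite (CI_0 (fun t => CI (fun s => cis (INR l * s) * Y (s, t))%C)).
    + rewrite Cmult_0_r. apply Cconj_RtoC.
    + intros t. pose proof (gam_disk t) as Ht. unfold Y. cbn [fst snd].
      rewrite (CI_ext _ (fun s => (cis (- INR j * t) * gam t) * (cis (INR l * s) * lq F F1 F2 (gam t) (RtoC r * cis s)))%C)
        by (intros s; unfold gam; ring).
      assert (Cc : forall w, Cmod w <= r -> ccont (X := C_UniformSpace) (fun w => lq F F1 F2 (gam t) w) w).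
      { intros w Hw. apply (slice_r_cont (lq F F1 F2)). apply (lq_cont F F1 F2 Rad); auto; lra. }
      rewrite CI_scal.
      * rewrite (circle_mean_pow (fun w => lq F F1 F2 (gam t) w) r l); auto; try lra; [ring|].
        intros w Hw. apply (lq_c1at_r F F1 F2 Rad); auto; try lra. intros E. rewrite <- E in Hw. lra.
      * apply ccontR_mult; [apply ccontR_cis|]. apply (ccontR_comp (fun w => lq F F1 F2 (gam t) w) r); auto; lra.
  - intros s. rewrite CI_scal.
    + rewrite !Cmult_conj.
      replace (CI (fun t => emode j t * RtoC (U_kernel (t, s)))%C) with
        (Cconj (/ INR j * CI (fun t => Y (s, t))))%C.
      * rewrite Cmult_conj, emode_pos by auto. ring.
      * unfold Y. cbn [fst snd]. rewrite <- U_fourier by auto. rewrite <- CI_conj.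
        -- apply CI_ext. intros t. rewrite Cmult_conj, Cconj_RtoC, Cconj_cis_mul, Ropp_involutive, emode_pos; auto.
        -- apply (ccontR_mult (fun t => cis (- INR j * t))); [apply ccontR_cis|apply (ccontR_slice2 _ ccont2_U)].
    + apply (ccontR_slice1 _ CY).
Qed.

(** Conjugation exchanges the modes 0 and 1, and the kernel is real. *)
Lemma U_form_00 : form (fun p => RtoC (U_kernel p)) (emode 0) (emode 0) = RtoC 0.
Proof.
  rewrite <- (Cconj_RtoC 0), <- (U_form_pos 1 1) by auto. unfold form.
  assert (E : forall t, emode 0 t = Cconj (emode 1 t)).
  { intros t. rewrite emode_0, emode_pos, Cconj_cis_mul; auto. }
  pose proof (ccontR_form _ _ _ ccont2_U (ccontR_emode 1) (ccontR_emode 1)) as CF.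
  rewrite <- (CI_conj (fun s => Cconj (emode 1 s) * CI (fun t => emode 1 t * RtoC (U_kernel (t, s))))%C) by exact CF.
  apply CI_ext. intros s. rewrite Cmult_conj, E. f_equal.
  pose proof (ccontR_slice_mult _ _ s ccont2_U (ccontR_emode 1)) as CS.
  rewrite <- (CI_conj (fun t => emode 1 t * RtoC (U_kernel (t, s)))%C) by exact CS.
  apply CI_ext. intros t. now rewrite Cmult_conj, Cconj_RtoC, E.
Qed.

(** The expansion of 1/z - 1/F(z) is given to order K with a Peano remainder z^K g(z), so a power
    series for 1/F need not be constructed. *)
Variables (b : nat -> C) (g : C -> C) (K : nat).
Hypothesis h_exp : forall z, 0 < Cmod z < Rad ->
  hfun z = (csum (fun j => b (S j) * z ^ S j) K + z ^ K * g z)%C.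
Hypothesis g_cont : ccont (X := C_UniformSpace) g (RtoC 0).
Hypothesis g_0 : g (RtoC 0) = RtoC 0.

(** Off the origin [h_exp] expresses g through F, so g inherits its holomorphy. *)
Lemma g_c1at z : 0 < Cmod z < Rad -> c1at g z.
Proof.
  intros Hz. assert (Hz0 : z <> RtoC 0) by (apply Cmod_gt_0; lra).
  apply c1at_ext_loc with (fun z => ((/ z - / F z) - csum (fun j => b (S j) * z ^ S j) K) / z ^ K)%C.
  - apply (filter_imp (fun w => w <> RtoC 0 /\ Cmod w < Rad)).
    + intros w [H1 H2]. assert (0 < Cmod w) by now apply Cmod_gt_0.
      change (/ w - / F w)%C with (hfun w). rewrite h_exp by lra. field. now apply Cpow_nz.
    + apply filter_and; [now apply locally_not_eq|apply locally_disk; lra].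
  - apply c1at_div; [| |now apply Cpow_nz].
    + apply c1at_minus.
      * apply c1at_minus; [apply c1at_inv; auto; apply c1at_id|].
        apply c1at_inv; [apply (F_c1at F F1 F2 Rad); auto; lra|now apply F_neq_0].
      * clear. induction K as [|k IH]; cbn [csum]; [apply c1at_const|].
        apply c1at_plus; auto. apply c1at_mult; [apply c1at_const|]. apply c1at_pow, c1at_id.
    + apply c1at_pow, c1at_id.
Qed.

Lemma g_continuous z : Cmod z < Rad -> ccont (X := C_UniformSpace) g z.
Proof.
  intros Hz. destruct (Ceq_dec z (RtoC 0)) as [->|H]; auto.
  apply c1at_ccont, g_c1at. split; auto. now apply Cmod_gt_0.
Qed.

Lemma gam_pow k t : (gam t ^ k)%C = (RtoC (r ^ k) * cis (INR k * t))%C.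
Proof. apply circle_pow. Qed.

(** Orthogonality selects b_l from the polynomial. The remainder contributes the central value of
    z^(K-l) g(z), which is 0 even for l = K because g vanishes at 0. *)
Lemma h_fourier l : (1 <= l <= K)%nat ->
  CI (fun s => cis (- INR l * s) * hfun (gam s))%C = (RtoC (2 * PI * r ^ l) * b l)%C.
Proof.
  intros Hl.
  rewrite (CI_ext _ (fun s => csum (fun j => (b (S j) * RtoC (r ^ S j)) * (Cconj (emode l s) * emode (S j) s)) K +
    RtoC (r ^ l) * ((RtoC r * cis s) ^ (K - l) * g (RtoC r * cis s)))%C).
  - assert (C1 : forall j, ccontR (fun s => Cconj (emode l s) * emode (S j) s)%C).
    { intros j. apply ccontR_mult; [apply ccontR_conj|]; apply ccontR_emode. }
    assert (C2 : forall z, Cmod z <= r -> ccont (X := C_UniformSpace) (fun z => z ^ (K - l) * g z)%C z).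
    { intros z Hz. apply ccont_mult; [apply ccont_pow, ccont_id|]. apply g_continuous. lra. }
    pose proof (ccontR_comp _ r ltac:(lra) C2) as C3. cbv beta in C3.
    rewrite CI_plus.
    + rewrite (CI_csum (fun j s => (b (S j) * RtoC (r ^ S j)) * (Cconj (emode l s) * emode (S j) s))%C).
      * rewrite CI_scal by exact C3.
        rewrite (circle_mean (fun z => z ^ (K - l) * g z)%C r); try lra; auto.
        -- rewrite g_0.
           rewrite (csum_ext _ (fun j => if Nat.eq_dec (pred l) j then (b (S j) * RtoC (r ^ S j) * RtoC (2 * PI))%C else RtoC 0)).
           ++ rewrite csum_delta. destruct (lt_dec (pred l) K); [|lia].
              replace (S (pred l)) with l by lia. rewrite !RtoC_mult. ring.
           ++ intros j _. rewrite CI_scal by apply C1. rewrite CI_emode_orth.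
              destruct (Nat.eq_dec (S j) l), (Nat.eq_dec (pred l) j); try lia; ring.
        -- intros z Hz. apply c1at_mult; [apply c1at_pow, c1at_id|]. apply g_c1at; lra.
      * intros j. apply ccontR_mult; [apply ccontR_const|apply C1].
    + apply (ccontR_csum (fun j s => (b (S j) * RtoC (r ^ S j)) * (Cconj (emode l s) * emode (S j) s))%C).
      intros j. apply ccontR_mult; [apply ccontR_const|apply C1].
    + apply ccontR_mult; [apply ccontR_const|exact C3].
  - intros s. rewrite h_exp by (rewrite gam_disk; lra).
    rewrite Cmult_plus_distr_l. f_equal.
    + rewrite <- csum_scal. apply csum_ext. intros j _. rewrite gam_pow.
      rewrite (emode_pos (S j)), (emode_pos l), Cconj_cis_mul by lia. ring.
    + fold (gam s). replace (gam s ^ K)%C with (gam s ^ l * gam s ^ (K - l))%C.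
      * rewrite (gam_pow l).
        assert (E : (cis (- INR l * s) * cis (INR l * s))%C = RtoC 1).
        { rewrite <- cis_plus. replace (- INR l * s + INR l * s) with 0 by ring. apply cis_0. }
        replace (cis (- INR l * s) * (RtoC (r ^ l) * cis (INR l * s) * gam s ^ (K - l) * g (gam s)))%C with
          ((cis (- INR l * s) * cis (INR l * s)) * (RtoC (r ^ l) * (gam s ^ (K - l) * g (gam s))))%C.
        -- rewrite E. unfold gam. ring.
        -- ring.
      * rewrite <- Cpow_add_r. f_equal. lia.
Qed.

Lemma U_form_0l l : (1 <= l <= K)%nat ->
  form (fun p => RtoC (U_kernel p)) (emode 0) (emode l) = (RtoC (4 * PI ^ 2 * r ^ S l) * b l)%C.
Proof.
  intros Hl. unfold form.
  rewrite (CI_ext _ (fun s => RtoC (2 * PI * r) * (cis (- INR l * s) * hfun (gam s)))%C).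
  - rewrite CI_scal.
    + rewrite h_fourier by auto. rewrite Cmult_assoc, <- RtoC_mult. f_equal. f_equal. simpl. ring.
    + apply ccontR_mult; [apply ccontR_cis|]. intros s. unfold hfun.
      apply ccont_minus; apply ccont_inv.
      * apply ccontR_gam.
      * apply Cmod_gt_0. rewrite gam_disk. lra.
      * apply (ccont_comp (X := R_UniformSpace) gam F); [apply ccontR_gam|].
        apply (F_cont F F1 Rad); auto. rewrite gam_disk. lra.
      * apply F_neq_0. rewrite gam_disk. lra.
  - intros s. rewrite U_moment_0, emode_pos, Cconj_cis_mul by lia. ring.
Qed.

(* The minimizer of the energy over all charges with coefficient 1 on [e^(-it)]. *)
Definition charge (j : nat) : C :=
  match j with O => RtoC 1 | _ => (RtoC (INR j * r ^ S j) * b j)%C end.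
(* Shifted index: [area_term j] belongs to [b_(j+1)]. *)
Definition area_term (j : nat) : R := INR (S j) * (r ^ S (S j) * Cmod (b (S j))) ^ 2.

(** Only the pairs of mode 0 with a mode l >= 1 survive. The two orders are conjugate and contribute
    4 pi^2 [area_term] each, hence the factor 8. *)
Lemma U_form_charge :
  let x := fun t => csum (fun j => charge j * emode j t)%C (S K) in
  Re (form (fun p => RtoC (U_kernel p)) x x) = 8 * PI ^ 2 * rsum area_term K.
Proof.
  intros x. unfold x. rewrite form_csum by apply ccont2_U.
  set (fm := fun j l => form (fun p => RtoC (U_kernel p)) (emode j) (emode l)).
  assert (S0l : forall l, (l < K)%nat -> (charge 0 * Cconj (charge (S l)) * fm 0%nat (S l))%C = RtoC (4 * PI ^ 2 * area_term l)).
  { intros l Hl. unfold fm. rewrite U_form_0l by lia. unfold charge, area_term.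
    rewrite Cmult_conj, Cconj_RtoC.
    transitivity (RtoC (INR (S l) * r ^ S (S l)) * RtoC (4 * PI ^ 2 * r ^ S (S l)) * (b (S l) * Cconj (b (S l))))%C; [ring|].
    rewrite <- Cmod2_conj. rewrite <- !RtoC_mult. f_equal. ring. }
  assert (Sl0 : forall l, (l < K)%nat -> (charge (S l) * Cconj (charge 0) * fm (S l) 0%nat)%C = RtoC (4 * PI ^ 2 * area_term l)).
  { intros l Hl. rewrite <- (Cconj_RtoC (4 * PI ^ 2 * area_term l)), <- S0l by auto.
    rewrite !Cmult_conj, Cconj_conj. unfold fm.
    rewrite (form_conj_sym U_kernel (emode 0) (emode (S l))); auto using ccontR_emode, cont2_U_kernel, U_kernel_sym. ring. }
  rewrite csum_S_left, csum_S_left.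
  fold (fm 0%nat 0%nat). replace (fm 0%nat 0%nat) with (RtoC 0) by (symmetry; apply U_form_00).
  rewrite (csum_ext _ (fun l => RtoC (4 * PI ^ 2 * area_term l))) by exact S0l.
  rewrite (csum_ext (fun j => csum _ (S K)) (fun l => RtoC (4 * PI ^ 2 * area_term l))).
  - rewrite re_plus, re_plus, csum_Re. cbn [Re fst RtoC].
    change (fun j : nat => Re (RtoC (4 * PI ^ 2 * area_term j))) with (fun j => (4 * PI ^ 2) * area_term j).
    rewrite rsum_scal. 
    replace (Re (charge 0 * Cconj (charge 0) * RtoC 0)) with 0 by (rewrite Cmult_0_r; reflexivity). ring.
  - intros j Hj. rewrite csum_S_left. rewrite Sl0 by auto. rewrite csum_0; [ring|].
    intros l Hl. unfold fm. rewrite U_form_pos by lia. ring.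
Qed.

(** On the modes the kernel is diagonal with entries -4 pi^2 rho^k/k. For the chosen charge
    |c_k|^2/k is an area term, mode 0 gives the summand 1, and rho^k <= 1 frees the bound from
    rho. *)
Lemma lam_form_charge rho : 0 < rho < 1 ->
  let x := fun t => csum (fun j => charge j * emode j t)%C (S K) in
  - (4 * PI ^ 2 * (1 + rsum area_term K)) <= Re (form (fun p => RtoC (lam_kernel rho p)) x x).
Proof.
  intros Hrho x. unfold x. rewrite form_csum by (intros p; apply ccont_RtoC; now apply cont2_lam_kernel).
  rewrite (csum_ext _ (fun j => RtoC (- (4 * PI ^ 2) * (Cmod (charge j) ^ 2 * (rho ^ Nat.max j 1 / INR (Nat.max j 1)))))).
  - rewrite csum_Re. cbn [Re fst RtoC].
    change (- (4 * PI ^ 2 * (1 + rsum area_term K)) <=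
       rsum (fun j => - (4 * PI ^ 2) * (Cmod (charge j) ^ 2 * (rho ^ Nat.max j 1 / INR (Nat.max j 1)))) (S K)).
    rewrite rsum_scal.
    assert (A : rsum (fun j => Cmod (charge j) ^ 2 * (rho ^ Nat.max j 1 / INR (Nat.max j 1))) (S K) <= 1 + rsum area_term K).
    { rewrite rsum_S_left. apply Rplus_le_compat.
      - unfold charge. rewrite Cmod_1. simpl. lra.
      - apply rsum_le. intros j _. replace (Nat.max (S j) 1) with (S j) by lia.
        unfold charge, area_term. rewrite Cmod_mult, Cmod_R.
        assert (Hj : 0 < INR (S j)) by (apply lt_0_INR; lia).
        assert (Hrj : 0 < r ^ S (S j)) by (apply pow_lt; lra).
        rewrite Rabs_pos_eq by (apply Rmult_le_pos; lra).
        assert (Hp : rho ^ S j <= 1) by (rewrite <- (pow1 (S j)); apply pow_incr; lra).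
        set (B := r ^ S (S j)) in *. set (c := Cmod (b (S j))).
        replace ((INR (S j) * B * c) ^ 2 * (rho ^ S j / INR (S j))) with (INR (S j) * (B * c) ^ 2 * rho ^ S j) by (field; lra).
        assert (0 <= INR (S j) * (B * c) ^ 2) by (apply Rmult_le_pos; [lra|apply pow2_ge_0]).
        rewrite <- (Rmult_1_r (INR (S j) * (B * c) ^ 2)) at 2. apply Rmult_le_compat_l; auto. }
    pose proof PI_RGT_0. assert (0 < 4 * PI ^ 2) by nra. nra.
  - intros j Hj.
    rewrite (csum_ext _ (fun l => if Nat.eq_dec j l then
       (charge j * Cconj (charge l) * RtoC (- (4 * PI ^ 2 * (rho ^ Nat.max j 1 / INR (Nat.max j 1)))))%C else RtoC 0)).
    + rewrite csum_delta. destruct (lt_dec j (S K)); [|lia].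
      rewrite <- Cmod2_conj, <- RtoC_mult. f_equal. ring.
    + intros l _. rewrite lam_form by auto. destruct (Nat.eq_dec j l); auto. ring.
Qed.

(** With S the sum, the two parts of the energy add up to at least -4 pi^2 (1 + S) + 8 pi^2 S = 4
    pi^2 (S - 1), and the total is nonpositive up to an error that vanishes as rho -> 1. *)
Theorem area_inequality : rsum area_term K <= 1.
Proof.
  set (x := fun t => csum (fun j => charge j * emode j t)%C (S K)).
  assert (Cjt : forall j, ccontR (fun t => charge j * emode j t)%C).
  { intros j. apply ccontR_mult; [apply ccontR_const|apply ccontR_emode]. }
  assert (Hx : ccontR x) by (apply (ccontR_csum (fun j t => charge j * emode j t)%C); auto).
  assert (Hx0 : CI x = RtoC 0).
  { unfold x. rewrite (CI_csum (fun j t => charge j * emode j t)%C) by auto.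
    apply csum_0. intros j _. rewrite CI_scal, CI_emode_0 by apply ccontR_emode. ring. }
  pose proof two_PI_pos as H2P.
  destruct (continuous_bounded (fun t => Cmod (x t)) (2 * PI)) as [X HX]; [lra| |].
  { intros t. apply continuous_Cmod, Hx. }
  assert (CF : ccontR (fun t => F (gam t))).
  { intros t. apply (ccont_comp (X := R_UniformSpace) gam F); [apply ccontR_gam|].
    apply (F_cont F F1 Rad); auto. rewrite gam_disk. lra. }
  destruct (continuous_bounded (fun t => Cmod (F (gam t))) (2 * PI)) as [W HW]; [lra| |].
  { intros t. apply continuous_Cmod, CF. }
  destruct (cont2_bounded dq_kernel (2 * PI)) as [M HM]; [lra|apply cont2_dq_kernel|].
  destruct (cont2_bounded (fun p => / dq_kernel p) (2 * PI)) as [M' HM']; [lra| |].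
  { intros p. apply continuous_Rinv_comp; [apply cont2_dq_kernel|]. apply Rgt_not_eq, dq_kernel_pos. }
  assert (HM'0 : 0 < M').
  { eapply Rlt_le_trans; [|apply (HM' 0 0); lra]. apply Rinv_0_lt_compat, dq_kernel_pos. }
  (* [cont2_bounded] gives upper bounds only, so [dq_kernel] is bounded below through its
     inverse. *)
  set (m := / M'). assert (Hm : 0 < m) by now apply Rinv_0_lt_compat.
  assert (HmM : forall t s, 0 <= t <= 2 * PI -> 0 <= s <= 2 * PI -> m <= dq_kernel (t, s) <= M).
  { intros t s Ht Hs. split; [|now apply HM]. unfold m. rewrite <- (Rinv_inv (dq_kernel (t, s))).
    apply Rinv_le_contravar; [apply Rinv_0_lt_compat, dq_kernel_pos|now apply HM']. }
  assert (HM0 : 0 < M).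
  { eapply Rlt_le_trans; [|apply (HM 0 0); lra]. apply dq_kernel_pos. }
  set (Cc := / m + 1 + (M + 1) / Rmin m 1).
  assert (HCc : 0 <= Cc).
  { unfold Cc. assert (0 < / m) by now apply Rinv_0_lt_compat.
    assert (0 < (M + 1) / Rmin m 1) by (apply Rdiv_lt_0_compat; [lra|apply Rmin_pos; lra]). lra. }
  assert (HX0 : 0 <= X) by (eapply Rle_trans; [apply Cmod_ge_0|apply (HX 0); lra]).
  cut (rsum area_term K - 1 <= 0); [lra|].
  apply (nonpos_of_vanishing_bound _ (X * X * Cc)).
  { apply Rmult_le_pos; auto. now apply Rmult_le_pos. }
  intros rho Hrho.
  (* With u = t - s this e satisfies r^2 (2 - 2 cos u) + e = (r^2/rho) (1 + rho^2 - 2 rho cos u). *)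
  set (e := r ^ 2 * (1 - rho) ^ 2 / rho).
  assert (Hr2 : 0 < r ^ 2) by (apply pow_lt; lra).
  assert (He : 0 < e).
  { unfold e. apply Rdiv_lt_0_compat; [|lra]. apply Rmult_lt_0_compat; auto. apply pow_lt; lra. }
  set (T := fun p : R * R => ln (Cmod (F (gam (fst p)) - F (gam (snd p))) ^ 2 + e)).
  pose proof (form_log_energy_nonpos (fun t => F (gam t)) x e X W CF Hx Hx0 He HX HW) as En.
  change (Re (form (fun p => RtoC (T p)) x x) <= 0) in En.
  set (A := fun p : R * R => Cmod (gam (fst p) - gam (snd p)) ^ 2).
  assert (EA : forall p, A p + e = r ^ 2 / rho * Cmod (RtoC 1 - RtoC rho * cis (fst p - snd p)) ^ 2).
  { intros [t s]. unfold A, e. cbn [fst snd].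
    replace (gam t - gam s)%C with (- ((RtoC r * cis s) * (RtoC 1 - RtoC 1 * cis (t - s))))%C.
    - rewrite Cmod_opp, Cmod_mult, Rpow_mult_distr, !Cmod_one_minus, Cmod_scal_cis by lra. field. lra.
    - assert (E : cis t = (cis (t - s) * cis s)%C) by (rewrite <- cis_plus; f_equal; ring).
      unfold gam. rewrite E. ring. }
  assert (HT : forall p, T p = ln (dq_kernel p * A p + e)).
  { intros [t s]. unfold T, A, dq_kernel. cbn [fst snd]. f_equal. f_equal.
    rewrite <- Rpow_mult_distr, <- Cmod_mult. f_equal. f_equal.
    unfold dq. destruct (Ceq_dec (gam t) (gam s)) as [E|E]; [rewrite E; ring|].
    field. now apply Csub_neq_0. }
  (* The defect of the splitting. On the diagonal it equals -[U_kernel] for every e, so it is small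
     only in the integrated sense of [form_bound]. *)
  set (D := fun p => T p - U_kernel p - ln (A p + e)).
  assert (CT : cont2 T).
  { intros p. apply continuous_ln_comp.
    - apply continuous_Rplus; [|apply continuous_const]. apply continuous_pow_comp, continuous_Cmod.
      apply ccont_minus; [now apply (ccont2_fst (fun t => F (gam t)))|now apply (ccont2_snd (fun t => F (gam t)))].
    - apply Rplus_le_lt_0_compat; [apply pow2_ge_0|exact He]. }
  assert (CA : cont2 (fun p => ln (A p + e))).
  { intros p. apply continuous_ln_comp.
    - apply continuous_Rplus; [|apply continuous_const]. apply continuous_pow_comp, continuous_Cmod.
      apply ccont_minus; [apply (ccont2_fst gam)|apply (ccont2_snd gam)]; apply ccontR_gam.
    - apply Rplus_le_lt_0_compat; [apply pow2_ge_0|exact He]. }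
  assert (CD : cont2 D).
  { intros p. apply continuous_Rminus; [apply continuous_Rminus|]; [apply CT|apply cont2_U_kernel|apply CA]. }
  assert (CCD : ccont2 (fun p => RtoC (D p))) by (intros p; apply ccont_RtoC, CD).
  assert (CCL : ccont2 (fun p => RtoC (lam_kernel rho p))) by (intros p; apply ccont_RtoC; now apply cont2_lam_kernel).
  assert (Dec : form (fun p => RtoC (T p)) x x =
    (form (fun p => RtoC (lam_kernel rho p)) x x + form (fun p => RtoC (U_kernel p)) x x + form (fun p => RtoC (D p)) x x)%C).
  { rewrite (form_ext _ (fun p => (RtoC (ln (r ^ 2 / rho)) + (RtoC (lam_kernel rho p) + RtoC (U_kernel p) + RtoC (D p))))%C).
    - rewrite form_plus; auto.
      + rewrite (form_const_l (fun _ => RtoC (ln (r ^ 2 / rho)))); auto using ccontR_const.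
        rewrite form_plus; auto; [rewrite form_plus; auto using ccont2_U; ring|].
        intros p. apply ccont_plus; [apply CCL|apply ccont2_U].
      + intros p. apply ccont_const.
      + intros p. apply ccont_plus; [apply ccont_plus; [apply CCL|apply ccont2_U]|apply CCD].
    - intros p. rewrite <- !RtoC_plus. f_equal. unfold D. rewrite EA, ln_mult.
      + unfold lam_kernel. ring.
      + apply Rdiv_lt_0_compat; lra.
      + now apply Cmod_one_minus_pos. }
  assert (BD : Cmod (form (fun p => RtoC (D p)) x x) <= 2 * PI * (X * (X * (Cc * (2 * PI * ((1 - rho) / (1 + rho))))))).
  { apply (form_bound _ (fun p => Cc * poisson_weight rho p)); auto.
    - intros p. apply continuous_Rmult; [apply continuous_const|now apply cont2_poisson].
    - intros t s Ht Hs. rewrite Cmod_R. unfold D. rewrite HT. unfold U_kernel.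
      replace (poisson_weight rho (t, s)) with (e / (A (t, s) + e)).
      + apply log_ratio_bound; auto. unfold A. apply pow2_ge_0.
      + rewrite EA. unfold e, poisson_weight. cbn [fst snd].
        pose proof (Cmod_one_minus_pos rho (t - s) Hrho). field. repeat split; try lra.
        intros E0. rewrite E0 in H. simpl in H. lra.
    - intros s. rewrite RI_scal, RI_poisson by (auto; apply (continuous_slice_r (poisson_weight rho)); now apply cont2_poisson).
      lra. }
  rewrite Dec, !re_plus in En.
  pose proof (lam_form_charge rho Hrho) as L1. pose proof U_form_charge as L2. cbv zeta in L1, L2.
  fold x in L1, L2. rewrite L2 in En.
  pose proof (re_le_Cmod (form (fun p => RtoC (D p)) x x)) as R1. apply Rabs_le_between in R1.
  set (S := rsum area_term K) in *.
  set (d := (1 - rho) / (1 + rho)) in *.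
  assert (Fin : 4 * PI ^ 2 * (S - 1) <= 4 * PI ^ 2 * (X * X * Cc * d)) by nra.
  apply Rmult_le_reg_l in Fin; auto. pose proof PI_RGT_0. nra.
Qed.
End AreaInequality.

(** * Complex power series *)

Definition cconv (u : nat -> C) (l : C) : Prop :=
  forall e, 0 < e -> exists N, forall n, (N <= n)%nat -> Cmod (u n - l) < e.

Lemma cconv_le u l B N : cconv u l -> (forall n, (N <= n)%nat -> Cmod (u n) <= B) -> Cmod l <= B.
Proof.
  intros H HB. destruct (Rle_or_lt (Cmod l) B) as [|Hlt]; auto. exfalso.
  destruct (H (Cmod l - B) ltac:(lra)) as [N' HN].
  specialize (HN (max N N') ltac:(lia)). specialize (HB (max N N') ltac:(lia)).
  pose proof (Cmod_triangle_inv l (u (max N N'))) as T. rewrite (Cmod_sub_sym l) in T. lra.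
Qed.

Lemma cconv_unique u l l' : cconv u l -> cconv u l' -> l = l'.
Proof.
  intros H H'. destruct (Ceq_dec l l') as [|Hne]; auto. exfalso.
  apply Csub_neq_0, Cmod_gt_0 in Hne.
  destruct (H (Cmod (l - l') / 2) ltac:(lra)) as [N HN].
  destruct (H' (Cmod (l - l') / 2) ltac:(lra)) as [N' HN'].
  specialize (HN (max N N') ltac:(lia)). specialize (HN' (max N N') ltac:(lia)).
  replace (l - l')%C with ((u (max N N') - l') + - (u (max N N') - l))%C in * by ring.
  pose proof (Cmod_triangle (u (max N N') - l') (- (u (max N N') - l))) as T.
  rewrite Cmod_opp in T. lra.
Qed.

Lemma cconv_plus u v l m : cconv u l -> cconv v m -> cconv (fun n => u n + v n)%C (l + m)%C.
Proof.
  intros H H' e He.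
  destruct (H (e / 2) ltac:(lra)) as [N HN]. destruct (H' (e / 2) ltac:(lra)) as [N' HN'].
  exists (max N N'). intros n Hn. specialize (HN n ltac:(lia)). specialize (HN' n ltac:(lia)).
  replace (u n + v n - (l + m))%C with ((u n - l) + (v n - m))%C by ring.
  eapply Rle_lt_trans; [apply Cmod_triangle|]. lra.
Qed.

Lemma cconv_scal c u l : cconv u l -> cconv (fun n => c * u n)%C (c * l)%C.
Proof.
  intros H e He. pose proof (Cmod_ge_0 c).
  destruct (H (e / (Cmod c + 1))) as [N HN]; [apply Rdiv_lt_0_compat; lra|].
  exists N. intros n Hn. specialize (HN n Hn).
  replace (c * u n - c * l)%C with (c * (u n - l))%C by ring. rewrite Cmod_mult.
  apply Rmult_lt_compat_r with (r := Cmod c + 1) in HN; [|lra].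
  unfold Rdiv in HN. rewrite Rmult_assoc, Rinv_l, Rmult_1_r in HN by lra.
  pose proof (Cmod_ge_0 (u n - l)). nra.
Qed.

Lemma cconv_const c : cconv (fun _ => c) c.
Proof.
  intros e He. exists 0%nat. intros n _. replace (c - c)%C with (RtoC 0) by ring. now rewrite Cmod_0.
Qed.

Lemma cconv_shift u l : cconv u l -> cconv (fun n => u (S n)) l.
Proof. intros H e He. destruct (H e He) as [N HN]. exists N. intros n Hn. apply HN. lia. Qed.

Lemma cconv_unshift u l : cconv (fun n => u (S n)) l -> cconv u l.
Proof.
  intros H e He. destruct (H e He) as [N HN]. exists (S N). intros n Hn.
  destruct n; [lia|]. apply HN. lia.
Qed.

Lemma cconv_ext u v l : (forall n, u n = v n) -> cconv u l -> cconv v l.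
Proof. intros E H e He. destruct (H e He) as [N HN]. exists N. intros n Hn. rewrite <- E. auto. Qed.

Definition psum (a : nat -> C) (z : C) (n : nat) : C := csum (fun k => a k * z ^ k)%C n.
Definition PS (a : nat -> C) (f : C -> C) : Prop := forall z, Cmod z < 1 -> cconv (psum a z) (f z).
(** Radius of convergence at least 1, in a form that passes to shifted and to differentiated
    series. *)
Definition coef_bound (a : nat -> C) : Prop :=
  forall s, 0 < s < 1 -> exists M, forall n, Cmod (a n) * s ^ n <= M.

Lemma pow_n_Cpow (z : C) k : pow_n (K := C_AbsRing) z k = (z ^ k)%C.
Proof. induction k; [reflexivity|]. simpl pow_n. rewrite IHk. reflexivity. Qed.

(** [sum_n] at n has n + 1 terms and [psum] has n, whence the shift by one. *)
Lemma is_pseries_cconv (a : nat -> C) z l :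
  @is_pseries C_AbsRing C_NormedModule a z l -> cconv (psum a z) l.
Proof.
  intros H. apply cconv_unshift. intros e He.
  assert (L : @locally C_UniformSpace l (fun w => Cmod (w - l) < e)).
  { apply locally_Cmod. exists e; auto. }
  destruct (H _ L) as [N HN]. exists N. intros n Hn. specialize (HN n Hn).
  assert (E : forall n, sum_n (G := C_NormedModule) (fun k : nat => scal (pow_n (K := C_AbsRing) z k) (a k)) n = psum a z (S n)).
  { clear. intros n. induction n as [|n IH].
    - rewrite sum_O. unfold psum. simpl. change (RtoC 1 * a 0%nat = RtoC 0 + a 0%nat * RtoC 1)%C. ring.
    - rewrite sum_Sn, IH. unfold psum. cbn [csum].
      assert (Hsc : forall u v w c : C, u = v ->
        plus (G := C_NormedModule) w (scal (K := C_AbsRing) (V := C_NormedModule) u c) = (w + c * v)%C).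
      { intros u v w c ->. change (w + v * c = w + c * v)%C. ring. }
      apply Hsc. apply pow_n_Cpow. }
  rewrite E in HN. exact HN.
Qed.

(** A term at z = s is the difference of two consecutive partial sums, which eventually lie within 1
    of the limit. *)
Lemma PS_coef_bound a f : PS a f -> coef_bound a.
Proof.
  intros H s Hs.
  assert (Hz : Cmod (RtoC s) < 1) by (rewrite Cmod_R, Rabs_pos_eq; lra).
  destruct (H _ Hz 1 Rlt_0_1) as [N HN].
  assert (B : forall n, (N <= n)%nat -> Cmod (a n) * s ^ n <= 2).
  { intros n Hn. pose proof (HN n Hn) as A1. pose proof (HN (S n) ltac:(lia)) as A2.
    unfold psum in *. cbn [csum] in A2.
    set (P := csum (fun k => a k * RtoC s ^ k)%C n) in *.
    assert (E : Cmod (a n * RtoC s ^ n) = Cmod (a n) * s ^ n).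
    { rewrite Cmod_mult, Cmod_pow, Cmod_R, Rabs_pos_eq; lra. }
    rewrite <- E. replace (a n * RtoC s ^ n)%C with ((P + a n * RtoC s ^ n - f (RtoC s)) + - (P - f (RtoC s)))%C by ring.
    eapply Rle_trans; [apply Cmod_triangle|]. rewrite Cmod_opp. lra. }
  assert (B' : forall N, exists M, forall n, (n < N)%nat -> Cmod (a n) * s ^ n <= M).
  { clear. induction N as [|N [M HM]].
    - exists 0. intros; lia.
    - exists (Rmax M (Cmod (a N) * s ^ N)). intros n Hn. destruct (Nat.eq_dec n N) as [->|].
      + apply Rmax_r.
      + eapply Rle_trans; [apply HM; lia|apply Rmax_l]. }
  destruct (B' N) as [M HM]. exists (Rmax M 2). intros n.
  destruct (le_lt_dec N n) as [Hn|Hn].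
  - eapply Rle_trans; [now apply B|apply Rmax_r].
  - eapply Rle_trans; [now apply HM|apply Rmax_l].
Qed.

Lemma pow_div_bound a s x M : (forall n, Cmod (a n) * s ^ n <= M) -> 0 < s -> 0 <= x ->
  forall n, Cmod (a n) * x ^ n <= M * (x / s) ^ n.
Proof.
  intros H Hs Hx n. unfold Rdiv. rewrite Rpow_mult_distr, pow_inv.
  assert (P : 0 < s ^ n) by now apply pow_lt.
  replace (Cmod (a n) * x ^ n) with (Cmod (a n) * s ^ n * (x ^ n * / s ^ n)) by (field; lra).
  apply Rmult_le_compat_r; auto. apply Rmult_le_pos; [now apply pow_le|left; now apply Rinv_0_lt_compat].
Qed.

Lemma rsum_sum_n (x : nat -> R) n : sum_n x n = rsum x (S n).
Proof.
  induction n as [|n IH].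
  - rewrite sum_O. simpl. ring.
  - rewrite sum_Sn, IH. reflexivity.
Qed.

(** Real series in each component give a total function, so that sums of derived sequences can be
    named before convergence is known. *)
Definition PSf (a : nat -> C) (z : C) : C :=
  (Series (fun k => Re (a k * z ^ k)%C), Series (fun k => Im (a k * z ^ k)%C)).

Lemma csum_pair f n : csum f n = (rsum (fun k => Re (f k)) n, rsum (fun k => Im (f k)) n).
Proof.
  induction n; [reflexivity|]. cbn [csum rsum]. rewrite IHn. unfold Cplus. cbn [fst snd]. reflexivity.
Qed.

Lemma Cmod_le_sum x y : Cmod (x, y) <= Rabs x + Rabs y.
Proof.
  replace ((x, y) : C) with (RtoC x + Ci * RtoC y)%C.
  - eapply Rle_trans; [apply Cmod_triangle|]. rewrite Cmod_mult, !Cmod_R, Cmod_Ci. lra.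
  - unfold Ci, Cplus, Cmult, RtoC. cbn [fst snd]. f_equal; ring.
Qed.

Lemma PSf_correct a : coef_bound a -> PS a (PSf a).
Proof.
  intros Ha z Hz. pose proof (Cmod_ge_0 z) as Hz0.
  destruct (Ha ((1 + Cmod z) / 2) ltac:(lra)) as [M HM].
  set (s := (1 + Cmod z) / 2) in *.
  assert (Hq : Rabs (Cmod z / s) < 1).
  { rewrite Rabs_pos_eq by (apply Rdiv_le_0_compat; unfold s; lra).
    apply Rmult_lt_reg_r with s; [unfold s; lra|]. unfold Rdiv. rewrite Rmult_assoc, Rinv_l; unfold s; lra. }
  assert (Hb : forall n, Cmod (a n * z ^ n) <= M * (Cmod z / s) ^ n).
  { intros n. rewrite Cmod_mult, Cmod_pow. apply (pow_div_bound a s (Cmod z) M); auto. unfold s; lra. }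
  assert (Hex : ex_series (fun n => M * (Cmod z / s) ^ n)).
  { apply (ex_series_scal (K := R_AbsRing) M (fun n => (Cmod z / s) ^ n)). now apply ex_series_geom. }
  assert (S1 : is_series (fun k => Re (a k * z ^ k)%C) (Series (fun k => Re (a k * z ^ k)%C))).
  { apply Series_correct. apply (ex_series_le (K := R_AbsRing) (V := R_CompleteNormedModule)) with (2 := Hex).
    intros n. eapply Rle_trans; [apply re_le_Cmod|apply Hb]. }
  assert (S2 : is_series (fun k => Im (a k * z ^ k)%C) (Series (fun k => Im (a k * z ^ k)%C))).
  { apply Series_correct. apply (ex_series_le (K := R_AbsRing) (V := R_CompleteNormedModule)) with (2 := Hex).
    intros n. eapply Rle_trans; [|apply Hb].
    pose proof (Rmax_Cmod (a n * z ^ n)%C) as Hm. eapply Rle_trans; [|exact Hm]. apply Rmax_r. }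
  apply cconv_unshift. intros e He.
  assert (He2 : 0 < e / 2) by lra.
  destruct (proj1 (filterlim_locally _ _) S1 (mkposreal _ He2)) as [N1 H1].
  destruct (proj1 (filterlim_locally _ _) S2 (mkposreal _ He2)) as [N2 H2].
  exists (max N1 N2). intros n Hn. specialize (H1 n ltac:(lia)). specialize (H2 n ltac:(lia)).
  rewrite rsum_sum_n in H1, H2.
  unfold psum, PSf. rewrite csum_pair.
  set (X := Series (fun k => Re (a k * z ^ k)%C)) in *. set (Y := Series (fun k => Im (a k * z ^ k)%C)) in *.
  change (Rabs (rsum (fun k => Re (a k * z ^ k)%C) (S n) - X) < e / 2) in H1.
  change (Rabs (rsum (fun k => Im (a k * z ^ k)%C) (S n) - Y) < e / 2) in H2.
  change (Cmod (rsum (fun k => Re (a k * z ^ k)%C) (S n) - X, rsum (fun k => Im (a k * z ^ k)%C) (S n) - Y) < e).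
  eapply Rle_lt_trans; [apply Cmod_le_sum|]. lra.
Qed.

Definition shift (a : nat -> C) (k : nat) : C := a (S k).
Definition dseq (a : nat -> C) (k : nat) : C := (RtoC (INR (S k)) * a (S k))%C.

(** Bernoulli's inequality for 1/q = 1 + h gives n h <= q^(-n). *)
Lemma n_pow_bound q : 0 < q < 1 -> exists B, forall n, INR n * q ^ n <= B.
Proof.
  intros Hq. set (h := / q - 1).
  assert (Hh : 0 < h). { unfold h. assert (1 < / q) by (rewrite <- Rinv_1; apply Rinv_lt_contravar; lra). lra. }
  exists (/ h). intros n. pose proof (poly n h Hh) as P.
  replace (1 + h) with (/ q) in P by (unfold h; ring). rewrite pow_inv in P.
  assert (Hqn : 0 < q ^ n) by (apply pow_lt; lra).
  apply Rmult_le_reg_r with (h * / q ^ n).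
  - apply Rmult_lt_0_compat; auto. now apply Rinv_0_lt_compat.
  - replace (INR n * q ^ n * (h * / q ^ n)) with (INR n * h) by (field; lra).
    replace (/ h * (h * / q ^ n)) with (/ q ^ n) by (field; lra). lra.
Qed.

Lemma coef_bound_shift a : coef_bound a -> coef_bound (shift a).
Proof.
  intros H s Hs. destruct (H s Hs) as [M HM]. exists (M / s). intros n. unfold shift.
  specialize (HM (S n)). simpl in HM.
  apply Rmult_le_reg_r with s; [lra|]. unfold Rdiv. rewrite Rmult_assoc, Rmult_assoc, Rinv_l by lra. lra.
Qed.

(** The factor n is paid for by a radius t strictly between s and 1, since n (s/t)^n is bounded. *)
Lemma coef_bound_mul_n a : coef_bound a -> coef_bound (fun k => RtoC (INR k) * a k)%C.
Proof.
  intros H s Hs. destruct (H ((1 + s) / 2) ltac:(lra)) as [M HM].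
  set (t := (1 + s) / 2) in *. assert (Ht : s < t < 1) by (unfold t; lra).
  assert (Hq : 0 < s / t < 1).
  { split; [apply Rdiv_lt_0_compat; lra|]. apply Rmult_lt_reg_r with t; [lra|].
    unfold Rdiv. rewrite Rmult_assoc, Rinv_l; lra. }
  destruct (n_pow_bound (s / t) Hq) as [B HB].
  assert (HM0 : 0 <= M).
  { eapply Rle_trans; [|apply (HM 0%nat)]. apply Rmult_le_pos; [apply Cmod_ge_0|apply pow_le; lra]. }
  exists (M * B). intros n. rewrite Cmod_mult, Cmod_R, Rabs_pos_eq by apply pos_INR.
  pose proof (pow_div_bound a t s M HM ltac:(lra) ltac:(lra) n) as P.
  specialize (HB n). pose proof (pos_INR n).
  rewrite Rmult_assoc. apply Rle_trans with (INR n * (M * (s / t) ^ n)).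
  - now apply Rmult_le_compat_l.
  - replace (INR n * (M * (s / t) ^ n)) with (M * (INR n * (s / t) ^ n)) by ring. now apply Rmult_le_compat_l.
Qed.

Lemma coef_bound_dseq a : coef_bound a -> coef_bound (dseq a).
Proof. intros H. exact (coef_bound_shift _ (coef_bound_mul_n a H)). Qed.

Definition pow_remainder (z w : C) (k : nat) : C := (w ^ k - z ^ k - RtoC (INR k) * (z ^ pred k * (w - z)))%C.

(** Induction on R_(k+1) = w R_k + k z^(k-1) (w - z)^2. Multiplication by p^2 avoids the exponent k
    - 2 for k < 2. *)
Lemma pow_remainder_bound z w p k : 0 < p -> Cmod z <= p -> Cmod w <= p ->
  p ^ 2 * Cmod (pow_remainder z w k) <= INR k ^ 2 * p ^ k * Cmod (w - z) ^ 2.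
Proof.
  intros Hp Hz Hw. induction k as [|k IH].
  - unfold pow_remainder. simpl INR. simpl. replace (1 - 1 - 0 * (1 * (w - z)))%C with (RtoC 0) by ring.
    rewrite Cmod_0. lra.
  - assert (E : pow_remainder z w (S k) = (w * pow_remainder z w k + RtoC (INR k) * (z ^ pred k * ((w - z) * (w - z))))%C).
    { unfold pow_remainder. rewrite S_INR, RtoC_plus. cbn [Nat.pred Cpow]. destruct k as [|k].
      - simpl. ring.
      - cbn [Nat.pred Cpow]. ring. }
    rewrite E. set (d := Cmod (w - z)) in *.
    assert (Hd : 0 <= d) by apply Cmod_ge_0.
    assert (T1 : Cmod (w * pow_remainder z w k) <= p * Cmod (pow_remainder z w k)).
    { rewrite Cmod_mult. apply Rmult_le_compat_r; [apply Cmod_ge_0|auto]. }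
    assert (T2 : p ^ 2 * Cmod (RtoC (INR k) * (z ^ pred k * ((w - z) * (w - z)))) <= INR k * p ^ S k * d ^ 2).
    { rewrite !Cmod_mult, Cmod_R, Cmod_pow, Rabs_pos_eq by apply pos_INR. fold d.
      destruct k as [|k]; [simpl; lra|]. cbn [Nat.pred].
      assert (Cmod z ^ k <= p ^ k) by (apply pow_incr; split; [apply Cmod_ge_0|auto]).
      replace (p ^ 2 * (INR (S k) * (Cmod z ^ k * (d * d)))) with (INR (S k) * p ^ 2 * d ^ 2 * Cmod z ^ k) by ring.
      replace (INR (S k) * p ^ S (S k) * d ^ 2) with (INR (S k) * p ^ 2 * d ^ 2 * p ^ k) by (simpl; ring).
      apply Rmult_le_compat_l; auto. pose proof (pos_INR (S k)).
      apply Rmult_le_pos; [apply Rmult_le_pos; auto|]; apply pow2_ge_0. }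
    eapply Rle_trans; [apply Rmult_le_compat_l; [apply pow2_ge_0|apply Cmod_triangle]|].
    rewrite Rmult_plus_distr_l.
    assert (T3 : p ^ 2 * Cmod (w * pow_remainder z w k) <= p * (INR k ^ 2 * p ^ k * d ^ 2)).
    { apply Rle_trans with (p * (p ^ 2 * Cmod (pow_remainder z w k))).
      - pose proof (pow2_ge_0 p). nra.
      - apply Rmult_le_compat_l; lra. }
    apply Rle_trans with (p * (INR k ^ 2 * p ^ k * d ^ 2) + INR k * p ^ S k * d ^ 2); [lra|].
    replace (p * (INR k ^ 2 * p ^ k * d ^ 2) + INR k * p ^ S k * d ^ 2) with ((INR k ^ 2 + INR k) * (p ^ S k * d ^ 2)) by (simpl; ring).
    replace (INR (S k) ^ 2 * p ^ S k * d ^ 2) with (INR (S k) ^ 2 * (p ^ S k * d ^ 2)) by ring.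
    apply Rmult_le_compat_r.
    + apply Rmult_le_pos; [apply pow_le; lra|apply pow2_ge_0].
    + rewrite S_INR. pose proof (pos_INR k). nra.
Qed.

Lemma Cmod_csum_le f (x : nat -> R) n : (forall k, Cmod (f k) <= x k) -> Cmod (csum f n) <= rsum x n.
Proof.
  intros H. induction n; cbn [csum rsum]; [rewrite Cmod_0; lra|].
  eapply Rle_trans; [apply Cmod_triangle|]. apply Rplus_le_compat; auto.
Qed.

Lemma rsum_geom_le q n : 0 <= q < 1 -> rsum (fun k => q ^ k) n <= / (1 - q).
Proof.
  intros Hq. assert (E : rsum (fun k => q ^ k) n = (1 - q ^ n) / (1 - q)).
  { induction n; cbn [rsum]; [simpl; field; lra|]. rewrite IHn. simpl. field. lra. }
  rewrite E. pose proof (pow_le q n ltac:(lra)). unfold Rdiv.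
  rewrite <- (Rmult_1_l (/ (1 - q))) at 2. apply Rmult_le_compat_r; [left; apply Rinv_0_lt_compat; lra|lra].
Qed.

(** Summed termwise, the remainder bounds give an error of at most B |w - z|^2 on the disk of radius
    p; their factors k^2 are absorbed by the larger radius s. *)
Lemma PS_cder a f f1 z : PS a f -> PS (dseq a) f1 -> Cmod z < 1 -> cder f z (f1 z).
Proof.
  intros Hf Hf1 Hz.
  pose proof (PS_coef_bound a f Hf) as Cb.
  pose proof (coef_bound_mul_n _ (coef_bound_mul_n _ Cb)) as Cb2.
  pose proof (Cmod_ge_0 z) as Hz0.
  set (p := (1 + Cmod z) / 2). set (s := (1 + p) / 2).
  assert (Hp : Cmod z < p < 1) by (unfold p; lra).
  assert (Hs : p < s < 1) by (unfold s; lra).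
  destruct (Cb2 s ltac:(lra)) as [M HM].
  assert (Hq : 0 <= p / s < 1).
  { split; [apply Rdiv_le_0_compat; lra|]. apply Rmult_lt_reg_r with s; [lra|].
    unfold Rdiv. rewrite Rmult_assoc, Rinv_l; lra. }
  set (B := / p ^ 2 * (M * / (1 - p / s))).
  assert (Hp2 : 0 < p ^ 2) by (apply pow_lt; lra).
  assert (HM0 : 0 <= M).
  { eapply Rle_trans; [|apply (HM 0%nat)]. apply Rmult_le_pos; [apply Cmod_ge_0|apply pow_le; lra]. }
  assert (HB : 0 <= B).
  { unfold B. apply Rmult_le_pos; [left; now apply Rinv_0_lt_compat|]. apply Rmult_le_pos; auto.
    left; apply Rinv_0_lt_compat; lra. }
  assert (Key : forall w, Cmod w <= p -> Cmod (f w - f z - f1 z * (w - z)) <= B * Cmod (w - z) ^ 2).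
  { intros w Hw.
    (* The differentiated series has lost its first term, so its n-th partial sum is paired with the
       next one of the original series. *)
    assert (L : cconv (fun n => psum a w (S n) + (- RtoC 1) * psum a z (S n) + (- (w - z)) * psum (dseq a) z n)%C
       (f w + (- RtoC 1) * f z + (- (w - z)) * f1 z)%C).
    { apply cconv_plus; [apply cconv_plus|].
      - apply cconv_shift, Hf. lra.
      - apply cconv_scal, cconv_shift, Hf. lra.
      - apply cconv_scal, Hf1. lra. }
    replace (f w - f z - f1 z * (w - z))%C with (f w + (- RtoC 1) * f z + (- (w - z)) * f1 z)%C by ring.
    apply (cconv_le _ _ _ 0%nat L). intros n _.
    assert (E : (psum a w (S n) + (- RtoC 1) * psum a z (S n) + (- (w - z)) * psum (dseq a) z n)%C =
       csum (fun k => a k * pow_remainder z w k)%C (S n)).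
    { unfold psum. rewrite !csum_S_left. unfold dseq, pow_remainder.
      transitivity (a 0%nat * w ^ 0 - a 0%nat * z ^ 0 + (csum (fun k => a (S k) * w ^ S k) n + (- RtoC 1) * csum (fun k => a (S k) * z ^ S k) n
         + (- (w - z)) * csum (fun k => RtoC (INR (S k)) * a (S k) * z ^ k) n))%C; [ring|].
      rewrite <- !csum_scal, <- !csum_plus. f_equal.
      - simpl INR. cbn [Cpow]. ring.
      - apply csum_ext. intros k _. cbn [Nat.pred]. ring. }
    rewrite E.
    eapply Rle_trans.
    - apply (Cmod_csum_le _ (fun k => (/ p ^ 2 * M * Cmod (w - z) ^ 2) * (p / s) ^ k)).
      intros k. rewrite Cmod_mult.
      pose proof (pow_remainder_bound z w p k ltac:(lra) ltac:(lra) Hw) as PB.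
      pose proof (pow_div_bound _ s p M HM ltac:(lra) ltac:(lra) k) as PD.
      cbv beta in PD. rewrite !Cmod_mult, !Cmod_R, !Rabs_pos_eq in PD by apply pos_INR.
      apply Rmult_le_reg_l with (p ^ 2); auto.
      replace (p ^ 2 * (/ p ^ 2 * M * Cmod (w - z) ^ 2 * (p / s) ^ k)) with (M * (p / s) ^ k * Cmod (w - z) ^ 2) by (field; lra).
      replace (p ^ 2 * (Cmod (a k) * Cmod (pow_remainder z w k))) with (Cmod (a k) * (p ^ 2 * Cmod (pow_remainder z w k))) by ring.
      eapply Rle_trans; [apply Rmult_le_compat_l; [apply Cmod_ge_0|exact PB]|].
      replace (Cmod (a k) * (INR k ^ 2 * p ^ k * Cmod (w - z) ^ 2)) with (INR k * (INR k * Cmod (a k)) * p ^ k * Cmod (w - z) ^ 2) by ring.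
      apply Rmult_le_compat_r; auto. apply pow2_ge_0.
    - rewrite rsum_scal. unfold B.
      replace (/ p ^ 2 * (M * / (1 - p / s)) * Cmod (w - z) ^ 2) with (/ p ^ 2 * M * Cmod (w - z) ^ 2 * / (1 - p / s)) by ring.
      apply Rmult_le_compat_l; [|now apply rsum_geom_le].
      apply Rmult_le_pos; [|apply pow2_ge_0]. apply Rmult_le_pos; auto. left; now apply Rinv_0_lt_compat. }
  intros e He. exists (Rmin (p - Cmod z) (e / (B + 1))). split.
  { apply Rmin_pos; [lra|]. apply Rdiv_lt_0_compat; lra. }
  intros w Hw.
  assert (H1 : Cmod (w - z) < p - Cmod z) by (eapply Rlt_le_trans; [exact Hw|apply Rmin_l]).
  assert (H2 : Cmod (w - z) < e / (B + 1)) by (eapply Rlt_le_trans; [exact Hw|apply Rmin_r]).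
  eapply Rle_trans; [apply Key|].
  - pose proof (Cmod_triangle_inv w z). lra.
  - apply Rmult_lt_compat_r with (r := B + 1) in H2; [|lra].
    unfold Rdiv in H2. rewrite Rmult_assoc, Rinv_l, Rmult_1_r in H2 by lra.
    pose proof (Cmod_ge_0 (w - z)). simpl. rewrite Rmult_1_r, <- Rmult_assoc. apply Rmult_le_compat_r; auto. nra.
Qed.

Lemma PSf_cder a z : coef_bound a -> Cmod z < 1 -> cder (PSf a) z (PSf (dseq a) z).
Proof. intros H Hz. apply (PS_cder a); auto; apply PSf_correct; auto using coef_bound_dseq. Qed.

Lemma PS_shift a f z : PS a f -> Cmod z < 1 -> f z = (a 0%nat + z * PSf (shift a) z)%C.
Proof.
  intros H Hz.
  assert (Hs : PS (shift a) (PSf (shift a))) by (apply PSf_correct, coef_bound_shift; eapply PS_coef_bound; eauto).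
  apply (cconv_unique (fun n => psum a z (S n))).
  - now apply cconv_shift, H.
  - apply cconv_ext with (fun n => a 0%nat + z * psum (shift a) z n)%C.
    + intros n. unfold psum. rewrite csum_S_left. rewrite <- csum_scal. f_equal; [simpl; ring|].
      apply csum_ext. intros k _. unfold shift. simpl. ring.
    + apply cconv_plus; [apply cconv_const|]. apply cconv_scal. now apply Hs.
Qed.

Lemma PSf_0 a : coef_bound a -> PSf a (RtoC 0) = a 0%nat.
Proof.
  intros H. rewrite (PS_shift a (PSf a)); [ring|now apply PSf_correct|rewrite Cmod_0; lra].
Qed.

(** * Square roots of nonvanishing functions *)

(** Reduction to the square [0, 2]^2: coordinates are translated by 1, and a radial retraction onto
    the disk makes the function continuous on the whole plane. *)
Lemma disk_bounded (phi : C -> R) rad : 0 < rad <= 1 ->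
  (forall z, Cmod z <= rad -> @continuous C_UniformSpace R_UniformSpace phi z) ->
  exists M, forall z, Cmod z <= rad -> phi z <= M.
Proof.
  intros HR H.
  set (mx := fun z : C => (rad + Cmod z + Rabs (rad - Cmod z)) / 2).
  assert (Hmx : forall z, mx z = Rmax rad (Cmod z)).
  { intros z. unfold mx, Rmax, Rabs. destruct Rcase_abs, Rle_dec; lra. }
  assert (Hmx0 : forall z, rad <= mx z /\ Cmod z <= mx z).
  { intros z. rewrite Hmx. split; [apply Rmax_l|apply Rmax_r]. }
  set (rt := fun z : C => (RtoC (rad / mx z) * z)%C).
  assert (Hrt : forall z, Cmod (rt z) <= rad).
  { intros z. unfold rt. destruct (Hmx0 z). rewrite Cmod_mult, Cmod_R, Rabs_pos_eq by (apply Rdiv_le_0_compat; lra).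
    apply Rmult_le_reg_r with (mx z); [lra|].
    replace (rad / mx z * Cmod z * mx z) with (rad * Cmod z) by (field; lra). apply Rmult_le_compat_l; lra. }
  assert (Hid : forall z, Cmod z <= rad -> rt z = z).
  { intros z Hz. unfold rt. rewrite Hmx, Rmax_left by auto. unfold Rdiv. rewrite Rinv_r by lra. ring. }
  set (sq := fun p : R * R => (fst p - 1, snd p - 1) : C).
  assert (Csq : forall p, ccont (X := R2) sq p).
  { intros [x y]. apply ccont_pair; (apply continuous_Rminus; [|apply continuous_const]);
      [apply continuous_fst|apply continuous_snd]. }
  destruct (cont2_bounded (fun p => phi (rt (sq p))) 2) as [M HM]; [lra| |].
  - intros p. apply (continuous_comp (U := R2) (V := C_UniformSpace) (fun p => rt (sq p)) phi); [|apply H, Hrt].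
    apply ccont_mult; [|apply Csq]. apply ccont_RtoC. apply continuous_Rmult; [apply continuous_const|].
    apply continuous_Rinv_comp; [|destruct (Hmx0 (sq p)); lra].
    assert (Cm : @continuous R2 R_UniformSpace (fun p => Cmod (sq p)) p) by (apply continuous_Cmod, Csq).
    unfold mx. apply continuous_Rmult; [|apply continuous_const].
    apply continuous_Rplus; [apply continuous_Rplus; [apply continuous_const|exact Cm]|].
    apply (continuous_Rcomp (X := R2) (fun p => rad - Cmod (sq p)) Rabs); [|apply Rcontinuity_abs].
    apply continuous_Rminus; [apply continuous_const|exact Cm].
  - exists M. intros z Hz.
    pose proof (Rmax_Cmod z) as Hc.
    assert (Hx : Rabs (fst z) <= 1) by (eapply Rle_trans; [apply Rmax_l|]; eapply Rle_trans; [exact Hc|lra]).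
    assert (Hy : Rabs (snd z) <= 1) by (eapply Rle_trans; [apply Rmax_r|]; eapply Rle_trans; [exact Hc|lra]).
    apply Rabs_le_between in Hx. apply Rabs_le_between in Hy.
    specialize (HM (fst z + 1) (snd z + 1) ltac:(lra) ltac:(lra)).
    unfold sq in HM. cbn [fst snd] in HM.
    replace (fst z + 1 - 1) with (fst z) in HM by ring. replace (snd z + 1 - 1) with (snd z) in HM by ring.
    rewrite <- surjective_pairing, Hid in HM; auto.
Qed.

(** Principal square root by the half-angle formulas; it is applied only in the right half-plane. *)
Definition psqrt (w : C) : C :=
  (sqrt ((Cmod w + Re w) / 2), Im w / (2 * sqrt ((Cmod w + Re w) / 2))).

Lemma psqrt_pos w : 0 < Re w -> 0 < sqrt ((Cmod w + Re w) / 2).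
Proof. intros H. apply sqrt_lt_R0. pose proof (Cmod_ge_0 w). lra. Qed.

Lemma psqrt_sq w : 0 < Re w -> (psqrt w * psqrt w)%C = w.
Proof.
  intros H. pose proof (psqrt_pos w H) as P. unfold psqrt.
  assert (E : sqrt ((Cmod w + Re w) / 2) * sqrt ((Cmod w + Re w) / 2) = (Cmod w + Re w) / 2).
  { apply sqrt_sqrt. pose proof (Cmod_ge_0 w). lra. }
  set (X := sqrt ((Cmod w + Re w) / 2)) in *.
  pose proof (Cmod_sqr w) as Q. pose proof (Cmod_ge_0 w).
  unfold Cmult. cbn [fst snd].
  apply injective_projections; cbn [fst snd]; change (fst w) with (Re w); change (snd w) with (Im w); [|field; lra].
  replace (Im w / (2 * X) * (Im w / (2 * X))) with (Im w * Im w / (4 * (X * X))) by (field; lra).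
  rewrite E. apply Rmult_eq_reg_r with (2 * (Cmod w + Re w)); [|lra].
  field_simplify; [|lra]. nra.
Qed.

Lemma psqrt_1 : psqrt (RtoC 1) = RtoC 1.
Proof.
  unfold psqrt. rewrite Cmod_1. cbn [Re Im fst snd RtoC].
  replace ((1 + 1) / 2) with 1 by field. rewrite sqrt_1. unfold RtoC. f_equal. field.
Qed.

Lemma psqrt_cont {X : UniformSpace} (f : X -> C) x : ccont f x -> 0 < Re (f x) -> ccont (fun y => psqrt (f y)) x.
Proof.
  intros Hf H. pose proof (psqrt_pos _ H) as P.
  assert (Cs : continuous (fun y => sqrt ((Cmod (f y) + Re (f y)) / 2)) x).
  { apply (continuous_Rcomp (fun y => (Cmod (f y) + Re (f y)) / 2) sqrt).
    - cts.
    - apply continuity_pt_sqrt. pose proof (Cmod_ge_0 (f x)). lra. }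
  apply ccont_pair; auto. apply continuous_Rmult; [now apply ccont_Im|].
  apply continuous_Rinv_comp; [|lra]. apply continuous_Rmult; auto. apply continuous_const.
Qed.

Fixpoint cprod (f : nat -> C) (n : nat) : C :=
  match n with O => RtoC 1 | S n => (cprod f n * f n)%C end.

(* The branch is a product of principal square roots of the ratios [P ((k+1) z/N) / P (k z/N)],
   all close to 1 once [N] is large. *)
Lemma sqrt_branch (P P1 : C -> C) rad : 0 < rad <= 1 ->
  (forall z, Cmod z <= rad -> cder P z (P1 z)) ->
  (forall z, Cmod z <= rad -> ccont (X := C_UniformSpace) P1 z) ->
  (forall z, Cmod z <= rad -> P z <> RtoC 0) -> P (RtoC 0) = RtoC 1 ->
  exists root : C -> C, root (RtoC 0) = RtoC 1 /\
    (forall z, Cmod z <= rad -> ccont (X := C_UniformSpace) root z) /\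
    (forall z, Cmod z <= rad -> (root z * root z)%C = P z).
Proof.
  intros HR HD HC HN H0.
  assert (CP : forall z, Cmod z <= rad -> ccont (X := C_UniformSpace) P z) by (intros; eapply cder_ccont; eauto).
  destruct (disk_bounded (fun z => Cmod (P1 z)) rad HR) as [L HL].
  { intros z Hz. apply continuous_Cmod. auto. }
  destruct (disk_bounded (fun z => / Cmod (P z)) rad HR) as [M HM].
  { intros z Hz. apply continuous_Rinv_comp; [apply continuous_Cmod; auto|].
    apply Rgt_not_eq, Cmod_gt_0. auto. }
  assert (Hz0 : Cmod 0 <= rad) by (rewrite Cmod_0; lra).
  assert (HL0 : 0 <= L) by (eapply Rle_trans; [apply Cmod_ge_0|apply (HL 0 Hz0)]).
  assert (HM0 : 0 <= M).
  { eapply Rle_trans; [|apply (HM 0 Hz0)]. left. apply Rinv_0_lt_compat, Cmod_gt_0. auto. }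
  (* L bounds |P'| and M bounds 1/|P|. With N > L M steps of length at most 1/N, every ratio differs
     from 1 by less than 1 and so has positive real part. *)
  destruct (archimed (L * M)) as [A _].
  assert (HA : 0 <= L * M) by now apply Rmult_le_pos.
  assert (Hz : (0 <= up (L * M))%Z) by (apply le_IZR; simpl; lra).
  set (N := Z.to_nat (up (L * M))).
  assert (HNN : INR N = IZR (up (L * M))) by (unfold N; rewrite INR_IZR_INZ, Z2Nat.id; auto).
  assert (HNp : 0 < INR N) by lra.
  set (pt := fun (k : nat) (z : C) => (RtoC (INR k / INR N) * z)%C).
  assert (Hpt : forall k z, (k <= N)%nat -> Cmod z <= rad -> Cmod (pt k z) <= rad).
  { intros k z Hk Hzz. unfold pt. apply le_INR in Hk. pose proof (pos_INR k). pose proof (Cmod_ge_0 z).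
    assert (0 <= INR k / INR N <= 1).
    { split; [apply Rdiv_le_0_compat; lra|]. apply Rmult_le_reg_r with (INR N); auto.
      unfold Rdiv. rewrite Rmult_assoc, Rinv_l; lra. }
    rewrite Cmod_mult, Cmod_R, Rabs_pos_eq by lra. nra. }
  set (q := fun (k : nat) (z : C) => (P (pt (S k) z) / P (pt k z))%C).
  assert (Hq : forall k z, (k < N)%nat -> Cmod z <= rad -> 0 < Re (q k z)).
  { intros k z Hk Hzz.
    pose proof (Hpt k z ltac:(lia) Hzz) as Hk0. pose proof (Hpt (S k) z ltac:(lia) Hzz) as Hk1.
    assert (B : Cmod (P (pt (S k) z) - P (pt k z)) <= L * Cmod (pt (S k) z - pt k z)).
    { apply (cmod_mean_value P P1). intros t Ht.
      assert (Hs : Cmod (seg (pt k z) (pt (S k) z) t) <= rad).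
      { unfold seg. replace (pt k z + t * (pt (S k) z - pt k z))%C with (RtoC (1 - t) * pt k z + RtoC t * pt (S k) z)%C by (rewrite RtoC_minus; ring).
        eapply Rle_trans; [apply Cmod_triangle|]. rewrite !Cmod_mult, !Cmod_R, !Rabs_pos_eq by lra.
        assert ((1 - t) * Cmod (pt k z) <= (1 - t) * rad) by (apply Rmult_le_compat_l; lra).
        assert (t * Cmod (pt (S k) z) <= t * rad) by (apply Rmult_le_compat_l; lra). lra. }
      split; auto. }
    assert (D : Cmod (pt (S k) z - pt k z) <= / INR N).
    { unfold pt. rewrite S_INR. replace (RtoC ((INR k + 1) / INR N) * z - RtoC (INR k / INR N) * z)%C with (RtoC (/ INR N) * z)%C.
      - rewrite Cmod_mult, Cmod_R, Rabs_pos_eq by (left; now apply Rinv_0_lt_compat).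
        rewrite <- (Rmult_1_r (/ INR N)) at 2. apply Rmult_le_compat_l; [left; now apply Rinv_0_lt_compat|lra].
      - replace ((INR k + 1) / INR N) with (INR k / INR N + / INR N) by (field; lra). rewrite RtoC_plus. ring. }
    assert (Ne : P (pt k z) <> RtoC 0) by auto.
    assert (Q : Cmod (q k z - 1) < 1).
    { unfold q. replace (P (pt (S k) z) / P (pt k z) - 1)%C with ((P (pt (S k) z) - P (pt k z)) / P (pt k z))%C by (field; auto).
      rewrite Cmod_div by auto. specialize (HM _ Hk0).
      assert (Ip : 0 < / Cmod (P (pt k z))) by (apply Rinv_0_lt_compat, Cmod_gt_0; auto).
      apply Rle_lt_trans with (L * / INR N * M).
      - unfold Rdiv. apply Rmult_le_compat; auto using Cmod_ge_0; [lra|].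
        eapply Rle_trans; [exact B|]. now apply Rmult_le_compat_l.
      - apply Rmult_lt_reg_r with (INR N); auto.
        replace (L * / INR N * M * INR N) with (L * M) by (field; lra). lra. }
    pose proof (re_le_Cmod (q k z - 1)) as RQ. apply Rabs_le_between in RQ.
    unfold Cminus in RQ. rewrite re_plus, re_opp in RQ. change (Re (RtoC 1)) with 1 in RQ.
    change (q k z + - RtoC 1)%C with (q k z - RtoC 1)%C in RQ. lra. }
  exists (fun z => cprod (fun k => psqrt (q k z)) N). split; [|split].
  - assert (E : forall n, cprod (fun k => psqrt (q k (RtoC 0))) n = RtoC 1).
    { induction n as [|n IH]; [reflexivity|]. cbn [cprod]. rewrite IH. unfold q, pt. rewrite !Cmult_0_r, H0.
      replace (RtoC 1 / RtoC 1)%C with (RtoC 1) by field. rewrite psqrt_1. ring. }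
    apply E.
  - intros z Hzz.
    assert (Cpt : forall k, ccont (X := C_UniformSpace) (fun z => pt k z) z).
    { intros k. apply ccont_mult; [apply ccont_const|apply ccont_id]. }
    assert (I : forall n, (n <= N)%nat -> ccont (X := C_UniformSpace) (fun z => cprod (fun k => psqrt (q k z)) n) z).
    { induction n as [|n IH]; intros Hn; cbn [cprod]; [apply ccont_const|].
      apply ccont_mult; [apply IH; lia|]. apply (psqrt_cont (X := C_UniformSpace) (fun z => q n z)); [|apply Hq; auto; lia].
      apply ccont_div.
      - apply (ccont_comp (X := C_UniformSpace) (fun z => pt (S n) z) P); auto.
      - apply (ccont_comp (X := C_UniformSpace) (fun z => pt n z) P); auto. apply CP, Hpt; auto; lia.
      - apply HN, Hpt; auto; lia. }
    now apply I.
  - intros z Hzz.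
    assert (I : forall n, (n <= N)%nat -> (cprod (fun k => psqrt (q k z)) n * cprod (fun k => psqrt (q k z)) n)%C = P (pt n z)).
    { induction n as [|n IH]; intros Hn; cbn [cprod].
      - unfold pt. simpl INR. unfold Rdiv. rewrite Rmult_0_l, Cmult_0_l, H0. ring.
      - transitivity ((cprod (fun k => psqrt (q k z)) n * cprod (fun k => psqrt (q k z)) n) * (psqrt (q n z) * psqrt (q n z)))%C; [ring|].
        rewrite IH by lia. rewrite psqrt_sq by (apply Hq; auto; lia). unfold q. field.
        apply HN, Hpt; auto; lia. }
    rewrite I by auto. unfold pt. unfold Rdiv. rewrite Rinv_r by lra. f_equal. ring.
Qed.

(** A continuous square root is differentiable: its difference quotient is that of P divided by root
    w + root z, which is nonzero near z. *)
Lemma sqrt_branch_cder (P P1 root : C -> C) rad : 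
  (forall z, Cmod z < rad -> cder P z (P1 z)) ->
  (forall z, Cmod z < rad -> P z <> RtoC 0) ->
  (forall z, Cmod z < rad -> ccont (X := C_UniformSpace) root z) ->
  (forall z, Cmod z < rad -> (root z * root z)%C = P z) ->
  forall z, Cmod z < rad -> cder root z (P1 z / (2 * root z)).
Proof.
  intros HD HN HC HS z Hz.
  assert (Sz : root z <> RtoC 0).
  { intros E. apply (HN z Hz). rewrite <- HS, E by auto. ring. }
  pose proof (HD z Hz) as D. apply cder_iff_slope in D. destruct D as [s [Cs [Es Hs]]].
  assert (Cp : ccont (X := C_UniformSpace) (fun w => root w + root z)%C z) by (apply ccont_plus; [auto|apply ccont_const]).
  assert (S2 : (root z + root z)%C <> RtoC 0).
  { replace (root z + root z)%C with (2 * root z)%C by ring. apply Cmult_neq_0; auto. apply RtoC_neq; lra. }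
  apply cder_iff_slope.
  exists (fun w => if Ceq_dec w z then (P1 z / (2 * root z))%C else ((root w - root z) / (w - z))%C).
  split; [|split].
  - apply ccont_ext_loc with (fun w => s w / (root w + root z))%C.
    + apply (filter_imp (fun w => (root w + root z)%C <> RtoC 0 /\ Cmod w < rad)).
      * intros w [Hw Hw2]. destruct (Ceq_dec w z) as [->|Hne].
        -- rewrite Es. replace (root z + root z)%C with (2 * root z)%C by ring. reflexivity.
        -- apply Csub_neq_0 in Hne.
           assert (E : (s w * (w - z) = (root w - root z) * (root w + root z))%C).
           { transitivity (P w - P z)%C; [rewrite (Hs w); ring|]. rewrite <- !HS by auto. ring. }
           replace (s w / (root w + root z))%C with (s w * (w - z) / ((root w + root z) * (w - z)))%C by (field; auto).
           rewrite E. field; auto.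
      * apply filter_and; [|now apply locally_disk]. now apply (ccont_neq_0 (fun w => root w + root z)%C).
    + now apply ccont_div.
  - destruct (Ceq_dec z z); congruence.
  - intros w. destruct (Ceq_dec w z) as [->|Hne]; [ring|]. field. now apply Csub_neq_0.
Qed.

(** * Application to the class S *)

(** The area inequality lives on circles of radius r < 1; letting r tend to 1 removes the powers of
    r. *)
Lemma limit_radius (T : R) n : (forall r, 0 < r < 1 -> r ^ n * T <= 1) -> T <= 1.
Proof.
  intros H. destruct (Rle_or_lt T 1) as [|HT]; auto. exfalso.
  assert (Cp : continuity_pt (fun r => r ^ n * T) 1).
  { apply continuity_pt_filterlim.
    apply (continuous_Rmult (X := R_UniformSpace) (fun r => r ^ n) (fun _ => T)); [|apply continuous_const].
    apply (continuous_pow_comp (X := R_UniformSpace) (fun r => r)), continuous_id. }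
  destruct (Cp ((T - 1) / 2) ltac:(lra)) as [d [Hd Hx]].
  set (r := 1 - Rmin (d / 2) (1 / 2)).
  assert (M1 : Rmin (d / 2) (1 / 2) <= d / 2) by apply Rmin_l.
  assert (M2 : Rmin (d / 2) (1 / 2) <= 1 / 2) by apply Rmin_r.
  assert (M3 : 0 < Rmin (d / 2) (1 / 2)) by (apply Rmin_pos; lra).
  assert (Hr : 0 < r < 1) by (unfold r; lra).
  specialize (H r Hr). specialize (Hx r). simpl in Hx. unfold Rdist in Hx.
  rewrite pow1 in Hx. assert (A : Rabs (r ^ n * T - 1 * T) < (T - 1) / 2).
  { apply Hx. split; [split; [exact I|lra]|]. rewrite Rabs_left; unfold r; lra. }
  apply Rabs_lt_between in A. lra.
Qed.

Lemma csq_disk z rad : rad <= 1 -> Cmod z < rad -> Cmod (z * z) < rad.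
Proof. intros H Hz. rewrite Cmod_mult. pose proof (Cmod_ge_0 z). nra. Qed.

Ltac ccont_poly :=
  repeat match goal with
  | |- ccont (fun t => Cplus (@?u t) (@?v t)) _ => apply (ccont_plus u v)
  | |- ccont (fun t => Cminus (@?u t) (@?v t)) _ => apply (ccont_minus u v)
  | |- ccont (fun t => Cmult (@?u t) (@?v t)) _ => apply (ccont_mult u v)
  | |- ccont (fun t => Cdiv (@?u t) ?c) _ => apply (ccont_mult u (fun _ => Cinv c))
  | |- ccont (fun t => t) _ => apply ccont_id
  | |- ccont (fun _ => ?c) _ => apply ccont_const
  | H : ccont ?G ?x |- ccont (fun t => ?G t) ?x => exact H
  end.

Section Coefficients.
Variables (f : C -> C) (a : nat -> C).
Hypothesis Hf : PS a f.
Hypothesis Hinj : forall z w, Cmod z < 1 -> Cmod w < 1 -> f z = f w -> z = w.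
Hypothesis a_0 : a 0%nat = RtoC 0.
Hypothesis a_1 : a 1%nat = RtoC 1.
Hypothesis a_2 : a 2%nat = RtoC 0.

Let cb : coef_bound a.
Proof. exact (PS_coef_bound a f Hf). Qed.
(** P is f(z)/z. As a_2 = 0, P = 1 + z^2 P3, where P3 starts with a_3 and its tail P5 with a_5. *)
Let P := PSf (shift a).
Let P3 := PSf (shift (shift (shift a))).
Let P5 := PSf (shift (shift (shift (shift (shift a))))).

Lemma zero_in_disk : Cmod (RtoC 0) < 1.
Proof. rewrite Cmod_0. lra. Qed.

Lemma PSf_shift b z : coef_bound b -> Cmod z < 1 -> PSf b z = (b 0%nat + z * PSf (shift b) z)%C.
Proof. intros Hb Hz. apply PS_shift; auto. now apply PSf_correct. Qed.

Lemma f_eq z : Cmod z < 1 -> f z = (z * P z)%C.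
Proof. intros Hz. rewrite (PS_shift a f z Hf Hz), a_0. unfold P. ring. Qed.

Lemma P_eq z : Cmod z < 1 -> P z = (1 + z * z * P3 z)%C.
Proof.
  intros Hz. unfold P, P3. rewrite PSf_shift by auto using coef_bound_shift.
  rewrite PSf_shift by auto using coef_bound_shift. unfold shift at 1 2 3. rewrite a_1, a_2. ring.
Qed.

Lemma P3_eq z : Cmod z < 1 -> P3 z = (a 3%nat + z * (a 4%nat + z * P5 z))%C.
Proof.
  intros Hz. unfold P3, P5. rewrite PSf_shift by auto using coef_bound_shift.
  rewrite PSf_shift by auto using coef_bound_shift. reflexivity.
Qed.

Lemma PSf_cont b z : coef_bound b -> Cmod z < 1 -> ccont (X := C_UniformSpace) (PSf b) z.
Proof. intros Hb Hz. eapply cder_ccont. now apply PSf_cder. Qed.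

Lemma P_neq_0 z : Cmod z < 1 -> P z <> RtoC 0.
Proof.
  intros Hz E. destruct (Ceq_dec z (RtoC 0)) as [->|H].
  - rewrite P_eq in E by auto. replace (1 + 0 * 0 * P3 0)%C with (RtoC 1) in E by ring.
    apply RtoC_inj in E. lra.
  - apply H. apply Hinj; auto using zero_in_disk. rewrite !f_eq by auto using zero_in_disk. rewrite E. ring.
Qed.

(** The area inequality for f with a single coefficient: 1/z - 1/f(z) = z P3/(1 + z^2 P3), so b_1 =
    a_3. *)
Lemma a3_bound : Cmod (a 3%nat) <= 1.
Proof.
  apply (limit_radius _ 2). intros r Hr.
  assert (Hd : forall z, Cmod z < 1 -> (1 + z * z * P3 z)%C <> RtoC 0).
  { intros z Hz. rewrite <- P_eq by auto. now apply P_neq_0. }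
  assert (A : rsum (area_term r (fun _ => a 3%nat)) 1 <= 1).
  { apply (area_inequality f (PSf (dseq a)) (PSf (dseq (dseq a))) 1 r) with
      (g := fun z => (P3 z / (1 + z * z * P3 z) - a 3%nat)%C).
    - intros z Hz. apply (PS_cder a); auto. now apply PSf_correct, coef_bound_dseq.
    - intros z Hz. apply PSf_cder; auto using coef_bound_dseq.
    - intros z Hz. apply PSf_cont; auto using coef_bound_dseq.
    - exact Hinj.
    - rewrite f_eq by apply zero_in_disk. ring.
    - rewrite PSf_0 by now apply coef_bound_dseq. unfold dseq. rewrite a_1. simpl. ring.
    - exact Hr.
    - intros z Hz. assert (Hz0 : z <> RtoC 0) by (apply Cmod_gt_0; lra).
      unfold hfun. rewrite f_eq, P_eq by lra. cbn [csum Cpow]. field. split; auto. apply Hd. lra.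
    - assert (C3 : ccont (X := C_UniformSpace) P3 (RtoC 0)) by (apply PSf_cont; auto using coef_bound_shift, zero_in_disk).
      apply ccont_minus; [|apply ccont_const]. apply ccont_div; auto using zero_in_disk.
      apply ccont_plus; [apply ccont_const|]. apply ccont_mult; auto. apply ccont_mult; apply ccont_id.
    - rewrite P3_eq by apply zero_in_disk. field. }
  unfold area_term in A. cbn [rsum] in A. simpl INR in A.
  replace (0 + 1 * (r ^ 2 * Cmod (a 3%nat)) ^ 2) with ((r ^ 2 * Cmod (a 3%nat)) * (r ^ 2 * Cmod (a 3%nat))) in A by ring.
  assert (0 <= r ^ 2 * Cmod (a 3%nat)) by (apply Rmult_le_pos; [apply pow2_ge_0|apply Cmod_ge_0]). nra.
Qed.

Lemma P5_0 : P5 (RtoC 0) = a 5%nat.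
Proof. unfold P5. now rewrite PSf_0 by (repeat apply coef_bound_shift; auto). Qed.

Let Bq (t : C) : C := (a 3%nat + t * a 4%nat + t * t * a 5%nat)%C.
Let kq : C := (3 / 8 * (a 3%nat * a 3%nat))%C.
(** 1/sqrt P through order t^4, from 1 - x/2 + 3 x^2/8 with x = t^2 [Bq] t; only the leading part
    [kq] t^4 of the quadratic term reaches that order. *)
Let Vq (t : C) : C := (1 - t * t * Bq t / 2 + kq * (t * t * t * t))%C.
(** The quotient (V^2 P - 1)/t^4 in closed form. It vanishes at 0 because 2 [kq] = 3/4 a_3^2, which
    is where the 3/8 in [kq] comes from. *)
Let wq (t : C) : C := (2 * kq - 3 / 4 * (Bq t * Bq t) + t * t * (kq * Bq t + Bq t * Bq t * Bq t / 4)
   + t * t * t * t * (kq * kq - kq * Bq t * Bq t) + t * t * t * t * t * t * (kq * kq * Bq t)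
   + Vq t * Vq t * (P5 t - a 5%nat))%C.

Lemma V_sq_P t : Cmod t < 1 -> (Vq t * Vq t * P t = 1 + t * t * t * t * wq t)%C.
Proof.
  intros Ht. rewrite P_eq, P3_eq by auto. unfold wq, Vq, Bq. field.
Qed.

(** Read off from (1 - V(z^2))/z. Even indices vanish because the root transform is odd, and b_1 =
    a_2/2 vanishes with a_2. *)
Definition root_coef (j : nat) : C :=
  match j with
  | 3%nat => (a 3%nat / 2)%C
  | 5%nat => (a 4%nat / 2)%C
  | 7%nat => (a 5%nat / 2 - kq)%C
  | _ => RtoC 0
  end.

Lemma root_transform_area :
  3 * Cmod (a 3%nat / 2) ^ 2 + 5 * Cmod (a 4%nat / 2) ^ 2 + 7 * Cmod (a 5%nat / 2 - 3 / 8 * (a 3%nat * a 3%nat)) ^ 2 <= 1.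
Proof.
  apply (limit_radius _ 16). intros r Hr.
  (* The square root is built on a closed disk of radius [rad] < 1 that still contains the circle of
     radius r in its interior. *)
  set (rad := (1 + r) / 2). assert (Hrad : r < rad < 1) by (unfold rad; lra).
  set (P1 := PSf (dseq (shift a))). set (P2 := PSf (dseq (dseq (shift a)))).
  assert (cbs : coef_bound (shift a)) by now apply coef_bound_shift.
  assert (cbd : coef_bound (dseq (shift a))) by now apply coef_bound_dseq.
  assert (cbd2 : coef_bound (dseq (dseq (shift a)))) by now apply coef_bound_dseq.
  assert (P_at_0 : P (RtoC 0) = RtoC 1) by (rewrite P_eq by apply zero_in_disk; ring).
  destruct (sqrt_branch P P1 rad) as [S0 [S00 [S0c S0sq]]]; try lra; auto.
  { intros z Hz. apply PSf_cder; auto. lra. }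
  { intros z Hz. apply PSf_cont; auto. lra. }
  { intros z Hz. apply P_neq_0. lra. }
  assert (Sne : forall z, Cmod z < rad -> S0 z <> RtoC 0).
  { intros z Hz E. apply (P_neq_0 z); [lra|]. rewrite <- S0sq, E by lra. ring. }
  set (S1 := fun z => (P1 z / (2 * S0 z))%C).
  set (S2 := fun z => ((P2 z * (2 * S0 z) - P1 z * (2 * S1 z)) / ((2 * S0 z) * (2 * S0 z)))%C).
  assert (S2ne : forall z, Cmod z < rad -> (2 * S0 z)%C <> RtoC 0).
  { intros z Hz. apply Cmult_neq_0; auto. apply RtoC_neq. lra. }
  assert (DS : forall z, Cmod z < rad -> cder S0 z (S1 z)).
  { intros z Hz. apply (sqrt_branch_cder P P1 S0 rad); auto.
    - intros w Hw. apply PSf_cder; auto. lra.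
    - intros w Hw. apply P_neq_0. lra.
    - intros w Hw. apply S0c. lra.
    - intros w Hw. apply S0sq. lra. }
  assert (DS1 : forall z, Cmod z < rad -> cder S1 z (S2 z)).
  { intros z Hz. unfold S1. eapply cder_eq.
    - apply cder_div; [apply PSf_cder; auto; lra| |now apply S2ne].
      apply cder_mult; [apply cder_const|now apply DS].
    - cbv beta. unfold S2. f_equal. fold P2. unfold P2, P1. ring. }
  assert (CS2 : forall z, Cmod z < rad -> ccont (X := C_UniformSpace) S2 z).
  { intros z Hz. assert (K0 : ccont (X := C_UniformSpace) (fun z => 2 * S0 z)%C z).
    { cts. }
    assert (K1 : ccont (X := C_UniformSpace) (fun z => 2 * S1 z)%C z).
    { apply ccont_mult; [apply ccont_const|]. eapply cder_ccont; now apply DS1. }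
    apply ccont_div; [apply ccont_minus|now apply ccont_mult|apply Cmult_neq_0; now apply S2ne].
    - apply ccont_mult; auto. apply PSf_cont; auto; lra.
    - apply ccont_mult; auto. apply PSf_cont; auto; lra. }
  set (F := fun z => (z * S0 (z * z))%C).
  set (F1 := fun z => (S0 (z * z) + 2 * (z * z) * S1 (z * z))%C).
  set (F2 := fun z => (6 * z * S1 (z * z) + 4 * (z * z * z) * S2 (z * z))%C).
  assert (Dsq : forall z, cder (fun z => z * z)%C z (2 * z)).
  { intros z. eapply cder_eq; [apply cder_mult; apply cder_id|]. cbv beta; ring. }
  assert (Hsq : forall z, Cmod z < rad -> Cmod (z * z) < rad) by (intros; apply csq_disk; lra).
  assert (DSsq : forall G G1, (forall z, Cmod z < rad -> cder G z (G1 z)) -> forall z, Cmod z < rad ->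
     cder (fun z => G (z * z)%C) z (G1 (z * z) * (2 * z))%C).
  { intros G G1 HG z Hz. apply (cder_comp G (fun z => z * z)%C); auto. }
  assert (dF : forall z, Cmod z < rad -> cder F z (F1 z)).
  { intros z Hz. eapply cder_eq.
    - apply cder_mult; [apply cder_id|]. now apply (DSsq S0 S1).
    - unfold F1. cbv beta. ring. }
  assert (dF1 : forall z, Cmod z < rad -> cder F1 z (F2 z)).
  { intros z Hz. eapply cder_eq.
    - apply cder_plus; [now apply (DSsq S0 S1)|].
      apply cder_mult; [apply cder_mult; [apply cder_const|apply Dsq]|now apply (DSsq S1 S2)].
    - unfold F2. cbv beta. ring. }
  assert (cF2 : forall z, Cmod z < rad -> ccont (X := C_UniformSpace) F2 z).
  { intros z Hz.
    assert (Ksq : ccont (X := C_UniformSpace) (fun z => z * z)%C z) by (apply ccont_mult; apply ccont_id).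
    apply ccont_plus.
    - apply ccont_mult; [apply ccont_mult; [apply ccont_const|apply ccont_id]|].
      apply (ccont_comp (X := C_UniformSpace) (fun z => z * z)%C S1); auto. eapply cder_ccont. apply DS1. auto.
    - apply ccont_mult.
      + cts.
      + apply (ccont_comp (X := C_UniformSpace) (fun z => z * z)%C S2); auto. }
  assert (Fsq : forall z, Cmod z < rad -> (F z * F z)%C = f (z * z)).
  { intros z Hz. pose proof (Hsq z Hz). rewrite f_eq, <- S0sq by lra. unfold F. ring. }
  (* Since F(z)^2 = f(z^2), equal values force z^2 = w^2; then S0 agrees at both squares, and F z =
     F w itself settles the sign. *)
  assert (injF : forall z w, Cmod z < rad -> Cmod w < rad -> F z = F w -> z = w).
  { intros z w Hz Hw E.
    assert (E2 : (z * z)%C = (w * w)%C).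
    { pose proof (Hsq z Hz). pose proof (Hsq w Hw). apply Hinj; try lra. rewrite <- !Fsq by auto. now rewrite E. }
    unfold F in E. rewrite E2 in E. pose proof (Sne _ (Hsq w Hw)) as N.
    replace z with (z * S0 (w * w) / S0 (w * w))%C by (field; auto). rewrite E. field. auto. }
  (* Normalized remainder of 1/S0 after V. It is continuous at 0 because (1/S0 - V)(1/S0 + V) = (1 -
     V^2 P)/P = -t^4 w/P and the second factor tends to 2. *)
  set (v := fun t => if Ceq_dec t (RtoC 0) then RtoC 0 else ((/ S0 t - Vq t) / (t * t * t * t))%C).
  assert (Crad : Cmod (RtoC 0) < rad) by (rewrite Cmod_0; lra).
  assert (V0 : Vq (RtoC 0) = RtoC 1) by (unfold Vq; field).
  assert (w0 : wq (RtoC 0) = RtoC 0).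
  { unfold wq. rewrite P5_0. unfold Bq, kq. field. }
  assert (CB : ccont (X := C_UniformSpace) Bq (RtoC 0)).
  { unfold Bq. ccont_poly. }
  assert (CV : ccont (X := C_UniformSpace) Vq (RtoC 0)).
  { unfold Vq. ccont_poly. }
  assert (Cw : ccont (X := C_UniformSpace) wq (RtoC 0)).
  { assert (CP5 : ccont (X := C_UniformSpace) P5 (RtoC 0)).
    { apply PSf_cont; [repeat apply coef_bound_shift; auto|apply zero_in_disk]. }
    unfold wq. ccont_poly. }
  assert (Cden : ccont (X := C_UniformSpace) (fun t => / S0 t + Vq t)%C (RtoC 0)).
  { apply ccont_plus; auto. apply ccont_inv; [apply S0c; lra|]. rewrite S00. apply RtoC_neq; lra. }
  assert (Nden : (/ S0 (RtoC 0) + Vq (RtoC 0))%C <> RtoC 0).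
  { rewrite S00, V0. replace (/ RtoC 1 + RtoC 1)%C with (RtoC 2) by field. apply RtoC_neq; lra. }
  assert (CPz : ccont (X := C_UniformSpace) P (RtoC 0)) by (apply PSf_cont; auto using zero_in_disk).
  assert (Cv : ccont (X := C_UniformSpace) v (RtoC 0)).
  { apply ccont_ext_loc with (fun t => - wq t / (P t * (/ S0 t + Vq t)))%C.
    - apply (filter_imp (fun t => (/ S0 t + Vq t)%C <> RtoC 0 /\ Cmod t < rad)).
      + intros t [Nt Ht]. unfold v. destruct (Ceq_dec t (RtoC 0)) as [->|Ht0].
        * rewrite w0. unfold Cdiv. ring.
        * assert (NP : P t <> RtoC 0) by (apply P_neq_0; lra).
          pose proof (Sne t Ht) as NS.
          assert (E : (t * t * t * t * wq t)%C = (Vq t * Vq t * P t - 1)%C) by (rewrite V_sq_P by lra; ring).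
          assert (EX : (RtoC 1 = S0 t * S0 t * (/ S0 t * / S0 t))%C) by (field; auto).
          set (X := (/ S0 t)%C) in *. clearbody X.
          replace (- wq t / (P t * (X + Vq t)))%C with
            (- (t * t * t * t * wq t) / (t * t * t * t * (P t * (X + Vq t))))%C by (field; auto).
          rewrite E. rewrite <- S0sq in NP |- * by lra.
          replace (- (Vq t * Vq t * (S0 t * S0 t) - 1))%C with ((S0 t * S0 t) * ((X - Vq t) * (X + Vq t)))%C.
          -- field. auto.
          -- rewrite EX at 1. ring.
      + apply filter_and; [now apply (ccont_neq_0 (fun t => / S0 t + Vq t)%C)|now apply locally_disk].
    - apply ccont_div; [now apply ccont_opp|now apply ccont_mult|].
      apply Cmult_neq_0; auto. apply P_neq_0, zero_in_disk. }
  assert (v0 : v (RtoC 0) = RtoC 0) by (unfold v; destruct (Ceq_dec (RtoC 0) (RtoC 0)); congruence).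
  (* With t = z^2 the remainder t^4 v(t), divided by z, becomes z^7 v(z^2); this fixes K = 7. *)
  assert (A : rsum (area_term r root_coef) 7 <= 1).
  { apply (area_inequality F F1 F2 rad r) with (g := fun z => (- v (z * z))%C); auto.
    - unfold F. ring.
    - unfold F1. rewrite !Cmult_0_l, S00. ring.
    - lra.
    - intros z Hz. assert (Hz0 : z <> RtoC 0) by (apply Cmod_gt_0; lra).
      assert (Ht0 : (z * z)%C <> RtoC 0) by now apply Cmult_neq_0.
      unfold hfun, F, v. destruct (Ceq_dec (z * z) (RtoC 0)); [congruence|].
      pose proof (Sne _ (Hsq z ltac:(lra))) as NS.
      unfold Vq, Bq. cbn [csum root_coef Cpow]. field. auto.
    - apply ccont_opp. apply (ccont_comp (X := C_UniformSpace) (fun z => z * z)%C v).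
      + apply ccont_mult; apply ccont_id.
      + rewrite Cmult_0_l. exact Cv.
    - rewrite Cmult_0_l, v0. ring. }
  unfold area_term in A. cbn [rsum root_coef] in A. rewrite Cmod_0 in A.
  fold kq. set (x := Cmod (a 3%nat / 2)) in *. set (y := Cmod (a 4%nat / 2)) in *. set (u := Cmod (a 5%nat / 2 - kq)) in *.
  simpl INR in A.
  (* The terms carry r^8, r^12 and r^16; all are lowered to r^16 so that one common factor can be
     sent to 1. *)
  assert (R12 : 0 < r ^ 4 <= 1) by (split; [apply pow_lt; lra|rewrite <- (pow1 4); apply pow_incr; lra]).
  assert (R8 : r ^ 16 <= r ^ 12 /\ r ^ 16 <= r ^ 8).
  { assert (0 < r ^ 8) by (apply pow_lt; lra). assert (0 < r ^ 12) by (apply pow_lt; lra).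
    replace (r ^ 16) with (r ^ 12 * r ^ 4) at 1 by ring. 
    replace (r ^ 16) with (r ^ 8 * (r ^ 4 * r ^ 4)) by ring. split; nra. }
  assert (A' : 3 * (r ^ 8 * x ^ 2) + 5 * (r ^ 12 * y ^ 2) + 7 * (r ^ 16 * u ^ 2) <= 1).
  { eapply Rle_trans; [|exact A]. right. ring. }
  pose proof (pow2_ge_0 x). pose proof (pow2_ge_0 y). pose proof (pow2_ge_0 u).
  destruct R8 as [R8a R8b].
  apply Rmult_le_compat_r with (r := y ^ 2) in R8a; auto.
  apply Rmult_le_compat_r with (r := x ^ 2) in R8b; auto. lra.
Qed.
End Coefficients.

(** * Numerical bounds and the final estimates *)

Lemma sqrt7_bounds : 2.645751 < sqrt 7 < 2.645752.
Proof.
  split.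
  - rewrite <- (sqrt_pow2 2.645751) by lra. apply sqrt_lt_1; lra.
  - rewrite <- (sqrt_pow2 2.645752) by lra. apply sqrt_lt_1; lra.
Qed.

Lemma c_1_bounds : 1.026 <= c_1 < 1.027.
Proof.
  pose proof sqrt7_bounds as H7.
  destruct c_1_is_max as [[y [Hy <-]] Hmax]. split.
  (* 2/7 is a rational point close to the maximizer, which lies near 0.2867. *)
  - eapply Rle_trans; [|apply (Hmax (2 / 7)); lra].
    unfold c_1_fun.
    assert (Hs : 0.8689 < sqrt (1 - 3 * (2 / 7) ^ 2)).
    { rewrite <- (sqrt_pow2 0.8689) by lra. apply sqrt_lt_1; lra. }
    assert (Hi : 1.5118 < 4 / sqrt 7).
    { apply Rmult_lt_reg_r with (sqrt 7); [lra|]. unfold Rdiv. rewrite Rmult_assoc, Rinv_l; lra. }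
    set (s := sqrt (1 - 3 * (2 / 7) ^ 2)) in *. set (i := 4 / sqrt 7) in *. nra.
  - unfold c_1_fun.
    assert (Hi : 0 < 4 / sqrt 7 < 1.51186).
    { split; [apply Rdiv_lt_0_compat; lra|].
      apply Rmult_lt_reg_r with (sqrt 7); [lra|]. unfold Rdiv. rewrite Rmult_assoc, Rinv_l; lra. }
    assert (Hp : 0 <= 1 - 3 * y ^ 2) by nra.
    set (s := sqrt (1 - 3 * y ^ 2)).
    assert (Hs0 : 0 <= s) by apply sqrt_pos.
    assert (Hs2 : s * s = 1 - 3 * y ^ 2) by now apply sqrt_sqrt.
    set (i := 4 / sqrt 7) in *.
    (* Tangent bound s <= (s^2 + c^2)/(2 c) with c = 0.868, approximately the value of s at the
       maximizer; it leaves a polynomial in y. *)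
    assert (Hs : s <= (1 - 3 * y ^ 2 + 0.868 * 0.868) / (2 * 0.868)).
    { pose proof (pow2_ge_0 (s - 0.868)). nra. }
    assert (Hiy : i * y * s <= 1.51186 * (y * ((1 - 3 * y ^ 2 + 0.868 * 0.868) / (2 * 0.868)))).
    { rewrite Rmult_assoc. apply Rmult_le_compat; [lra|apply Rmult_le_pos; lra|lra|].
      apply Rmult_le_compat_l; lra. }
    (* tangent to [y ^ 3] near the maximizer *)
    assert (Ht : 0 <= (y - 0.2867) ^ 2 * (y + 2 * 0.2867)) by (apply Rmult_le_pos; [apply pow2_ge_0|lra]).
    pose proof (pow2_ge_0 (y - 0.2867)). nra.
Qed.

(** For s <= 1/2 the bound 3 y^2 <= 3/4 suffices. For s > 1/2 one has 3 y^2 <= 1 - s^2, and 1 - s^2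
    + 2 s/sqrt 7 decreases there because 1/sqrt 7 < 1/2. Both cases meet at s = y = 1/2, the origin
    of the constant. *)
Lemma a5_estimate x5 s y : 0 <= s -> 0 <= y <= 1 / 2 -> 3 * y ^ 2 + s ^ 2 <= 1 ->
  x5 <= 2 / sqrt 7 * s + 3 * y ^ 2 -> x5 <= 3 / 4 + 1 / sqrt 7.
Proof.
  intros Hs Hy H Hx. pose proof sqrt7_bounds as H7.
  assert (Hi : 0 < / sqrt 7 < 1 / 2).
  { split; [apply Rinv_0_lt_compat; lra|]. apply Rmult_lt_reg_r with (sqrt 7); [lra|]. rewrite Rinv_l; lra. }
  unfold Rdiv in *. set (i := / sqrt 7) in *. destruct (Rle_or_lt s (1 / 2)); nra.
Qed.

Theorem theorem4 (f : C -> C) (a : nat -> C)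
    (hS : class_S f) (hfa : normalized_expansion f a)
    (ha2 : a 2%nat = RtoC 0) :
  (Cmod (a 5%nat) <= 3 / 4 + 1 / sqrt 7 /\
   1.12796 <= 3 / 4 + 1 / sqrt 7 < 1.12797) /\
  (Cmod (hankel3 a) <= c_1 /\ 1.026 <= c_1 < 1.027).
Proof.
  destruct hfa as [a_0 [a_1 Hexp]].
  assert (Hf : PS a f) by (intros z Hz; apply is_pseries_cconv, Hexp, Hz).
  assert (Hinj : forall z w, Cmod z < 1 -> Cmod w < 1 -> f z = f w -> z = w)
    by (intros z w Hz Hw; apply (S_univalent f hS); assumption).
  pose proof (a3_bound f a Hf Hinj a_0 a_1 ha2) as B3.
  pose proof (root_transform_area f a Hf Hinj a_0 a_1 ha2) as A.
  pose proof sqrt7_bounds as H7. pose proof c_1_bounds as Hc.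
  set (b3 := (a 3%nat / 2)%C) in *. set (b5 := (a 4%nat / 2)%C) in *.
  set (b7 := (a 5%nat / 2 - 3 / 8 * (a 3%nat * a 3%nat))%C) in *.
  assert (E3 : a 3%nat = (2 * b3)%C) by (unfold b3; field).
  assert (E4 : a 4%nat = (2 * b5)%C) by (unfold b5; field).
  assert (E5 : a 5%nat = (2 * b7 + 3 * (b3 * b3))%C) by (unfold b7, b3; field).
  (* The bound |a_3| <= 1 becomes 2 |b_3| <= 1. *)
  rewrite E3, Cmod_mult, Cmod_R, Rabs_pos_eq in B3 by lra.
  pose proof (Cmod_ge_0 b3) as P3. pose proof (Cmod_ge_0 b5) as P5. pose proof (Cmod_ge_0 b7) as P7.
  set (y := Cmod b3) in *. set (u := Cmod b5) in *.
  (* This scaling turns the root inequality into 3 y^2 + 5 u^2 + s^2 <= 1. *)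
  set (s := sqrt 7 * Cmod b7).
  assert (Hs0 : 0 <= s) by (apply Rmult_le_pos; lra).
  assert (Es2 : s ^ 2 = 7 * Cmod b7 ^ 2) by (unfold s; rewrite Rpow_mult_distr, pow2_sqrt by lra; ring).
  assert (Es : Cmod b7 = / sqrt 7 * s) by (unfold s; field; lra).
  rewrite <- Es2 in A.
  pose proof (pow2_ge_0 u).
  split; split; auto.
  - apply (a5_estimate _ s y); auto; try lra.
    rewrite E5. eapply Rle_trans; [apply Cmod_triangle|].
    rewrite !Cmod_mult, !Cmod_R, !Rabs_pos_eq, Es by lra. fold y. unfold Rdiv. right. ring.
  - split.
    + assert (0.37796 < 1 / sqrt 7).
      { apply Rmult_lt_reg_r with (sqrt 7); [lra|]. unfold Rdiv. rewrite Rmult_assoc, Rinv_l; lra. }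
      lra.
    + assert (1 / sqrt 7 < 0.37797).
      { apply Rmult_lt_reg_r with (sqrt 7); [lra|]. unfold Rdiv. rewrite Rmult_assoc, Rinv_l; lra. }
      lra.
  - destruct c_1_is_max as [_ Hmax]. eapply Rle_trans; [|apply (Hmax y); lra].
    (* The determinant equals -2 b_3^3 - 4 b_5^2 + 4 b_3 b_7. Bounding u and s separately, 4 u^2 <=
       4/5 (1 - 3 y^2) and s <= sqrt (1 - 3 y^2) produce the three terms of [c_1_fun]. *)
    unfold hankel3. rewrite ha2, E3, E4, E5.
    replace (2 * b3 * (0 * (2 * b5) - 2 * b3 * (2 * b3)) - 2 * b5 * (2 * b5 - 0 * (2 * b3)) +
      (2 * b7 + 3 * (b3 * b3)) * (2 * b3 - 0 * 0))%C with
      (- RtoC 2 * (b3 * (b3 * b3)) + (- RtoC 4 * (b5 * b5) + 4 * (b3 * b7)))%C by ring.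
    eapply Rle_trans; [apply Cmod_triangle|].
    eapply Rle_trans; [apply Rplus_le_compat_l, Cmod_triangle|].
    rewrite !Cmod_mult, !Cmod_opp, !Cmod_R, !Rabs_pos_eq by lra.
    fold y u. rewrite Es. unfold c_1_fun.
    assert (Hw : 0 <= 1 - 3 * y ^ 2) by nra.
    assert (Hsw : s <= sqrt (1 - 3 * y ^ 2)).
    { rewrite <- (sqrt_pow2 s) by auto. apply sqrt_le_1_alt. lra. }
    set (w := sqrt (1 - 3 * y ^ 2)) in *.
    assert (Hi : 0 < / sqrt 7) by (apply Rinv_0_lt_compat; lra).
    unfold Rdiv. set (i := / sqrt 7) in *.
    assert (Hiy : 0 <= 4 * i * y) by (apply Rmult_le_pos; lra).
    assert (4 * i * y * s <= 4 * i * y * w) by (apply Rmult_le_compat_l; auto).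
    pose proof (pow2_ge_0 s). nra.
Qed.
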